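(* The map $\Phi:\mathfrak{X}/K\to\mathfrak{E}/K$ satisfies the following conditions. (a) If $((r,s),\mu)\in\Pi_2^k$ is of type (I), (II)$^0$, or (III), then $\Phi^{-1}(\mathfrak{O}^K_{((r,s),\mu)})$ is a singleton. (b) If $((r,s),\mu)\in\Pi_2^k$ is of type (II)$^*$, then $\Phi^{-1}(\mathfrak{O}^K_{((r,s),\mu)})$ is a pair (i.e., has exactly two elements). (c) $\Phi$ is a bijection if and only if $p\le\max\{k,n-k,q+1\}$.
   Context: Everything is over $\mathbb{C}$. Let $V=\mathbb{C}^n$ ($n\ge 1$), $p+q=n$, $V_1=\mathbb{C}^p\times\{0\}^q$, $V_2=\{0\}^p\times\mathbb{C}^q$, so $V=V_1\oplus V_2$. Let $K=\mathrm{GL}(V_1)\times\mathrm{GL}(V_2)\subset\mathrm{GL}(V)$. Let $k\in\{0,\ldots,n\}$; $\mathrm{Gr}_k(V)$ is the Grassmann variety of $k$-dimensional subspaces of $V$ and $\mathbb{P}(V_1)$ is the variety of lines $L\subset V_1$. The exotic Grassmannian is $\mathfrak{X}=\mathrm{Gr}_k(V)\times\mathbb{P}(V_1)$ with the diagonal action of $K$. $\mathcal{L}(V)$ is the space of linear endomorphisms of $V$. For $x=\begin{pmatrix} x_1 & x_{12} \\ x_{21} & x_2 \end{pmatrix}\in\mathcal{L}(V)$ (blocks with respect to $V=V_1\oplus V_2$) put $x^{\theta}=\begin{pmatrix} x_1 & 0 \\ 0 & x_2 \end{pmatrix}$ and $x^{-\theta}=\begin{pmatrix} 0 & x_{12}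 \\ x_{21} & 0 \end{pmatrix}$. Let $\mathfrak{s}=\{x\in\mathcal{L}(V): x^\theta=0\}$. The conormal variety is $$\mathcal{Y}=\{(W,L,x)\in\mathrm{Gr}_k(V)\times\mathbb{P}(V_1)\times\mathcal{L}(V):\ \mathrm{Im}\,x\subset W\subset\ker x,\ \mathrm{Im}\,x^\theta\subset L\subset\ker x^\theta\},$$ and the exotic nilpotent cone is $\mathfrak{E}=\mathbb{P}(V_1)\times\mathcal{N}(\mathfrak{s})_2^k$, where $\mathcal{N}(\mathfrak{s})_2^k=\{x\in\mathfrak{s}: x^2=0,\ \mathrm{rk}\,x\le\min\{k,n-k\}\}$. The map $\pi:\mathcal{Y}\to\mathfrak{E}$, $(W,L,x)\mapsto(L,x^{-\theta})$, is well defined, surjective and $K$-equivariant ($K$ acts naturally on subspaces and by conjugation on $\mathcal{L}(V)$). $\mathfrak{X}/K$ and $\mathfrak{E}/K$ are the (finite) sets of $K$-orbits. Definition of $\Phi$. For a $K$-orbit $\mathbb{O}\subset\mathfrak{X}$, the conormal bundle $T^*_{\mathbb{O}}\mathfrak{X}$ is identified with $\{(W,L,x)\in\mathcal{Y}:(W,L)\in\mathbb{O}\}$; its closure is an irreducible component of $\mathcal{Y}$, and every irreducible component arises in this way from a unique $\mathbb{O}$. $\Phi(\mathbb{O})$ is the unique $K$-orbit $\mathfrak{O}\subset\mathfrak{E}$ such that $\overline{T^*_{\mathbb{O}}\mathfrak{X}}\subset\overline{\pi^{-1}(\mathfrak{O})}$. Parameters. $\Pi_2$ is the set of pairs $((r,s),\mu)$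 where $r,s\ge 0$ are integers with $r+s\le\min\{p,q\}$ and $\mu=(\mu_1,\ldots,\mu_{n-(r+s)})$ is a sequence such that: $\mu_1=\cdots=\mu_r=1$; $\mu_{r+1}=\cdots=\mu_{r+s}\in\{0,2\}$; $\mu_{r+s+1}=\cdots=\mu_p\in\{-1,1\}$; $\mu_{p+1}=\cdots=\mu_{n-(r+s)}=0$; at least one $\mu_i$ is $\ge 1$; and $\{-1,2\}\not\subset\{\mu_1,\ldots,\mu_{n-(r+s)}\}$. The element $((r,s),\mu)$ is of type (I) if $\mu_{r+1},\ldots,\mu_p\le 0$; of type (II) if $r+s\ne p$, $\mu_{r+1}=\cdots=\mu_{r+s}=0$ and $\mu_{r+s+1}=\cdots=\mu_p=1$; of type (III) if $s\neq 0$ and $\mu_{r+1}=\cdots=\mu_{r+s}=2$. Let $\Pi_2^k=\{((r,s),\mu)\in\Pi_2: r+s\le\min\{k,n-k\}\}$. An element of $\Pi_2^k$ is of type (II)$^*$ if it is of type (II) and satisfies $q=r+s\le p-2$ and $q<\min\{k,n-k\}$; it is of type (II)$^0$ if it is of type (II) but does not satisfy these relations. For $((r,s),\mu)\in\Pi_2^k$, $\mathfrak{O}^K_{((r,s),\mu)}$ is the set of pairs $\left(L,\begin{pmatrix} 0 & a \\ b & 0 \end{pmatrix}\right)$ with $L\in\mathbb{P}(V_1)$, $ab=0$, $ba=0$, $\mathrm{rk}\,a=r$, $\mathrm{rk}\,b=s$ and: $L\subset\mathrm{Im}\,a$ if the type is (I); $L\subset\ker b$, $L\not\subset\mathrm{Im}\,a$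 if the type is (II); $L\not\subset\ker b$ if the type is (III). It is known that these sets are exactly the $K$-orbits of $\mathfrak{E}$, each arising from a unique element of $\Pi_2^k$. *)

(* Defs.v *)
From HB Require Import structures.
From mathcomp Require Import all_boot all_order all_algebra.
From mathcomp Require Import boolp classical_sets functions reals.
From mathcomp Require Import complex.
From mathcomp Require mpoly.

Set Implicit Arguments.
Unset Strict Implicit.
Unset Printing Implicit Defensive.

Import Order.TTheory GRing.Theory Num.Theory.
Local Open Scope classical_set_scope.
Local Open Scope ring_scope.

(* We take V = F^(p+q) (column vectors), and identify V_1 with F^p and V_2
   with F^q; endomorphisms of V are (p+q) x (p+q) matrices, in block form.
   The definitions are meant for F algebraically closed (here, F = R[i]): the
   Zariski topology below is that of the F-points. *)

Definition mxlin (F : fieldType) (m n : nat) (x : 'M[F]_(m, n)) :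
  'Hom('cV[F]_n, 'cV[F]_m) := linfun (mulmx x).

Notation mxim x := (limg (mxlin x)).
Notation mxker x := (lker (mxlin x)).

Definition inV1 (F : fieldType) (p q : nat) (L : {vspace 'cV[F]_p}) :
  {vspace 'cV[F]_(p + q)} :=
  (mxlin (col_mx (1%:M : 'M[F]_p) (0 : 'M[F]_(q, p))) @: L)%VS.

Definition theta (F : fieldType) (p q : nat) (x : 'M[F]_(p + q)) :
  'M[F]_(p + q) := block_mx (ulsubmx x) 0 0 (drsubmx x).

Definition mtheta (F : fieldType) (p q : nat) (x : 'M[F]_(p + q)) :
  'M[F]_(p + q) := block_mx 0 (ursubmx x) (dlsubmx x) 0.

Definition ptX (F : fieldType) (p q : nat) : Type :=
  ({vspace 'cV[F]_(p + q)} * {vspace 'cV[F]_p})%type.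

Definition ptE (F : fieldType) (p q : nat) : Type :=
  ({vspace 'cV[F]_p} * 'M[F]_(p + q))%type.

Definition ptY (F : fieldType) (p q : nat) : Type :=
  ({vspace 'cV[F]_(p + q)} * {vspace 'cV[F]_p} * 'M[F]_(p + q))%type.

Definition exoticX (F : fieldType) (p q k : nat) : set (ptX F p q) :=
  [set z | \dim z.1 = k /\ \dim z.2 = 1%N].

Definition exoticE (F : fieldType) (p q k : nat) : set (ptE F p q) :=
  [set z | [/\ \dim z.1 = 1%N, theta z.2 = 0, z.2 *m z.2 = 0
             & (\rank z.2 <= minn k (p + q - k))%N]].

Definition conormalY (F : fieldType) (p q k : nat) : set (ptY F p q) :=
  [set y | let: (W, L, x) := y in
     [/\ exoticX k (W, L),
         (mxim x <= W)%VS, (W <= mxker x)%VS,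
         (mxim (theta x) <= inV1 q L)%VS & (inV1 q L <= mxker (theta x))%VS]].

Definition piYE (F : fieldType) (p q : nat) (y : ptY F p q) : ptE F p q :=
  (y.1.2, mtheta y.2).

Definition groupK (F : fieldType) (p q : nat) : set ('M[F]_p * 'M[F]_q) :=
  [set g | (g.1 \in unitmx) /\ (g.2 \in unitmx)].

Definition Kmx (F : fieldType) (p q : nat) (g : 'M[F]_p * 'M[F]_q) :
  'M[F]_(p + q) := block_mx g.1 0 0 g.2.

Definition actX (F : fieldType) (p q : nat) (g : 'M[F]_p * 'M[F]_q)
  (z : ptX F p q) : ptX F p q :=
  ((mxlin (Kmx g) @: z.1)%VS, (mxlin g.1 @: z.2)%VS).

Definition actE (F : fieldType) (p q : nat) (g : 'M[F]_p * 'M[F]_q)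
  (z : ptE F p q) : ptE F p q :=
  ((mxlin g.1 @: z.1)%VS, Kmx g *m z.2 *m invmx (Kmx g)).

Definition orbitsX (F : fieldType) (p q k : nat) : set (set (ptX F p q)) :=
  [set [set actX g z | g in @groupK F p q] | z in exoticX k].

Definition orbitsE (F : fieldType) (p q k : nat) : set (set (ptE F p q)) :=
  [set [set actE g z | g in @groupK F p q] | z in exoticE k].

Definition coordY (F : fieldType) (p q k : nat) (M : 'M[F]_(p + q, k))
  (v : 'cV[F]_p) (x : 'M[F]_(p + q)) :
  'rV[F]_((p + q) * k + (p + (p + q) * (p + q))) :=
  row_mx (mxvec M) (row_mx v^T (mxvec x)).

(* Zariski closed subsets of Gr_k(V) x P(V_1) x L(V), where Gr_k(V) and
   P(V_1) carry the quotient topology from the spaces of injective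
   (p+q) x k matrices and of nonzero vectors: Z is closed when its inverse
   image is the zero locus of polynomials in the entries of (M, v, x). *)
Definition zariski_closed (F : fieldType) (p q k : nat) (Z : set (ptY F p q)) :
  Prop :=
  Z `<=` [set y | exoticX k y.1] /\
  exists A : set (mpoly.mpoly ((p + q) * k + (p + (p + q) * (p + q))) F),
    forall (M : 'M[F]_(p + q, k)) (v : 'cV[F]_p) (x : 'M[F]_(p + q)),
      \rank M = k -> v != 0 ->
      Z (mxim M, <[v]>%VS, x) <->
      forall f, A f -> mpoly.meval (fun i => coordY M v x 0 i) f = 0.

Definition zariski_closure (F : fieldType) (p q k : nat)
  (S : set (ptY F p q)) : set (ptY F p q) :=
  smallest (@zariski_closed F p q k) S.

Definition conormal_bundle (F : fieldType) (p q k : nat)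
  (O : set (ptX F p q)) : set (ptY F p q) :=
  conormalY k `&` [set y | O y.1].

Definition Phi_spec (F : fieldType) (p q k : nat) (O : set (ptX F p q))
  (N : set (ptE F p q)) : Prop :=
  orbitsE k N /\
  zariski_closure k (conormal_bundle k O) `<=`
    zariski_closure k (conormalY k `&` @piYE F p q @^-1` N).

(* "The unique orbit such that": the junk value set0, which is not an orbit,
   is taken if there is no such unique orbit. *)
Definition Phi (F : fieldType) (p q k : nat) (O : set (ptX F p q)) :
  set (ptE F p q) :=
  xget set0 [set N | unique (Phi_spec k O) N].

Definition Phi_fiber (F : fieldType) (p q k : nat) (N : set (ptE F p q)) :
  set (set (ptX F p q)) :=
  orbitsX k `&` Phi k @^-1` [set N].

(* The sequence mu is indexed from 0: mu_i is mu`_(i - 1). *)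
Definition Pi2 (p q r s : nat) (mu : seq int) : Prop :=
  [/\ (r + s <= minn p q)%N /\ size mu = (p + q - (r + s))%N,
      forall i, (i < r)%N -> mu`_i = 1,
      exists2 c : int, c \in [:: 0; 2] &
        forall i, (r <= i < r + s)%N -> mu`_i = c,
      exists2 c : int, c \in [:: -1; 1] &
        forall i, (r + s <= i < p)%N -> mu`_i = c
    & [/\ forall i, (p <= i < p + q - (r + s))%N -> mu`_i = 0,
          exists2 m, m \in mu & 1 <= m
        & ~ ((-1 \in mu) /\ (2 \in mu))]].

Definition Pi2k (p q k r s : nat) (mu : seq int) : Prop :=
  Pi2 p q r s mu /\ (r + s <= minn k (p + q - k))%N.

Definition typeI (p r s : nat) (mu : seq int) : Prop :=
  forall i, (r <= i < p)%N -> mu`_i <= 0.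

Definition typeII (p r s : nat) (mu : seq int) : Prop :=
  [/\ (r + s)%N <> p,
      forall i, (r <= i < r + s)%N -> mu`_i = 0
    & forall i, (r + s <= i < p)%N -> mu`_i = 1].

Definition typeIII (p r s : nat) (mu : seq int) : Prop :=
  s <> 0%N /\ forall i, (r <= i < r + s)%N -> mu`_i = 2.

(* r + s <= p - 2 is an inequality of integers, hence r + s + 2 <= p. *)
Definition star_rel (p q k r s : nat) : Prop :=
  [/\ q = (r + s)%N, (r + s + 2 <= p)%N & (q < minn k (p + q - k))%N].

Definition typeII_star (p q k r s : nat) (mu : seq int) : Prop :=
  typeII p r s mu /\ star_rel p q k r s.

Definition typeII_zero (p q k r s : nat) (mu : seq int) : Prop :=
  typeII p r s mu /\ ~ star_rel p q k r s.

Definition paramOrbitE (F : fieldType) (p q r s : nat) (mu : seq int) :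
  set (ptE F p q) :=
  [set z | let L := z.1 in \dim L = 1%N /\
     exists (a : 'M[F]_(p, q)) (b : 'M[F]_(q, p)),
       [/\ z.2 = block_mx 0 a b 0,
           a *m b = 0 /\ b *m a = 0,
           \rank a = r /\ \rank b = s
         & [/\ typeI p r s mu -> (L <= mxim a)%VS,
               typeII p r s mu -> (L <= mxker b)%VS /\ ~ (L <= mxim a)%VS
             & typeIII p r s mu -> ~ (L <= mxker b)%VS]]].

(* Main.v *)
Require Import Defs.
From HB Require Import structures.
From mathcomp Require Import all_boot all_order all_algebra.
From mathcomp Require Import boolp classical_sets functions reals.
From mathcomp Require Import complex.
From mathcomp Require Import zify.
From mathcomp Require mpoly.
Import -(notations) mpoly.

(** Phi can be computed explicitly on parameters of orbits, and the theorem is read off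
    from the formula.

    The orbit of (W, L) is given by w1 = dim (W /\ V1), w2 = dim (W /\ V2) and the position
    j (0, 1 or 2) of L in the chain W /\ V1 <= pr1 W <= V1 ([orbit_X]). The orbit of
    (L, [[0, a], [b, 0]]) is given by r = rk a, s = rk b and the position of L in the chain
    Im a <= ker b <= V1 ([orbit_E]). Both are normal form statements: bases of V1 and V2 are
    adapted to the chain, to the line and to W, respectively to a and b.

    The conormal vectors at (W, L) are the x = [[x1, a], [b, 0]] of the linear space
    [fibre W L]. With t = k - w1 - w2, u = codim pr2 W = q - k + w1 and
    v = codim pr1 W = p - k + w2, elementary bounds ([fibre_num]) show that rk a and rk b are
    at most the numbers [phi_r] and [phi_s]:
      - j = 0: min (w1, u + 1) if t > 0 and min (w1, u) if t = 0; min (w2, v);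
      - j = 1: min (w1, u); min (w2 + 1, v);
      - j = 2: min (w1, u); min (w2, v).
    Explicit elements of the fibre reach these bounds ([witness_ex]), with L in the position
    [phi_t]. Ranks do not drop at the generic point of the line that joins an arbitrary
    conormal vector to this one, hence the conormal bundle of the orbit (w1, w2, j) is in the
    closure of the preimage of the orbit (phi_r, phi_s, phi_t) ([generic_in_closure]).

    That no other orbit N has this property is usually a dimension count. Here it is shown by
    exhibiting, for each N, closed sets cut out by rank conditions on (W, L, x) that contain
    the preimage of N and exclude a conormal vector ([unique_param]). The conditions
    rk a <= r and rk b <= s give phi_r <= r and phi_s <= s; semicontinuity of dim (W /\ V1)
    and dim (W /\ V2) gives most of the converse; the remaining cases use x1 and the relative
    position of L.

    So Phi is (w1, w2, j) |-> (phi_r, phi_s, phi_t) ([Phi_stratumX]). This map of triples is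
    onto ([phi_surj]) and one-to-one ([phi_inj]) except over the (r, s, 1) with
    r + s = q < k < p. There, both W = (W /\ V1) + (W /\ V2) with L <= W and a subspace with
    j > 0 are sent to the same triple ([phi_star]). Finally q < k < p is equivalent to
    q < min (k, n - k), it implies q <= p - 2, and it means p > max (k, n - k, q + 1). *)

Set Implicit Arguments.
Unset Strict Implicit.
Unset Printing Implicit Defensive.

Import Order.TTheory GRing.Theory Num.Theory.
Local Open Scope classical_set_scope.
Local Open Scope ring_scope.

(** * Column vectors, matrices and bases *)

(** The arithmetic solver processes every hypothesis, and dimensions occur in the context
    in several convertible forms (the carrier of column vectors is a matrix type or a vector
    space). Only the hypotheses on natural numbers are kept, and these are normalized. *)
Ltac keep_nat := intros; repeat match goal with
  | H : ?T |- _ => lazymatch type of T with Prop =>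
      lazymatch T with
      | is_true (leq _ _) => fail
      | is_true (andb _ _) => fail
      | is_true (negb _) => fail
      | _ /\ _ => fail
      | _ \/ _ => fail
      | ~ _ => fail
      | @eq ?A _ _ => lazymatch A with
          | nat => fail | matrix _ _ _ => clear H
          | _ => tryif unify A nat then fail else clear H end
      | _ => clear H
      end end
  end;
  repeat match goal with x := _ |- _ => subst x end.

Ltac dim_lia := keep_nat;
  unfold reverse_coercion in *; simpl Algebra.BaseAddUMagma.sort in *;
  repeat match goal with
  | H : context [@size ?T ?s] |- _ =>
      match type of s with list ?X => tryif constr_eq T X then fail else
        change (@size T s) with (@size X s) in H end
  | |- context [@size ?T ?s] =>
      match type of s with list ?X => tryif constr_eq T X then fail else
        change (@size T s) with (@size X s) end
  end; lia.

Lemma mxlinE (F : fieldType) m n (A : 'M[F]_(m, n)) v : mxlin A v = A *m v.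
Proof. by rewrite lfunE. Qed.

Lemma memv_mxker (F : fieldType) m n (A : 'M[F]_(m, n)) v :
  (v \in mxker A) = (A *m v == 0).
Proof. by rewrite memv_ker mxlinE. Qed.

Lemma memv_mxim (F : fieldType) m n (A : 'M[F]_(m, n)) v : A *m v \in mxim A.
Proof. by rewrite -mxlinE memv_img ?memvf. Qed.

Lemma mxlinM (F : fieldType) m n p (A : 'M[F]_(m, n)) (B : 'M[F]_(n, p)) :
  mxlin (A *m B) = (mxlin A \o mxlin B)%VF.
Proof. by apply/lfunP => v; rewrite comp_lfunE !mxlinE mulmxA. Qed.

Lemma mxlin_im (F : fieldType) m n p (A : 'M[F]_(m, n)) (B : 'M[F]_(n, p)) :
  (mxlin A @: mxim B)%VS = mxim (A *m B).
Proof. by rewrite mxlinM limg_comp. Qed.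

Lemma dim_cV (F : fieldType) n : \dim {:'cV[F]_n} = n.
Proof. by rewrite dimvf /dim /= muln1. Qed.

Lemma mxim_row (F : fieldType) m n1 n2 (A : 'M[F]_(m, n1)) (B : 'M[F]_(m, n2)) :
  mxim (row_mx A B) = (mxim A + mxim B)%VS.
Proof.
apply/eqP; rewrite eqEsubv subv_add; apply/and3P; split; apply/subvP=> _ /memv_imgP[v _ ->];
  rewrite mxlinE.
- by rewrite -[v]vsubmxK mul_row_col memv_add ?memv_mxim.
- by rewrite (_ : A *m v = row_mx A B *m col_mx v 0) ?memv_mxim // mul_row_col mulmx0 addr0.
- by rewrite (_ : B *m v = row_mx A B *m col_mx 0 v) ?memv_mxim // mul_row_col mulmx0 add0r.
Qed.

Lemma mxim_cV (F : fieldType) n (v : 'cV[F]_n) : mxim v = <[v]>%VS.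
Proof.
apply/eqP; rewrite eqEsubv; apply/andP; split.
  apply/subvP=> _ /memv_imgP[c _ ->]; rewrite mxlinE [c]mx11_scalar mul_mx_scalar.
  by rewrite memvZ ?memv_line.
by rewrite -memvE -[v in v \in _]mulmx1 memv_mxim.
Qed.

(** A right-invertible factor is onto, so it does not change the image. *)
Lemma mxim_mul_full (F : fieldType) m n r (C : 'M[F]_(m, r)) (B : 'M[F]_(r, n)) R :
  B *m R = 1%:M -> mxim (C *m B) = mxim C.
Proof.
move=> hR; apply/eqP; rewrite eqEsubv; apply/andP; split; apply/subvP=> _ /memv_imgP[v _ ->].
  by rewrite mxlinE -mulmxA; exact: memv_mxim.
rewrite mxlinE (_ : C *m v = C *m B *m (R *m v)); first exact: memv_mxim.
by rewrite -!mulmxA (mulmxA B) hR mul1mx.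
Qed.

(** The rank is defined through the row space; a full rank factorization of A transfers
    it to the column space. *)
Lemma dim_mxim (F : fieldType) m n (A : 'M[F]_(m, n)) : \dim (mxim A) = \rank A.
Proof.
have Rf := row_base_free A; have Cf : row_free (col_base A)^T.
  by rewrite /row_free mxrank_tr; apply: col_base_full.
case/row_freeP: Rf => R hR; case/row_freeP: Cf => C hC.
have hC' : C^T *m col_base A = 1%:M by rewrite -[LHS]trmxK trmx_mul trmxK hC trmx1.
rewrite -{1}(mulmx_base A) (mxim_mul_full _ hR).
rewrite limg_dim_eq ?dim_cV // capfv; apply/eqP/lker0P => x y; rewrite !mxlinE => e.
by have := congr1 (mulmx C^T) e; rewrite (mulmxA _ _ x) (mulmxA _ _ y) hC' !mul1mx.
Qed.

Lemma dim_mxker (F : fieldType) m n (A : 'M[F]_(m, n)) : (\dim (mxker A) + \rank A)%N = n.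
Proof. by rewrite -dim_mxim -[RHS](@dim_cV F) -(limg_ker_dim (mxlin A) fullv) capfv. Qed.

Lemma rank_sub (F : fieldType) m n (A : 'M[F]_(m, n)) (U : {vspace 'cV[F]_m}) :
  (mxim A <= U)%VS -> (\rank A <= \dim U)%N.
Proof. by rewrite -dim_mxim; apply: dimvS. Qed.

Lemma mxim_ex (F : fieldType) n k (W : {vspace 'cV[F]_n}) : \dim W = k ->
  exists2 M : 'M[F]_(n, k), mxim M = W & \rank M = k.
Proof.
move=> <-; pose M := \matrix_(i < n, j < \dim W) (vbasis W)`_j i 0.
suff h : mxim M = W by exists M; rewrite // -dim_mxim h.
have hM x : M *m x = \sum_i x i 0 *: (vbasis W)`_i.
  apply/colP => i; rewrite mxE summxE; apply: eq_bigr => j _.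
  by rewrite !mxE mulrC.
apply/eqP; rewrite eqEsubv; apply/andP; split; apply/subvP => v.
  case/memv_imgP => x _ ->; rewrite mxlinE hM memv_suml // => i _.
  by rewrite memvZ // vbasis_mem // mem_nth // size_tuple.
move/coord_vbasis => ->.
rewrite (_ : \sum_(i < _) _ = M *m \col_i coord (vbasis W) i v) ?memv_mxim // hM.
by apply: eq_bigr => i _; rewrite mxE.
Qed.

Lemma line_generator (F : fieldType) n (L : {vspace 'cV[F]_n}) : \dim L = 1%N ->
  exists2 v, v != 0 & L = <[v]>%VS.
Proof.
move=> h; exists (vpick L); first by rewrite vpick0 -dimv_eq0 h.
apply/esym/eqP; rewrite eqEdim -memvE memv_pick /= h dim_vline.
by rewrite vpick0 -dimv_eq0 h.
Qed.

Definition is_basis (F : fieldType) n (e : seq 'cV[F]_n) :=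
  size e = n /\ <<e>>%VS = fullv.

Lemma is_basis_free (F : fieldType) n (e : seq 'cV[F]_n) : is_basis e -> free e.
Proof. by case=> hs hf; rewrite /free hf dim_cV hs. Qed.

Definition seqmx (F : fieldType) m n (s : seq 'cV[F]_m) : 'M[F]_(m, n) :=
  \matrix_(i, j) s`_j i 0.

Lemma seqmx_delta (F : fieldType) m n (s : seq 'cV[F]_m) (j : 'I_n) :
  seqmx n s *m delta_mx j 0 = s`_j.
Proof. by rewrite -colE; apply/colP => i; rewrite !mxE. Qed.

Lemma seqmx_unit (F : fieldType) n (s : seq 'cV[F]_n) : is_basis s -> seqmx n s \in unitmx.
Proof.
case=> hs hf; rewrite -row_full_unit /row_full -dim_mxim.
rewrite (_ : mxim _ = fullv) ?dim_cV //; apply/eqP; rewrite eqEsubv subvf -{1}hf /=.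
apply/span_subvP => v /(nthP 0)[i hi <-]; rewrite hs in hi.
by rewrite -(seqmx_delta s (Ordinal hi)); exact: memv_mxim.
Qed.

Lemma mx_on_basis (F : fieldType) m n (f : seq 'cV[F]_n) (z : seq 'cV[F]_m) :
  is_basis f -> size z = n -> exists A : 'M[F]_(m, n), map (mulmx A) f = z.
Proof.
move=> hf hz; exists (seqmx n z *m invmx (seqmx n f)).
have hs : size f = n by case: hf.
apply: (@eq_from_nth _ 0); first by rewrite size_map hz.
move=> i; rewrite size_map hs => hi.
rewrite (nth_map 0) ?hs // -(seqmx_delta f (Ordinal hi)) -mulmxA mulKmx ?seqmx_unit //.
by rewrite seqmx_delta.
Qed.

Lemma mx_eq_basis (F : fieldType) m n (f : seq 'cV[F]_n) (A B : 'M[F]_(m, n)) :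
  <<f>>%VS = fullv -> map (mulmx A) f = map (mulmx B) f -> A = B.
Proof.
move=> hf e; have : mxlin A = mxlin B.
  apply/eqP; apply: contraT => /lfunPn[v]; suff -> : mxlin A v = mxlin B v by rewrite eqxx.
  apply/eqP; rewrite -subr_eq0 -opp_lfunE -add_lfunE -memv_ker.
  have : (fullv <= lker (mxlin A - mxlin B))%VS.
    rewrite -hf; apply/span_subvP => w /(nthP 0)[i hi <-].
    apply/eqlfunP; rewrite !mxlinE.
    by have := congr1 (fun s => s`_i) e; rewrite !(nth_map 0).
  by move/subvP; apply; rewrite memvf.
move=> h; apply/matrixP => i j.
have := congr1 (fun g : 'Hom('cV[F]_n, 'cV[F]_m) => (g (delta_mx j 0) : 'cV_m) i 0) h.
by rewrite !mxlinE -!colE !mxE.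
Qed.

Lemma unit_im (F : fieldType) n (A : 'M[F]_n) : (A \in unitmx) = (mxim A == fullv).
Proof.
by rewrite -row_full_unit /row_full eqEdim subvf dim_cV dim_mxim eqn_leq rank_leq_row.
Qed.

Lemma mxim_basis (F : fieldType) m n (A : 'M[F]_(m, n)) (f : seq 'cV[F]_n) :
  <<f>>%VS = fullv -> mxim A = <<map (mulmx A) f>>%VS.
Proof.
move=> <-; rewrite limg_span; congr (<<_>>)%VS; apply: eq_map => v; exact: mxlinE.
Qed.

Lemma GL_on_basis (F : fieldType) n (e e' : seq 'cV[F]_n) : is_basis e -> is_basis e' ->
  exists2 g : 'M[F]_n, g \in unitmx & map (mulmx g) e = e'.
Proof.
move=> he [hs' hf']; have [g hg] := mx_on_basis he hs'; exists g => //.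
by rewrite unit_im (mxim_basis _ he.2) hg hf'.
Qed.

(** * Bases adapted to a subspace and a line *)

(** The position of L in the chain U1 <= U2 <= V, for a line L: the index of the first step
    that contains it. *)
Definition pos (F : fieldType) (vT : vectType F) (U1 U2 L : {vspace vT}) : nat :=
  if (L <= U1)%VS then 0 else if (L <= U2)%VS then 1 else 2.

Lemma ext_basis (F : fieldType) n (U U' : {vspace 'cV[F]_n}) : (U <= U')%VS ->
  exists X : seq 'cV[F]_n, (U + <<X>> = U')%VS /\ (\dim U + size X = \dim U')%N.
Proof.
move=> h; exists (vbasis (U' :\: U)%VS).
rewrite (span_basis (vbasisP _)) addvC addv_diff (addv_idPl h); split=> //.
by rewrite size_tuple -(dimv_cap_compl U' U) (capv_idPr h).
Qed.

(** A basis of a complement of U + <[v]> is extended by v. *)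
Lemma ext_basis_through (F : fieldType) n (U U' : {vspace 'cV[F]_n}) (v : 'cV[F]_n) :
  (U <= U')%VS -> v \in U' -> v \notin U ->
  exists X : seq 'cV[F]_n, (U + <<v :: X>> = U')%VS /\ (\dim U + size (v :: X) = \dim U')%N.
Proof.
move=> h hv hv'; have hU : (U + <[v]> <= U')%VS by rewrite subv_add h -memvE.
have [X [h1 h2]] := ext_basis hU; exists X; rewrite span_cons addvA; split=> //=.
have v0 : v != 0 by apply: contraNneq hv' => ->; rewrite mem0v.
rewrite -h2 -addSnnS; congr addn; rewrite dimv_disjoint_sum ?dim_vline ?v0 ?addn1 //.
apply/eqP; rewrite -subv0; apply/subvP => w /memv_capP[wU /vlineP[c hc]].
rewrite memv0; move: wU; rewrite hc; have [->|c0] := eqVneq c 0; first by rewrite scale0r.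
move/(memvZ c^-1); rewrite scalerA mulVf // scale1r => hU'.
by rewrite hU' in hv'.
Qed.

(** The generator of L is inserted as the first new vector of the step of the chain in
    which L appears. *)
Lemma chain_basis (F : fieldType) n (U1 U2 L : {vspace 'cV[F]_n}) :
  (U1 <= U2)%VS -> \dim L = 1%N ->
  exists e1 e2 e3 : seq 'cV[F]_n,
    [/\ <<e1>>%VS = U1, <<e1 ++ e2>>%VS = U2, <<e1 ++ e2 ++ e3>>%VS = fullv,
        [/\ size e1 = \dim U1, (size e1 + size e2)%N = \dim U2
          & (size e1 + size e2 + size e3)%N = n]
      & L = <[head 0%R (nth [::] [:: e1; e2; e3] (pos U1 U2 L))]>%VS].
Proof.
move=> h12 hL; pose v := vpick L.
have hLv : L = <[v]>%VS.
  apply/esym/eqP; rewrite eqEdim -memvE memv_pick /= hL dim_vline.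
  by rewrite vpick0 -dimv_eq0 hL.
have mem U : (L <= U)%VS = (v \in U) by rewrite hLv memvE.
have ext U U' (b : bool) : (U <= U')%VS -> (b -> v \in U' /\ v \notin U) ->
    exists X : seq 'cV[F]_n, [/\ (U + <<X>> = U')%VS, (\dim U + size X = \dim U')%N & b ->
      head 0 X = v].
  move=> hU; case: b => hb; last by have [X [? ?]] := ext_basis hU; exists X; split.
  have [//|vU' vU] := hb.
  by have [X [? ?]] := ext_basis_through hU vU' vU; exists (v :: X); split.
have [e1 [a1 b1 c1]] : exists X : seq 'cV[F]_n,
    [/\ (0 + <<X>> = U1)%VS, (\dim
      (0%VS : {vspace 'cV[F]_n}) + size X = \dim U1)%N & pos U1 U2 L == 0%N -> head 0 X = v].
  apply: ext; rewrite ?sub0v // /pos !mem; case: ifP; last by case: ifP.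
  by move=> _ _; split=> //; rewrite memv0 /v vpick0 -dimv_eq0 hL.
have [e2 [a2 b2 c2]] : exists X : seq 'cV[F]_n,
    [/\ (U1 + <<X>> = U2)%VS, (\dim U1 + size X = \dim U2)%N & pos U1 U2 L == 1%N ->
      head 0 X = v].
  by apply: ext => //; rewrite /pos !mem; case: ifP => // _; case: ifP.
have [e3 [a3 b3 c3]] : exists X : seq 'cV[F]_n,
    [/\ (U2 + <<X>> = fullv)%VS,
      (\dim U2 + size X = \dim {:'cV[F]_n})%N & pos U1 U2 L == 2%N -> head 0 X = v].
  apply: ext; rewrite ?subvf // /pos !mem; case: ifP => // _; case: ifP => // _ _.
  by rewrite memvf.
rewrite add0v in a1; rewrite dimv0 add0n in b1; rewrite dim_cV in b3.
exists e1, e2, e3; rewrite !span_cat a1 addvA a2 a3 b1 b2 b3; split=> //.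
rewrite {1}hLv; congr <[_]>%VS; move: c1 c2 c3; rewrite /pos.
by case: ifP => _ /=; [|case: ifP => _ /=] => c1 c2 c3; rewrite ?c1 ?c2 ?c3.
Qed.

Definition in1 (F : fieldType) p q : 'M[F]_(p + q, p) := col_mx 1%:M 0.
Definition in2 (F : fieldType) p q : 'M[F]_(p + q, q) := col_mx 0 1%:M.
Definition pr1 (F : fieldType) p q : 'M[F]_(p, p + q) := row_mx 1%:M 0.
Definition pr2 (F : fieldType) p q : 'M[F]_(q, p + q) := row_mx 0 1%:M.

Lemma in1E (F : fieldType) p q (x : 'cV[F]_p) : in1 F p q *m x = col_mx x 0.
Proof. by rewrite mul_col_mx mul1mx mul0mx. Qed.
Lemma in2E (F : fieldType) p q (x : 'cV[F]_q) : in2 F p q *m x = col_mx 0 x.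
Proof. by rewrite mul_col_mx mul1mx mul0mx. Qed.
Lemma pr1E (F : fieldType) p q (x : 'cV[F]_p) (y : 'cV[F]_q) : pr1 F p q *m col_mx x y = x.
Proof. by rewrite mul_row_col mul1mx mul0mx addr0. Qed.
Lemma pr2E (F : fieldType) p q (x : 'cV[F]_p) (y : 'cV[F]_q) : pr2 F p q *m col_mx x y = y.
Proof. by rewrite mul_row_col mul1mx mul0mx add0r. Qed.

Definition meet1 (F : fieldType) p q (W : {vspace 'cV[F]_(p + q)}) : {vspace 'cV[F]_p} :=
  (mxlin (in1 F p q) @^-1: W)%VS.
Definition meet2 (F : fieldType) p q (W : {vspace 'cV[F]_(p + q)}) : {vspace 'cV[F]_q} :=
  (mxlin (in2 F p q) @^-1: W)%VS.
Definition proj1 (F : fieldType) p q (W : {vspace 'cV[F]_(p + q)}) : {vspace 'cV[F]_p} :=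
  (mxlin (pr1 F p q) @: W)%VS.
Definition proj2 (F : fieldType) p q (W : {vspace 'cV[F]_(p + q)}) : {vspace 'cV[F]_q} :=
  (mxlin (pr2 F p q) @: W)%VS.

Lemma mem_meet1 (F : fieldType) p q (W : {vspace 'cV[F]_(p + q)}) (x : 'cV_p) :
  (x \in meet1 W) = (col_mx x 0 \in W).
Proof. by rewrite -in1E -mxlinE; apply/esym; exact: memv_preim. Qed.
Lemma mem_meet2 (F : fieldType) p q (W : {vspace 'cV[F]_(p + q)}) (x : 'cV_q) :
  (x \in meet2 W) = (col_mx 0 x \in W).
Proof. by rewrite -in2E -mxlinE; apply/esym; exact: memv_preim. Qed.

Lemma mem_proj1 (F : fieldType) p q (W : {vspace 'cV[F]_(p + q)}) x y :
  col_mx x y \in W -> x \in proj1 W.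
Proof. by move/(memv_img (mxlin (pr1 F p q))); rewrite mxlinE pr1E. Qed.
Lemma mem_proj2 (F : fieldType) p q (W : {vspace 'cV[F]_(p + q)}) x y :
  col_mx x y \in W -> y \in proj2 W.
Proof. by move/(memv_img (mxlin (pr2 F p q))); rewrite mxlinE pr2E. Qed.

Lemma proj1_ex (F : fieldType) p q (W : {vspace 'cV[F]_(p + q)}) (x : 'cV_p) :
  x \in proj1 W -> exists y, col_mx x y \in W.
Proof.
case/memv_imgP => w; rewrite -[w]vsubmxK => hw ->; exists (dsubmx w).
by rewrite mxlinE pr1E.
Qed.
Lemma proj2_ex (F : fieldType) p q (W : {vspace 'cV[F]_(p + q)}) (y : 'cV_q) :
  y \in proj2 W -> exists x, col_mx x y \in W.
Proof.
case/memv_imgP => w; rewrite -[w]vsubmxK => hw ->; exists (usubmx w).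
by rewrite mxlinE pr2E.
Qed.

Lemma dim_meet2_proj1 (F : fieldType) p q (W : {vspace 'cV[F]_(p + q)}) :
  (\dim (meet2 W) + \dim (proj1 W))%N = \dim W.
Proof.
rewrite -(limg_ker_dim (mxlin (pr1 F p q)) W); congr addn.
rewrite -(@limg_dim_eq _ _ _ (mxlin (in2 F p q))); last first.
  apply/eqP; rewrite -subv0; apply: subv_trans (capvSr _ _) _; apply/subvP => y.
  rewrite memv_ker mxlinE in2E col_mx_eq0 => /andP[_ /eqP ->]; exact: mem0v.
congr (\dim _); apply/eqP; rewrite eqEsubv; apply/andP; split; apply/subvP => w.
  case/memv_imgP => y hy ->; rewrite mxlinE in2E memv_cap memv_ker mxlinE pr1E eqxx andbT.
  by rewrite -mem_meet2.
rewrite memv_cap memv_ker mxlinE -[w]vsubmxK pr1E => /andP[hw /eqP h0].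
by rewrite h0 in hw *; rewrite -in2E -mxlinE memv_img // mem_meet2.
Qed.

Lemma dim_meet1_proj2 (F : fieldType) p q (W : {vspace 'cV[F]_(p + q)}) :
  (\dim (meet1 W) + \dim (proj2 W))%N = \dim W.
Proof.
rewrite -(limg_ker_dim (mxlin (pr2 F p q)) W); congr addn.
rewrite -(@limg_dim_eq _ _ _ (mxlin (in1 F p q))); last first.
  apply/eqP; rewrite -subv0; apply: subv_trans (capvSr _ _) _; apply/subvP => y.
  rewrite memv_ker mxlinE in1E col_mx_eq0 => /andP[/eqP -> _]; exact: mem0v.
congr (\dim _); apply/eqP; rewrite eqEsubv; apply/andP; split; apply/subvP => w.
  case/memv_imgP => y hy ->; rewrite mxlinE in1E memv_cap memv_ker mxlinE pr2E eqxx andbT.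
  by rewrite -mem_meet1.
rewrite memv_cap memv_ker mxlinE -[w]vsubmxK pr2E => /andP[hw /eqP h0].
by rewrite h0 in hw *; rewrite -in1E -mxlinE memv_img // mem_meet1.
Qed.

Lemma meet1_proj1 (F : fieldType) p q (W : {vspace 'cV[F]_(p + q)}) : (meet1 W <= proj1 W)%VS.
Proof. by apply/subvP => x; rewrite mem_meet1; apply: mem_proj1. Qed.
Lemma meet2_proj2 (F : fieldType) p q (W : {vspace 'cV[F]_(p + q)}) : (meet2 W <= proj2 W)%VS.
Proof. by apply/subvP => x; rewrite mem_meet2; apply: mem_proj2. Qed.

(** A subspace W of V1 + V2 is the graph of an isomorphism from proj1 W / meet1 W to
    proj2 W / meet2 W: e1 and f2 are bases of meet1 W and meet2 W, and e2, f1 lift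
    corresponding bases of the two quotients. *)
Definition glue (F : fieldType) p q (e1 e2 : seq 'cV[F]_p) (f1 f2 : seq 'cV[F]_q) :=
  [seq col_mx x 0 | x <- e1] ++ [seq col_mx z.1 z.2 | z <- zip e2 f1]
    ++ [seq col_mx 0 y | y <- f2].

Lemma glue1 (F : fieldType) p q (e1 e2 : seq 'cV[F]_p) (f1 f2 : seq 'cV[F]_q) x :
  x \in e1 -> col_mx x 0 \in <<glue e1 e2 f1 f2>>%VS.
Proof.
by move=> hx; apply: memv_span; rewrite !mem_cat; apply/or3P/Or31/(map_f (fun x => col_mx x 0)).
Qed.

Lemma glue3 (F : fieldType) p q (e1 e2 : seq 'cV[F]_p) (f1 f2 : seq 'cV[F]_q) y :
  y \in f2 -> col_mx 0 y \in <<glue e1 e2 f1 f2>>%VS.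
Proof.
by move=> hx; apply: memv_span; rewrite !mem_cat; apply/or3P/Or33/(map_f (fun y => col_mx 0 y)).
Qed.

Lemma glue_sub (F : fieldType) p q (e1 e2 : seq 'cV[F]_p) (f1 f2 : seq 'cV[F]_q)
    (W : {vspace 'cV[F]_(p + q)}) :
  (forall x, x \in e1 -> col_mx x 0 \in W) ->
  (forall i, (i < size e2)%N -> (i < size f1)%N -> col_mx e2`_i f1`_i \in W) ->
  (forall y, y \in f2 -> col_mx 0 y \in W) -> (<<glue e1 e2 f1 f2>> <= W)%VS.
Proof.
move=> h1 h2 h3; apply/span_subvP => w; rewrite !mem_cat => /or3P[] /mapP[x hx ->].
- exact: h1.
- have := hx; case/(nthP ((0 : 'cV[F]_p), (0 : 'cV[F]_q))) => i.
  rewrite size_zip leq_min => /andP[i1 i2]; rewrite nth_zip_cond size_zip leq_min i1 i2 /=.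
  by move=> <-; apply: h2.
- exact: h3.
Qed.

Definition adapted (F : fieldType) p q (W : {vspace 'cV[F]_(p + q)})
    (e1 e2 e3 : seq 'cV[F]_p) (f1 f2 f3 : seq 'cV[F]_q) :=
  [/\ is_basis (e1 ++ e2 ++ e3), is_basis (f1 ++ f2 ++ f3), size e2 = size f1
    & W = <<glue e1 e2 f1 f2>>%VS].

Lemma span_zeros (F : fieldType) (vT : vectType F) n : <<nseq n (0%R : vT)>>%VS = 0%VS.
Proof.
by apply/eqP; rewrite -subv0; apply/span_subvP => v /nseqP[-> _]; rewrite mem0v.
Qed.

Lemma proj1_glue (F : fieldType) p q (e1 e2 : seq 'cV[F]_p) (f1 f2 : seq 'cV[F]_q) :
  size e2 = size f1 -> proj1 <<glue e1 e2 f1 f2>> = <<e1 ++ e2>>%VS.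
Proof.
move=> hs; rewrite /proj1 limg_span /glue !map_cat -!map_comp !span_cat.
rewrite (@eq_map _ _ _ id) ?map_id; last by move=> x /=; rewrite mxlinE pr1E.
rewrite (@eq_map _ _ _ fst); last by move=> x /=; rewrite mxlinE pr1E.
rewrite -/(unzip1 _) unzip1_zip ?hs // (@eq_map _ _ _ (fun=> 0)); last first.
  by move=> x /=; rewrite mxlinE pr1E.
by rewrite (_ : map _ f2 = nseq (size f2) 0) ?span_zeros ?addv0 //; elim: f2 => //= ? ? ->.
Qed.

Lemma proj2_glue (F : fieldType) p q (e1 e2 : seq 'cV[F]_p) (f1 f2 : seq 'cV[F]_q) :
  size e2 = size f1 -> proj2 <<glue e1 e2 f1 f2>> = <<f1 ++ f2>>%VS.
Proof.
move=> hs; rewrite /proj2 limg_span /glue !map_cat -!map_comp !span_cat.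
rewrite [X in (<<X>> + _)%VS](@eq_map _ _ _ (fun=> 0)); last by move=> x /=; rewrite mxlinE pr2E.
rewrite (_ : map _ e1 = nseq (size e1) 0) ?span_zeros ?add0v //; last by elim: e1 => //= ? ? ->.
rewrite (@eq_map _ _ _ snd); last by move=> x /=; rewrite mxlinE pr2E.
rewrite -/(unzip2 _) unzip2_zip ?hs // (@eq_map _ _ _ id) ?map_id //.
by move=> x /=; rewrite mxlinE pr2E.
Qed.

Lemma free_dim (F : fieldType) n (X : seq 'cV[F]_n) : free X -> \dim <<X>> = size X.
Proof. by rewrite /free => /eqP. Qed.

(** The spans of e1 and f2 are in meet1 W and meet2 W; the dimensions of the
    projections leave no room for more. *)
Lemma adapted_spaces (F : fieldType) p q (W : {vspace 'cV[F]_(p + q)}) e1 e2 e3 f1 f2 f3 :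
  adapted W e1 e2 e3 f1 f2 f3 ->
  [/\ meet1 W = <<e1>>%VS, proj1 W = <<e1 ++ e2>>%VS, meet2 W = <<f2>>%VS
    & proj2 W = <<f1 ++ f2>>%VS] /\
  [/\ \dim (meet1 W) = size e1, \dim (meet2 W) = size f2 &
      \dim W = (size e1 + size e2 + size f2)%N].
Proof.
case=> he hf hs hW; have eP1 := proj1_glue e1 f2 hs; have eP2 := proj2_glue e1 f2 hs.
rewrite -hW in eP1 eP2.
have/is_basis_free := he; rewrite catA => /catl_free fe12.
have/is_basis_free := hf; rewrite catA => /catl_free ff12.
have fe1 := catl_free fe12; have ff2 := catr_free ff12.
have s2 : (<<f2>> <= meet2 W)%VS.
  by apply/span_subvP => y hy; rewrite mem_meet2 hW; exact: glue3.
have s1 : (<<e1>> <= meet1 W)%VS.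
  by apply/span_subvP => y hy; rewrite mem_meet1 hW; exact: glue1.
have dW : (\dim W <= size e1 + size e2 + size f2)%N.
  have h := dim_span (glue e1 e2 f1 f2).
  have hsz : size (glue e1 e2 f1 f2) = (size e1 + size e2 + size f2)%N.
    by rewrite !size_cat !size_map size_zip hs minnn addnA.
  by rewrite hW -hsz.
have d1 := dim_meet1_proj2 W; have d2 := dim_meet2_proj1 W.
have l1 := dimvS s1; have l2 := dimvS s2.
have dP1 : \dim (proj1 W) = (size e1 + size e2)%N by rewrite eP1 free_dim // size_cat.
have dP2 : \dim (proj2 W) = (size f1 + size f2)%N by rewrite eP2 free_dim // size_cat.
rewrite (free_dim fe1) in l1; rewrite (free_dim ff2) in l2.
split; split=> //; try dim_lia.
  by apply/esym/eqP; rewrite eqEdim s1 (free_dim fe1); dim_lia.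
by apply/esym/eqP; rewrite eqEdim s2 (free_dim ff2); dim_lia.
Qed.

(** Each vector of e2 is in proj1 W, and f1 consists of second components of vectors of
    W above e2. *)
Lemma adapted_ex (F : fieldType) p q (W : {vspace 'cV[F]_(p + q)}) (L : {vspace 'cV[F]_p}) :
  \dim L = 1%N -> exists e1 e2 e3 f1 f2 f3, adapted W e1 e2 e3 f1 f2 f3 /\
    L = <[head 0%R (nth [::] [:: e1; e2; e3] (pos (meet1 W) (proj1 W) L))]>%VS.
Proof.
move=> hL; have [e1 [e2 [e3 [h1 h2 h3 [s1 s2 s3] hLe]]]] := chain_basis (meet1_proj1 W) hL.
have lift x : x \in proj1 W -> {y : 'cV[F]_q | col_mx x y \in W}.
  by move=> hx; apply: cid; apply: proj1_ex.
pose lft x := if @idP (x \in proj1 W) is ReflectT h then sval (lift _ h) else 0.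
have hlft x : x \in proj1 W -> col_mx x (lft x) \in W.
  by move=> hx; rewrite /lft; case: {-}_ / idP => // h; exact: (svalP (lift _ h)).
pose f1 := map lft e2; pose f2 : seq 'cV[F]_q := vbasis (meet2 W).
have hs : size e2 = size f1 by rewrite size_map.
have hf2 : <<f2>>%VS = meet2 W by exact: (span_basis (vbasisP _)).
have sf2 : size f2 = \dim (meet2 W) by rewrite size_tuple.
have hW : W = <<glue e1 e2 f1 f2>>%VS.
  have sub : (<<glue e1 e2 f1 f2>> <= W)%VS.
    apply: glue_sub => [x hx|i hi _|y hy].
    - by rewrite -mem_meet1 -h1 memv_span.
    - rewrite (nth_map 0) // hlft // -h2 memv_span // mem_cat.
      by rewrite mem_nth ?orbT.
    by rewrite -mem_meet2 -hf2 memv_span.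
  apply/esym/eqP; rewrite eqEdim sub -(dim_meet2_proj1 W).
  rewrite -(dim_meet2_proj1 <<_>>) proj1_glue // h2 leq_add2r dimvS // -hf2.
  by apply/span_subvP => y hy; rewrite mem_meet2; exact: glue3.
have hP2 : proj2 W = <<f1 ++ f2>>%VS by rewrite {1}hW proj2_glue.
have [f3 [h4 h5]] := ext_basis (subvf (proj2 W)).
exists e1, e2, e3, f1, f2, f3; split=> //; split=> //.
  by split; rewrite // !size_cat addnA s3.
split; last by rewrite catA span_cat -hP2.
rewrite !size_cat addnA sf2 -hs -[RHS](@dim_cV F) -h5; congr addn.
have := dim_meet1_proj2 W; have := dim_meet2_proj1 W; dim_lia.
Qed.

Lemma map_glue (F : fieldType) p q (g1 : 'M[F]_p) (g2 : 'M[F]_q) e1 e2 f1 f2 :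
  map (mxlin (Kmx (g1, g2))) (glue e1 e2 f1 f2) =
  glue (map (mulmx g1) e1) (map (mulmx g1) e2) (map (mulmx g2) f1) (map (mulmx g2) f2).
Proof.
have E x y : mxlin (Kmx (g1, g2)) (col_mx x y) = col_mx (g1 *m x) (g2 *m y).
  by rewrite mxlinE mul_block_col !mul0mx addr0 add0r.
rewrite /glue !map_cat -!map_comp; congr (_ ++ (_ ++ _)).
- by apply: eq_map => x /=; rewrite E mulmx0.
- by elim: e2 f1 => [|x e2 IH] [|y f1] //=; rewrite E IH.
- by apply: eq_map => x /=; rewrite E mulmx0.
Qed.

(** K acts simply transitively on the pairs of bases of V1 and V2. *)
Lemma adapted_conj (F : fieldType) p q (W W' : {vspace 'cV[F]_(p + q)})
    e1 e2 e3 f1 f2 f3 e1' e2' e3' f1' f2' f3' :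
  adapted W e1 e2 e3 f1 f2 f3 -> adapted W' e1' e2' e3' f1' f2' f3' ->
  size e1 = size e1' -> size e2 = size e2' -> size f2 = size f2' ->
  exists g, [/\ @groupK F p q g, (mxlin (Kmx g) @: W)%VS = W',
    [/\ map (mulmx g.1) e1 = e1', map (mulmx g.1) e2 = e2' & map (mulmx g.1) e3 = e3']
  & [/\ map (mulmx g.2) f1 = f1', map (mulmx g.2) f2 = f2' & map (mulmx g.2) f3 = f3']].
Proof.
move=> [he hf hs hW] [he' hf' hs' hW'] q1 q2 q3.
have [g1 u1] := GL_on_basis he he'; have [g2 u2] := GL_on_basis hf hf'.
rewrite !map_cat => /eqP; rewrite eqseq_cat ?size_map -?hs -?hs' // => /andP[/eqP k4].
rewrite eqseq_cat ?size_map // => /andP[/eqP k5 /eqP k6].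
move=> /eqP; rewrite eqseq_cat ?size_map // => /andP[/eqP k1].
rewrite eqseq_cat ?size_map // => /andP[/eqP k2 /eqP k3].
exists (g1, g2); split=> //.
by rewrite hW limg_span map_glue k1 k2 k4 k5 hW'.
Qed.

(** * Classification of the orbits *)

(** The nonempty ones are the K-orbits of pairs (W, L), see [orbit_X]. *)
Definition stratumX (F : fieldType) (p q k w1 w2 j : nat) : set (ptX F p q) :=
  [set z | exoticX k z /\ [/\ \dim (meet1 z.1) = w1, \dim (meet2 z.1) = w2
     & pos (meet1 z.1) (proj1 z.1) z.2 = j]].

(** The nonempty ones are the K-orbits of the exotic nilpotent cone, see [orbit_E]. *)
Definition stratumE (F : fieldType) (p q k r s j : nat) : set (ptE F p q) :=
  [set z | exoticE k z /\ [/\ \rank (ursubmx z.2) = r, \rank (dlsubmx z.2) = s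
     & pos (mxim (ursubmx z.2)) (mxker (dlsubmx z.2)) z.1 = j]].

Lemma lker_unit (F : fieldType) n (g : 'M[F]_n) : g \in unitmx -> lker (mxlin g) == 0%VS.
Proof.
move=> hg; apply/lker0P => x y; rewrite !mxlinE => e.
by rewrite -[x](mulKmx hg) e mulKmx.
Qed.

Lemma pos_img (F : fieldType) (vT : vectType F) (g : 'End(vT)) (U1 U2 L : {vspace vT}) :
  lker g == 0%VS -> pos (g @: U1)%VS (g @: U2)%VS (g @: L)%VS = pos U1 U2 L.
Proof. by move=> h; rewrite /pos !limg_ker0. Qed.

Lemma Kmx_col (F : fieldType) p q (g : 'M[F]_p * 'M[F]_q) (x : 'cV_p) (y : 'cV_q) :
  Kmx g *m col_mx x y = col_mx (g.1 *m x) (g.2 *m y).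
Proof. by rewrite mul_block_col !mul0mx addr0 add0r. Qed.

Lemma Kmx_unit (F : fieldType) p q (g : 'M[F]_p * 'M[F]_q) : groupK g -> Kmx g \in unitmx.
Proof. by case=> h1 h2; rewrite unitmxE det_ublock unitrM -!unitmxE h1 h2. Qed.

Lemma proj1_act (F : fieldType) p q (g : 'M[F]_p * 'M[F]_q) W :
  proj1 (mxlin (Kmx g) @: W)%VS = (mxlin g.1 @: proj1 W)%VS.
Proof.
rewrite /proj1 -!limg_comp -!mxlinM; suff -> : pr1 F p q *m Kmx g = g.1 *m pr1 F p q by [].
rewrite /pr1 /Kmx mul_row_block mul_mx_row !mul1mx !mul0mx !mulmx1 !mulmx0.
by rewrite !addr0.
Qed.

Lemma meet1_act (F : fieldType) p q (g : 'M[F]_p * 'M[F]_q) W : groupK g ->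
  meet1 (mxlin (Kmx g) @: W)%VS = (mxlin g.1 @: meet1 W)%VS.
Proof.
case=> h1 h2; apply/vspaceP => x; apply/idP/idP.
  rewrite mem_meet1 => /memv_imgP[w hw]; rewrite mxlinE -[w]vsubmxK Kmx_col.
  case/eq_col_mx => -> /esym e; apply/memv_imgP; exists (usubmx w); last by rewrite mxlinE.
  rewrite mem_meet1; have e0 : dsubmx w = 0 by rewrite -[LHS](mulKmx h2) e mulmx0.
  by rewrite -e0 vsubmxK.
case/memv_imgP => y hy ->; rewrite mxlinE mem_meet1.
have -> : col_mx (g.1 *m y) 0 = Kmx g *m col_mx y 0 by rewrite Kmx_col mulmx0.
by rewrite -mxlinE; apply: memv_img; rewrite -mem_meet1.
Qed.

Lemma meet2_act (F : fieldType) p q (g : 'M[F]_p * 'M[F]_q) W : groupK g ->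
  meet2 (mxlin (Kmx g) @: W)%VS = (mxlin g.2 @: meet2 W)%VS.
Proof.
case=> h1 h2; apply/vspaceP => x; apply/idP/idP.
  rewrite mem_meet2 => /memv_imgP[w hw]; rewrite mxlinE -[w]vsubmxK Kmx_col.
  case/eq_col_mx => /esym e ->; apply/memv_imgP; exists (dsubmx w); last by rewrite mxlinE.
  rewrite mem_meet2; have e0 : usubmx w = 0 by rewrite -[LHS](mulKmx h1) e mulmx0.
  by rewrite -e0 vsubmxK.
case/memv_imgP => y hy ->; rewrite mxlinE mem_meet2.
have -> : col_mx 0 (g.2 *m y) = Kmx g *m col_mx 0 y by rewrite Kmx_col mulmx0.
by rewrite -mxlinE; apply: memv_img; rewrite -mem_meet2.
Qed.

Lemma dim_unit (F : fieldType) n (g : 'M[F]_n) (U : {vspace 'cV[F]_n}) : g \in unitmx ->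
  \dim (mxlin g @: U) = \dim U.
Proof. by move=> /lker_unit/eqP h; rewrite limg_dim_eq // h capv0. Qed.

Lemma head_map (F : fieldType) n (g : 'M[F]_n) (s : seq 'cV[F]_n) :
  head 0 (map (mulmx g) s) = g *m head 0 s.
Proof. by case: s => //=; rewrite mulmx0. Qed.

Lemma orbit_X (F : fieldType) p q k w1 w2 j (z : ptX F p q) : stratumX k w1 w2 j z ->
  [set actX g z | g in @groupK F p q] = stratumX k w1 w2 j.
Proof.
case: z => W L [[/= dW dL] [d1 d2 hj]]; apply/seteqP; split.
  move=> _ [g hg <-]; have [u1 u2] := hg; split; first split=> /=.
  - by rewrite dim_unit ?Kmx_unit.
  - by rewrite dim_unit.
  split=> /=.
  - by rewrite meet1_act // dim_unit.
  - by rewrite meet2_act // dim_unit.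
  - by rewrite meet1_act // proj1_act pos_img // lker_unit.
case=> W' L' [[/= dW' dL'] [d1' d2' hj']].
have [e1 [e2 [e3 [f1 [f2 [f3 [hA hL]]]]]]] := adapted_ex W dL.
have [e1' [e2' [e3' [f1' [f2' [f3' [hA' hL']]]]]]] := adapted_ex W' dL'.
have [_ [a1 a2 a3]] := adapted_spaces hA; have [_ [b1 b2 b3]] := adapted_spaces hA'.
have [] := @adapted_conj _ _ _ _ _ _ _ _ _ _ _ _ _ _ _ _ _ hA hA'; try dim_lia.
move=> g [hg hgW [m1 m2 m3] _]; exists g => //; rewrite /actX /= hgW; congr pair.
rewrite hL hL' hj hj' limg_line mxlinE -head_map; congr (<[head _ _]>)%VS.
rewrite -m1 -m2 -m3; move: j {hj hj' hL hL'} => j.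
by case: j => [|[|[|j]]] //=; case: j.
Qed.

Lemma orbit_X_refl (F : fieldType) p q k (z : ptX F p q) : exoticX k z ->
  stratumX k (\dim (meet1 z.1)) (\dim (meet2 z.1)) (pos (meet1 z.1) (proj1 z.1) z.2) z.
Proof. by []. Qed.

(** The Jordan normal form of a pair with ab = ba = 0: a sends f3 to e1, b sends e3 to f1,
    and the other basis vectors are killed. *)
Definition adaptedE (F : fieldType) p q (a : 'M[F]_(p, q)) (b : 'M[F]_(q, p))
    (e1 e2 e3 : seq 'cV[F]_p) (f1 f2 f3 : seq 'cV[F]_q) :=
  [/\ is_basis (e1 ++ e2 ++ e3), is_basis (f1 ++ f2 ++ f3),
      map (mulmx a) (f1 ++ f2 ++ f3) = nseq (size f1) 0 ++ nseq (size f2) 0 ++ e1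
    & map (mulmx b) (e1 ++ e2 ++ e3) = nseq (size e1) 0 ++ nseq (size e2) 0 ++ f1].

Lemma map0_ker (F : fieldType) m n (a : 'M[F]_(m, n)) (s : seq 'cV[F]_n) :
  (<<s>> <= mxker a)%VS -> map (mulmx a) s = nseq (size s) 0.
Proof.
move/span_subvP => h; elim: s h => //= x s IH h; rewrite IH => [|y hy].
  by have := h x (mem_head _ _); rewrite memv_mxker => /eqP ->.
by apply: h; rewrite inE hy orbT.
Qed.

Lemma lift_seq (F : fieldType) m n (a : 'M[F]_(m, n)) (s : seq 'cV[F]_m) :
  (<<s>> <= mxim a)%VS -> exists t, map (mulmx a) t = s.
Proof.
move/span_subvP; elim: s => [|x s IH] h; first by exists [::].
have [t ht] : exists t, map (mulmx a) t = s by apply: IH => y hy; apply: h; rewrite inE hy orbT.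
have /memv_imgP[y _ hy] := h x (mem_head _ _); exists (y :: t); rewrite /= ht hy.
by rewrite mxlinE.
Qed.

(** The vectors e1, e2, e3 are adapted to Im a <= ker b and to L; f1 is the image of e3
    under b, f2 completes it to a basis of ker a, and f3 lifts e1 along a. *)
Lemma adaptedE_ex (F : fieldType) p q (a : 'M[F]_(p, q)) (b : 'M[F]_(q, p))
  (L : {vspace 'cV[F]_p}) :
  \dim L = 1%N -> a *m b = 0 -> b *m a = 0 ->
  exists e1 e2 e3 f1 f2 f3, [/\ adaptedE a b e1 e2 e3 f1 f2 f3,
    L = <[head 0%R (nth [::] [:: e1; e2; e3] (pos (mxim a) (mxker b) L))]>%VS,
    size e1 = \rank a & size f1 = \rank b].
Proof.
move=> hL ab ba.
have imker m n o (x : 'M[F]_(m, n)) (y : 'M[F]_(n, o)) : x *m y = 0 -> (mxim y <= mxker x)%VS.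
  move=> xy; apply/subvP => _ /memv_imgP[v _ ->]; rewrite mxlinE memv_mxker mulmxA xy mul0mx.
  exact: eqxx.
have [e1 [e2 [e3 [h1 h2 h3 [s1 s2 s3] hLe]]]] := chain_basis (imker _ _ _ _ _ ba) hL.
have [f2 [h4 s4]] := ext_basis (imker _ _ _ _ _ ab).
have he : is_basis (e1 ++ e2 ++ e3).
  by split; rewrite // !size_cat addnA s3.
have bm : map (mulmx b) (e1 ++ e2) = nseq (size (e1 ++ e2)) 0 by apply: map0_ker; rewrite h2.
pose f1 := map (mulmx b) e3.
have hf1 : <<f1>>%VS = mxim b.
  rewrite (mxim_basis _ he.2) catA map_cat bm span_cat span_zeros add0v //.
have [f3 hf3] : exists t, map (mulmx a) t = e1 by apply: lift_seq; rewrite h1.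
have k12 : <<f1 ++ f2>>%VS = mxker a by rewrite span_cat hf1 h4.
have da := dim_mxker a; have db := dim_mxker b; have ma := dim_mxim a; have mb := dim_mxim b.
have fs : size f3 = size e1 by rewrite -hf3 size_map.
exists e1, e2, e3, f1, f2, f3; split=> //; last 2 first.
- by rewrite s1.
- rewrite size_map; dim_lia.
split=> //; last first.
  by rewrite catA map_cat bm size_cat nseqD -catA.
  rewrite catA map_cat map0_ker ?k12 // size_cat nseqD -catA hf3 //.
split.
  rewrite !size_cat size_map; dim_lia.
set S := <<_>>%VS; have kS : (mxker a <= S)%VS by rewrite -k12 /S catA (span_cat
  (f1 ++ f2)) addvSl.
apply/eqP; rewrite eqEdim subvf /= -(limg_ker_dim (mxlin a) S) (capv_idPr kS).
rewrite dim_cV -{1}da leq_add2l -dim_mxim; apply: dimvS.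
rewrite -h1 -hf3 /S limg_span; apply: sub_span => x /mapP[y hy ->].
by rewrite -mxlinE; apply: map_f; rewrite !mem_cat hy !orbT.
Qed.

Lemma rank_antidiag (F : fieldType) m n m' n' (a : 'M[F]_(m, n)) (b : 'M[F]_(m', n')) :
  \rank (block_mx 0 a b 0) = (\rank a + \rank b)%N.
Proof.
rewrite [RHS]addnC -rank_diag_block_mx /block_mx -!addsmxE addsmxC. done.
Qed.

Lemma exoticE_ab (F : fieldType) p q k (L : {vspace 'cV[F]_p}) (x : 'M[F]_(p + q)) :
  exoticE k (L, x) <-> [/\ \dim L = 1%N, x = block_mx 0 (ursubmx x) (dlsubmx x) 0,
    ursubmx x *m dlsubmx x = 0, dlsubmx x *m ursubmx x = 0 &
    (\rank (ursubmx x) + \rank (dlsubmx x) <= minn k (p + q - k))%N].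
Proof.
have e0 : (0 : 'M[F]_(p + q)) = block_mx 0 0 0 0 by rewrite block_mx0.
have ex : theta x = 0 <-> x = block_mx 0 (ursubmx x) (dlsubmx x) 0.
  split=> [|->]; last by rewrite /theta block_mxKul block_mxKdr block_mx0.
  move=> h; have := etrans h e0; rewrite -{2}[x]submxK /theta.
  by case/eq_block_mx => -> _ _ ->.
split=> [[/= hL /ex ht hx hr]|[hL ht ab ba hr]].
  split=> //; last by rewrite -rank_antidiag -ht.
    move: hx; rewrite ht mulmx_block !mul0mx !mulmx0 !addr0 !add0r => hx.
    by have := etrans hx e0; case/eq_block_mx; rewrite block_mxKur block_mxKdl.
  move: hx; rewrite ht mulmx_block !mul0mx !mulmx0 !addr0 !add0r => hx.
  by have := etrans hx e0; case/eq_block_mx; rewrite block_mxKur block_mxKdl.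
split=> //=; first exact/ex.
  by rewrite ht mulmx_block !mul0mx !mulmx0 !addr0 !add0r ab ba block_mx0.
by rewrite ht rank_antidiag.
Qed.

Lemma block_conj (F : fieldType) p q (g : 'M[F]_p * 'M[F]_q) (a a' : 'M[F]_(p, q))
  (b b' : 'M[F]_(q, p)) :
  groupK g -> g.1 *m a = a' *m g.2 -> g.2 *m b = b' *m g.1 ->
  Kmx g *m block_mx 0 a b 0 *m invmx (Kmx g) = block_mx 0 a' b' 0.
Proof.
move=> hg ha hb; rewrite (_ : Kmx g *m _ = block_mx 0 a' b' 0 *m Kmx g).
  by rewrite mulmxK ?Kmx_unit.
by rewrite !mulmx_block !mul0mx !mulmx0 !addr0 !add0r ha hb.
Qed.

Lemma mxim_unitr (F : fieldType) m n (a : 'M[F]_(m, n)) (g : 'M[F]_n) :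
  g \in unitmx -> mxim (a *m g) = mxim a.
Proof. by move=> hg; apply: (@mxim_mul_full _ _ _ _ _ _ (invmx g)); rewrite mulmxV. Qed.

Lemma orbit_E (F : fieldType) p q k r s j (z : ptE F p q) : stratumE k r s j z ->
  [set actE g z | g in @groupK F p q] = stratumE k r s j.
Proof.
case: z => L x [hz [/= ra rb hj]]; apply/seteqP; split.
  move=> _ [g hg <-]; have [u1 u2] := hg.
  have [dL hx ab ba hr] := (exoticE_ab k L x).1 hz.
  set a := ursubmx x in hx ab ba hr ra hj *; set b := dlsubmx x in hx ab ba hr rb hj *.
  have [a' ha] : exists a', g.1 *m a = a' *m g.2.
    by exists (g.1 *m a *m invmx g.2); rewrite mulmxKV.
  have [b' hb] : exists b', g.2 *m b = b' *m g.1.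
    by exists (g.2 *m b *m invmx g.1); rewrite mulmxKV.
  have ea : a' = g.1 *m a *m invmx g.2 by rewrite ha mulmxK.
  have eb : b' = g.2 *m b *m invmx g.1 by rewrite hb mulmxK.
  have ra' : \rank a' = r.
    by rewrite ea mxrankMfree ?row_free_unit ?unitmx_inv // -mxrank_tr trmx_mul mxrankMfree
      ?row_free_unit ?unitmx_tr // mxrank_tr.
  have rb' : \rank b' = s.
    by rewrite eb mxrankMfree ?row_free_unit ?unitmx_inv // -mxrank_tr trmx_mul mxrankMfree
      ?row_free_unit ?unitmx_tr // mxrank_tr.
  rewrite /actE /= hx (block_conj hg ha hb).
  split; first apply/exoticE_ab; rewrite /= !(block_mxKur, block_mxKdl).
    split=> //.
    - by rewrite dim_unit.
    - by rewrite ea eb !mulmxA mulmxKV // -!mulmxA (mulmxA a) ab mul0mx mulmx0.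
    - by rewrite ea eb !mulmxA mulmxKV // -!mulmxA (mulmxA b) ba mul0mx mulmx0.
    - by rewrite ra' rb' -ra -rb.
  split=> //; rewrite -hj -[RHS](@pos_img _ _ (mxlin g.1)) ?lker_unit //; congr pos.
    by rewrite mxlin_im ha mxim_unitr.
  apply/vspaceP => v; apply/idP/idP.
    rewrite memv_mxker => /eqP hv; apply/memv_imgP; exists (invmx g.1 *m v).
      rewrite memv_mxker; apply/eqP.
      by rewrite -[LHS](mulKmx u2) (mulmxA g.2) hb -mulmxA mulKVmx // hv mulmx0.
    by rewrite mxlinE mulKVmx.
  case/memv_imgP => w; rewrite memv_mxker => /eqP hw ->.
  rewrite memv_mxker mxlinE mulmxA -hb -mulmxA hw mulmx0; exact: eqxx.
case=> L' x' [hz' [/= ra' rb' hj']].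
have [dL hx ab ba hr] := (exoticE_ab k L x).1 hz.
have [dL' hx' ab' ba' hr'] := (exoticE_ab k L' x').1 hz'.
have [e1 [e2 [e3 [f1 [f2 [f3 [[he hf ha hb] hL se1 sf1]]]]]]] := adaptedE_ex dL ab ba.
have [e1' [e2' [e3' [f1' [f2' [f3' [[he' hf' ha' hb'] hL' se1' sf1']]]]]]] :=
  adaptedE_ex dL' ab' ba'.
have sz1 : size e1 = size e1' by rewrite se1 ra se1' ra'.
have sz2 : size f1 = size f1' by rewrite sf1 rb sf1' rb'.
have sf3 : size f3 = size e1.
  by have := congr1 size ha; rewrite size_map !size_cat !size_nseq; dim_lia.
have se3 : size e3 = size f1.
  by have := congr1 size hb; rewrite size_map !size_cat !size_nseq; dim_lia.
have sf3' : size f3' = size e1'.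
  by have := congr1 size ha'; rewrite size_map !size_cat !size_nseq; dim_lia.
have se3' : size e3' = size f1'.
  by have := congr1 size hb'; rewrite size_map !size_cat !size_nseq; dim_lia.
have sz3 : size e2 = size e2'.
  by have := he.1; have := he'.1; rewrite !size_cat; dim_lia.
have sz4 : size f2 = size f2'.
  by have := hf.1; have := hf'.1; rewrite !size_cat; dim_lia.
have [g1 u1 G1] := GL_on_basis he he'; have [g2 u2 G2] := GL_on_basis hf hf'.
have := G1; rewrite !map_cat => /eqP.
rewrite eqseq_cat ?size_map // => /andP[/eqP k1].
rewrite eqseq_cat ?size_map // => /andP[/eqP k2 /eqP k3].
have := G2; rewrite !map_cat => /eqP.
rewrite eqseq_cat ?size_map // => /andP[/eqP k4].
rewrite eqseq_cat ?size_map // => /andP[/eqP k5 /eqP k6].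
have hg : groupK (g1, g2) by split.
have z0 m n (g : 'M[F]_(m, n)) l : map (mulmx g) (nseq l 0) = nseq l 0.
  by elim: l => //= l ->; rewrite mulmx0.
have mc m n o (g : 'M[F]_(m, n)) (h : 'M[F]_(n, o)) l :
    map (mulmx (g *m h)) l = map (mulmx g) (map (mulmx h) l).
  by rewrite -map_comp; apply: eq_map => v /=; rewrite mulmxA.
exists (g1, g2) => //; rewrite /actE /= hx hx'; congr pair.
  rewrite hL hL' hj hj' limg_line mxlinE -head_map; congr (<[head _ _]>)%VS.
  rewrite -k1 -k2 -k3; move: j {hj hj' hL hL'} => j.
  by case: j => [|[|[|j]]] //=; case: j.
apply: block_conj => //=.
  apply: (mx_eq_basis hf.2); rewrite !mc ha G2 ha' !map_cat !z0 k1.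
  by rewrite sz2 sz4.
apply: (mx_eq_basis he.2); rewrite !mc hb G1 hb' !map_cat !z0 k4.
by rewrite sz1 sz3.
Qed.

(** * Conormal vectors at a point *)

(** The conditions Im x <= W <= ker x and Im x^theta <= L <= ker x^theta in terms of the
    blocks of x = [[x1, a], [b, 0]]. *)
Definition fibre (F : fieldType) p q (W : {vspace 'cV[F]_(p + q)}) (L : {vspace 'cV[F]_p})
    (x1 : 'M[F]_p) (a : 'M[F]_(p, q)) (b : 'M[F]_(q, p)) : Prop :=
  [/\ (mxim x1 <= L)%VS, (L <= mxker x1)%VS,
      forall v, col_mx (x1 *m v) (b *m v) \in W,
      forall v, col_mx (a *m v) 0 \in W
    & forall w w', col_mx w w' \in W -> x1 *m w + a *m w' = 0 /\ b *m w = 0].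

Lemma inV1E (F : fieldType) p q (L : {vspace 'cV[F]_p}) : inV1 q L = (mxlin (in1 F p q) @: L)%VS.
Proof. by []. Qed.

Lemma mem_inV1 (F : fieldType) p q (L : {vspace 'cV[F]_p}) x y :
  (col_mx x y \in inV1 q L) = (x \in L) && (y == 0).
Proof.
rewrite inV1E; apply/memv_imgP/andP => [[v hv]|[hx /eqP ->]].
  by rewrite mxlinE in1E => /eq_col_mx[-> ->].
by exists x => //; rewrite mxlinE in1E.
Qed.

Lemma block4_col (F : fieldType) p q (x1 : 'M[F]_p) (a : 'M[F]_(p, q)) b (d : 'M[F]_q)
  (v : 'cV_p) (w : 'cV_q) :
  block_mx x1 a b d *m col_mx v w = col_mx (x1 *m v + a *m w) (b *m v + d *m w).
Proof. exact: mul_block_col. Qed.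

Lemma conormalP (F : fieldType) p q k (W : {vspace 'cV[F]_(p + q)}) (L : {vspace 'cV[F]_p}) x :
  conormalY k (W, L, x) <->
  [/\ \dim W = k, \dim L = 1%N, drsubmx x = 0
    & fibre W L (ulsubmx x) (ursubmx x) (dlsubmx x)].
Proof.
set x1 := ulsubmx x; set a := ursubmx x; set b := dlsubmx x; set d := drsubmx x.
have ex : x = block_mx x1 a b d by rewrite submxK.
split=> [[[/= dW dL] imW Wker imL Lker]|[dW dL d0 [f1 f2 f3 f4 f5]]].
  have d0 : d = 0.
    apply/eqP; apply: contraT => /matrix0Pn[i [j]]; suff -> : d = 0 by rewrite mxE eqxx.
    apply: (mx_eq_basis (span_basis (vbasisP fullv))); apply/eq_in_map => v _.
    have : theta x *m col_mx 0 v \in inV1 q L.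
      by apply: (subvP imL); exact: memv_mxim.
    rewrite block4_col !mulmx0 !mul0mx !add0r mem_inV1.
    by case/andP => _ /eqP.
  split=> //; split.
  - apply/subvP => _ /memv_imgP[v _ ->]; rewrite mxlinE.
    have : theta x *m col_mx v 0 \in inV1 q L.
      by apply: (subvP imL); exact: memv_mxim.
    by rewrite block4_col !mulmx0 !mul0mx !addr0 mem_inV1 => /andP[].
  - apply/subvP => v hv; rewrite memv_mxker.
    have : col_mx v 0 \in inV1 q L by rewrite mem_inV1 hv eqxx.
    move/(subvP Lker); rewrite memv_mxker block4_col !mulmx0 !mul0mx !addr0 col_mx_eq0.
    by case/andP.
  - move=> v; have : x *m col_mx v 0 \in W by apply: (subvP imW); exact: memv_mxim.
    by rewrite ex block4_col !mulmx0 !addr0.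
  - move=> v; have : x *m col_mx 0 v \in W by apply: (subvP imW); exact: memv_mxim.
    by rewrite ex block4_col !mulmx0 !add0r d0 mul0mx.
  - move=> w w' /(subvP Wker); rewrite memv_mxker ex block4_col d0 mul0mx addr0 col_mx_eq0.
    by case/andP => /eqP ? /eqP ?.
split; first by split.
- apply/subvP => _ /memv_imgP[v _ ->]; rewrite mxlinE -[v]vsubmxK ex block4_col d0 mul0mx addr0.
  have -> : col_mx (x1 *m usubmx v + a *m dsubmx v) (b *m usubmx v) =
    col_mx (x1 *m usubmx v) (b *m usubmx v) + col_mx (a *m dsubmx v) 0.
    by rewrite add_col_mx addr0.
  exact: memvD.
- apply/subvP => v; rewrite -[v]vsubmxK => /f5[h1 h2].
  rewrite memv_mxker ex block4_col d0 mul0mx addr0 h1 h2 col_mx0; exact: eqxx.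
- apply/subvP => _ /memv_imgP[v _ ->];
  rewrite mxlinE -[v]vsubmxK /theta block4_col -/d d0 !mul0mx !addr0.
  by rewrite mem_inV1 eqxx andbT (subvP f1) //; exact: memv_mxim.
- apply/subvP => v; rewrite -[v]vsubmxK mem_inV1 => /andP[hv /eqP ->].
  rewrite memv_mxker block4_col -/d d0 !mul0mx !addr0 col_mx_eq0 eqxx andbT.
  by have := subvP f2 _ hv; rewrite memv_mxker.
Qed.

Lemma line_cap (F : fieldType) (vT : vectType F) (L U : {vspace vT}) w :
  \dim L = 1%N -> ~~ (L <= U)%VS -> w \in L -> w \in U -> w = 0.
Proof.
move=> dL nLU wL wU; apply/eqP; apply: contraNT nLU => w0.
have <- : <[w]>%VS = L by apply/eqP; rewrite eqEdim -memvE wL dL dim_vline w0.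
by rewrite -memvE.
Qed.

Lemma line_sub (F : fieldType) (vT : vectType F) (L U : {vspace vT}) w :
  \dim L = 1%N -> w \in L -> w != 0 -> w \in U -> (L <= U)%VS.
Proof. by move=> dL wL w0 wU; apply: contraT => h; rewrite (line_cap dL h wL wU) eqxx in w0. Qed.

(** The kernel of a on U is at most its kernel. *)
Lemma rank_restr (F : fieldType) m n (a : 'M[F]_(m, n)) (U : {vspace 'cV[F]_n}) :
  (\rank a + \dim U <= \dim (mxlin a @: U) + n)%N.
Proof.
have := limg_ker_dim (mxlin a) U; have := dim_mxker a; have := dimvS (capvSr U (mxker a)).
dim_lia.
Qed.

Lemma rank_ker (F : fieldType) m n (a : 'M[F]_(m, n)) (U : {vspace 'cV[F]_n}) :
  (U <= mxker a)%VS -> (\rank a + \dim U <= n)%N.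
Proof. by move=> /dimvS h; have := dim_mxker a; dim_lia. Qed.

Lemma im_ker (F : fieldType) m n o (x : 'M[F]_(m, n)) (y : 'M[F]_(n, o)) :
  (mxim y <= mxker x)%VS = (x *m y == 0).
Proof.
apply/idP/eqP => [h|xy]; last first.
  apply/subvP => _ /memv_imgP[v _ ->]; rewrite mxlinE memv_mxker mulmxA xy mul0mx.
  exact: eqxx.
apply: (mx_eq_basis (span_basis (vbasisP fullv))); apply/eq_in_map => v _.
rewrite mul0mx -mulmxA; apply/eqP; rewrite -memv_mxker; apply: (subvP h); exact: memv_mxim.
Qed.

Section Fibre.
Variables (F : fieldType) (p q : nat) (W : {vspace 'cV[F]_(p + q)}) (L : {vspace 'cV[F]_p}).
Variables (x1 : 'M[F]_p) (a : 'M[F]_(p, q)) (b : 'M[F]_(q, p)).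
Hypothesis dL : \dim L = 1%N.
Hypothesis hfib : fibre W L x1 a b.

Lemma fibre_ima : (mxim a <= meet1 W)%VS.
Proof.
case: hfib => _ _ _ f4 _; apply/subvP => _ /memv_imgP[v _ ->].
by rewrite mxlinE mem_meet1.
Qed.

Lemma fibre_kerb : (proj1 W <= mxker b)%VS.
Proof.
case: hfib => _ _ _ _ f5; apply/subvP => v /proj1_ex[y /f5[_ h]].
by rewrite memv_mxker h; exact: eqxx.
Qed.

Lemma fibre_x1L v : x1 *m v \in L.
Proof. by case: hfib => f1 _ _ _ _; apply: (subvP f1); exact: memv_mxim. Qed.

Lemma fibre_a2 : (meet2 W <= mxker a)%VS.
Proof.
case: hfib => _ _ _ _ f5; apply/subvP => v; rewrite mem_meet2 => /f5[h _].
by rewrite memv_mxker; move: h; rewrite mulmx0 add0r => ->; exact: eqxx.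
Qed.

(** Over a vector (w, w') of W, a w' = - x1 w is in L. *)
Lemma fibre_aproj : (mxlin a @: proj2 W <= L)%VS.
Proof.
case: hfib => _ _ _ _ f5; apply/subvP => _ /memv_imgP[v /proj2_ex[x /f5[h _]] ->].
by rewrite mxlinE -(addKr (x1 *m x) (a *m v)) h addr0 memvN fibre_x1L.
Qed.

Lemma fibre_ab : a *m b = 0 /\ b *m a = 0.
Proof.
case: hfib => f1 f2 f3 f4 f5; split; apply/eqP; rewrite -im_ker;
  apply/subvP => _ /memv_imgP[v _ ->];
  rewrite mxlinE memv_mxker; last by have [_ ->] := f5 _ _ (f4 v); exact: eqxx.
have [h _] := f5 _ _ (f3 v).
have := subvP f2 _ (fibre_x1L v); rewrite memv_mxker => /eqP h'.
by move: h; rewrite h' add0r => ->; exact: eqxx.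
Qed.

(** If L is not in W, the vectors x1 w = - a w' above are both in L and in meet1 W,
    hence zero. For the same reason b v = 0 forces x1 v = 0, since then (x1 v, 0) is in W. *)
Lemma fibre_notmeet : ~~ (L <= meet1 W)%VS ->
  [/\ (proj2 W <= mxker a)%VS, (proj1 W <= mxker x1)%VS & \rank (col_mx x1 b) = \rank b].
Proof.
move=> nL; case: (hfib) => _ _ f3 f4 f5.
have key w w' : col_mx w w' \in W -> x1 *m w = 0.
  move=> /f5[h _]; apply: (line_cap dL nL (fibre_x1L w)).
  rewrite -(addrK (a *m w') (x1 *m w)) h sub0r memvN; apply: (subvP fibre_ima); exact: memv_mxim.
split.
- apply/subvP => v /proj2_ex[x hx]; have [h _] := f5 _ _ hx.
  by rewrite memv_mxker; move: h; rewrite (key _ _ hx) add0r => ->; exact: eqxx.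
- by apply/subvP => v /proj1_ex[y /key h]; rewrite memv_mxker h; exact: eqxx.
have := dim_mxker (col_mx x1 b); have := dim_mxker b.
suff -> : mxker (col_mx x1 b) = mxker b by dim_lia.
apply/vspaceP => v; rewrite !memv_mxker mul_col_mx col_mx_eq0.
apply/andP/idP => [[]//|/eqP h0]; rewrite h0 eqxx; split=> //.
have := f3 v; rewrite h0 -mem_meet1 => /(line_cap dL nL (fibre_x1L v)) ->; exact: eqxx.
Qed.

(** The image of x1 is in L and in proj1 W. *)
Lemma fibre_notproj : ~~ (L <= proj1 W)%VS -> x1 = 0.
Proof.
move=> nL; case: (hfib) => _ _ f3 _ _.
apply: (mx_eq_basis (span_basis (vbasisP fullv))); apply/eq_in_map => v _.
by rewrite mul0mx; apply: (line_cap dL nL (fibre_x1L v)); exact: mem_proj1 (f3 v).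
Qed.

(** The image of (x1, b) is a subspace of W: its intersection with V2 is in meet2 W, and
    its projection to V1 is the image of x1. *)
Lemma fibre_rank_le : (\rank (col_mx x1 b) <= \dim (meet2 W) + \rank x1)%N.
Proof.
case: (hfib) => _ _ f3 _ _; rewrite -dim_mxim -(dim_meet2_proj1 (mxim _)) leq_add //.
  apply: dimvS; apply: lpreimS; apply/subvP => _ /memv_imgP[v _ ->].
  by rewrite mxlinE mul_col_mx.
rewrite -dim_mxim; apply: dimvS; rewrite /proj1 mxlin_im /pr1 mul_row_col mul1mx mul0mx addr0.
exact: subvv.
Qed.

Lemma fibre_rankb : (\rank b <= \rank (col_mx x1 b))%N.
Proof.
have e : row_mx 0 1%:M *m col_mx x1 b = b by rewrite mul_row_col mul0mx mul1mx add0r.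
by rewrite -{1}e mxrankM_maxr.
Qed.

Lemma fibre_rankx1 : (\rank x1 <= 1)%N.
Proof. by case: hfib => f1 _ _ _ _; rewrite -dL; apply: rank_sub. Qed.

(** The bounds for a come from Im a <= meet1 W, from a (meet2 W) = 0 and from
    a (proj2 W) <= L; those for b from b (proj1 W) = 0 and from the image of (x1, b). *)
Lemma fibre_num :
  [/\ (\rank a <= \dim (meet1 W))%N,
      (\rank b + \dim (proj1 W) <= p)%N,
      (\rank a + \dim (proj2 W) <= q + 1)%N,
      (\dim (proj1 W) = \dim (meet1 W) -> \rank a + \dim (proj2 W) <= q)%N
    & [/\ pos (meet1 W) (proj1 W) L = 0%N -> (\rank b <= \dim (meet2 W))%N,
          pos (meet1 W) (proj1 W) L = 1%N -> [/\ (\rank a + \dim (proj2 W) <= q)%N,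
             (\rank b <= \dim (meet2 W) + 1)%N & (\dim (meet1 W) < \dim (proj1 W))%N]
        & pos (meet1 W) (proj1 W) L = 2%N -> [/\ (\rank a + \dim (proj2 W) <= q)%N,
             (\rank b <= \dim (meet2 W))%N, (\dim (proj1 W) < p)%N & x1 = 0]]].
Proof.
have hb2 := leq_trans fibre_rankb fibre_rank_le; have hx := fibre_rankx1.
split.
- exact: rank_sub fibre_ima.
- exact: rank_ker fibre_kerb.
- have := rank_restr a (proj2 W); have := dimvS fibre_aproj; rewrite dL; dim_lia.
- move=> h; apply: rank_ker; rewrite (_ : proj2 W = meet2 W) ?fibre_a2 //.
  apply/esym/eqP; rewrite eqEdim meet2_proj2 /=.
  have := dim_meet1_proj2 W; have := dim_meet2_proj1 W; dim_lia.
rewrite /pos; split.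
- case: ifP => [hL _|_]; last by case: ifP.
  apply: rank_sub; apply/subvP => _ /memv_imgP[v _ ->]; rewrite mxlinE mem_meet2.
  case: (hfib) => _ _ f3 _ _.
  have -> : col_mx 0 (b *m v) = col_mx (x1 *m v) (b *m v) - col_mx (x1 *m v) 0.
    by rewrite opp_col_mx add_col_mx subrr subr0.
  by apply: memvB => //; rewrite -mem_meet1; apply: (subvP hL); exact: fibre_x1L.
- case: ifP => [//|/negbT hL]; case: ifP => // hL2 _; have [g1 g2 g3] := fibre_notmeet hL.
  split; [exact: rank_ker g1|dim_lia|].
  rewrite ltnNge; apply: contra hL => hd; apply: subv_trans hL2 _.
  by have /eqP <- : meet1 W == proj1 W by rewrite eqEdim meet1_proj1.
case: ifP => [//|/negbT hL]; case: ifP => [//|/negbT hL2 _].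
have [g1 g2 g3] := fibre_notmeet hL; have x0 := fibre_notproj hL2.
split=> //; first exact: rank_ker g1.
  by move: hb2; rewrite x0 mxrank0 addn0.
rewrite ltnNge; apply: contra hL2 => hd.
by have /eqP -> : proj1 W == fullv; rewrite ?subvf // eqEdim subvf dim_cV.
Qed.

Lemma fibre_type0 : (L <= mxim a)%VS -> pos (meet1 W) (proj1 W) L = 0%N.
Proof. by move=> h; rewrite /pos (subv_trans h fibre_ima). Qed.

Lemma fibre_type2 : ~~ (L <= mxker b)%VS -> pos (meet1 W) (proj1 W) L = 2%N.
Proof.
move=> h; have h2 : ~~ (L <= proj1 W)%VS by apply: contra h => /subv_trans; apply;
  apply: fibre_kerb.
rewrite /pos (negbTE h2) ifF //; apply: contraNF h2 => /subv_trans; apply; exact: meet1_proj1.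
Qed.

(** If L is not in Im a, then a vanishes on proj2 W, because a (proj2 W) is in L; and Im a
    is a proper subspace of meet1 W if L is in the latter. *)
Lemma fibre_type1 : ~~ (L <= mxim a)%VS -> (L <= mxker b)%VS ->
  [/\ (proj2 W <= mxker a)%VS,
      pos (meet1 W) (proj1 W) L = 0%N -> (\rank a < \dim (meet1 W))%N
    & pos (meet1 W) (proj1 W) L = 2%N -> (\rank b + \dim (proj1 W) < p)%N].
Proof.
move=> h1 h2; split.
- apply/subvP => v hv; rewrite memv_mxker; apply/eqP.
  apply: (line_cap dL h1); last exact: memv_mxim.
  by rewrite -mxlinE; apply: (subvP fibre_aproj); apply: memv_img.
- rewrite /pos; case: ifP => [hL _|_]; last by case: ifP.
  rewrite ltnNge; apply: contra h1 => hd.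
  by have /eqP -> : mxim a == meet1 W by rewrite eqEdim fibre_ima dim_mxim.
rewrite /pos; case: ifP => [//|_]; case: ifP => [//|/negbT hL] _.
have hs : (proj1 W + L <= mxker b)%VS by rewrite subv_add fibre_kerb.
have := rank_ker hs; rewrite dimv_disjoint_sum ?dL; first by dim_lia.
apply/eqP; rewrite -subv0; apply/subvP => w /memv_capP[wP wL].
by rewrite memv0 (line_cap dL hL wL wP).
Qed.

(** In the three positions of L, the bounds on rk a and rk b add up to at most
    k = w1 + w2 + t and to at most n - k = u + v + t. *)
Lemma fibre_exotic k : \dim W = k -> exoticE k (L, block_mx 0 a b 0).
Proof.
move=> dW; apply/exoticE_ab; rewrite !block_mxKur !block_mxKdl; have [ab ba] := fibre_ab.
split=> //; have [n1 n2 n3 n4 [n5 n6 n7]] := fibre_num.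
have := dim_meet1_proj2 W; have := dim_meet2_proj1 W.
have d2 : (\dim (proj2 W) <= q)%N by rewrite -[q in leqRHS](@dim_cV F) dimvS ?subvf.
have d1 : (\dim (proj1 W) <= p)%N by rewrite -[p in leqRHS](@dim_cV F) dimvS ?subvf.
have m1 := dimvS (meet1_proj1 W).
have : (pos (meet1 W) (proj1 W) L <= 2)%N by rewrite /pos; case: ifP => // _; case: ifP.
rewrite leq_min; case: (pos _ _ _) n5 n6 n7 => [|[|[|//]]] n5 n6 n7 _.
- move=> e1 e2; have := n5 erefl => ?; apply/andP; split; first by dim_lia.
  have [e|ne] := eqVneq (\dim (proj1 W)) (\dim (meet1 W)); first by have := n4 e; dim_lia.
  by move: ne => /eqP; dim_lia.
- by have [] := n6 erefl; dim_lia.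
- by have [] := n7 erefl; dim_lia.
Qed.

End Fibre.

(** * Zariski closed sets *)

Definition ncoord (p q k : nat) := ((p + q) * k + (p + (p + q) * (p + q)))%N.

Definition Xrow (F : fieldType) N : 'rV[mpoly.mpoly N F]_N :=
  \row_i mpoly.mpolyX F (mpoly.mnm1 i).
(** Generic coordinates of the triple (M, v, x). *)
Definition XM (F : fieldType) p q k : 'M[mpoly.mpoly (ncoord p q k) F]_(p + q, k) :=
  vec_mx (lsubmx (Xrow F (ncoord p q k))).
Definition Xv (F : fieldType) p q k : 'cV[mpoly.mpoly (ncoord p q k) F]_p :=
  (lsubmx (rsubmx (Xrow F (ncoord p q k))))^T.
Definition Xx (F : fieldType) p q k : 'M[mpoly.mpoly (ncoord p q k) F]_(p + q) :=
  vec_mx (rsubmx (rsubmx (Xrow F (ncoord p q k)))).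

Definition eval_coord (F : fieldType) p q k (M : 'M[F]_(p + q, k)) (v : 'cV[F]_p)
  (x : 'M[F]_(p + q)) :
    {rmorphism mpoly.mpoly (ncoord p q k) F -> F} :=
  mpoly.meval (fun i => coordY M v x 0 i).

Lemma eval_Xrow (F : fieldType) p q k (M : 'M[F]_(p + q, k)) (v : 'cV[F]_p) (x : 'M[F]_(p + q)) :
  map_mx (eval_coord M v x) (Xrow F (ncoord p q k)) = coordY M v x.
Proof. by apply/rowP => i; rewrite mxE [X in eval_coord _ _ _ X]mxE [LHS]mpoly.mevalXU. Qed.

Lemma eval_XM (F : fieldType) p q k (M : 'M[F]_(p + q, k)) (v : 'cV[F]_p) (x : 'M[F]_(p + q)) :
  map_mx (eval_coord M v x) (XM F p q k) = M.
Proof. by rewrite map_vec_mx map_lsubmx eval_Xrow row_mxKl mxvecK. Qed.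
Lemma eval_Xv (F : fieldType) p q k (M : 'M[F]_(p + q, k)) (v : 'cV[F]_p) (x : 'M[F]_(p + q)) :
  map_mx (eval_coord M v x) (Xv F p q k) = v.
Proof. by rewrite -map_trmx map_lsubmx map_rsubmx eval_Xrow row_mxKr row_mxKl trmxK. Qed.
Lemma eval_Xx (F : fieldType) p q k (M : 'M[F]_(p + q, k)) (v : 'cV[F]_p) (x : 'M[F]_(p + q)) :
  map_mx (eval_coord M v x) (Xx F p q k) = x.
Proof. by rewrite map_vec_mx !map_rsubmx eval_Xrow !row_mxKr mxvecK. Qed.

Lemma eval_const (F : fieldType) p q k (M : 'M[F]_(p + q, k)) (v : 'cV[F]_p)
  (x : 'M[F]_(p + q)) m n (A : 'M[F]_(m, n)) :
  map_mx (eval_coord M v x) (map_mx (@mpoly.mpolyC _ F) A) = A.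
Proof. by apply/matrixP => i j; rewrite !mxE [LHS]mpoly.mevalC. Qed.

(** Minors with arbitrary rows and columns, that is, minors after arbitrary linear
    substitutions, spare the bookkeeping of index sets; if rk E > t, the substitutions that
    reduce E to diagonal form give a minor equal to 1. *)
Lemma rank_le_det (F : fieldType) m n (E : 'M[F]_(m, n)) t :
  (\rank E <= t)%N <->
  forall (P : 'M[F]_(t.+1, m)) (Q : 'M[F]_(n, t.+1)), \det (P *m E *m Q) = 0.
Proof.
split=> [h P Q|h].
  apply/eqP; rewrite -[_ == 0]negbK -unitfE -unitmxE -row_full_unit /row_full neq_ltn.
  apply/orP; left; rewrite ltnS; apply: leq_trans h.
  by apply: leq_trans (mxrankM_maxl _ _) _; exact: mxrankM_maxr.
rewrite leqNgt; apply/negP => lt.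
have := h (pid_mx t.+1 *m invmx (col_ebase E)) (invmx (row_ebase E) *m pid_mx t.+1).
rewrite -{2}(mulmx_ebase E) !mulmxA mulmxKV ?col_ebase_unit // mulmxK ?row_ebase_unit //.
have tm : (t.+1 <= m)%N := leq_trans lt (rank_leq_row E).
have tn : (t.+1 <= n)%N := leq_trans lt (rank_leq_col E).
rewrite !mul_pid_mx (_ : minn _ _ = t.+1); last by lia.
by rewrite pid_mx_1 det1 => /eqP; rewrite oner_eq0.
Qed.

(** The rank of a matrix with polynomial entries is semicontinuous; the hypothesis says
    that this rank depends only on the point (W, L, x) and not on the choice of M and v. *)
Lemma closed_rank (F : fieldType) p q k m n (E : 'M[mpoly.mpoly (ncoord p q k) F]_(m, n))
    (rho : ptY F p q -> nat) t :
  (forall M v x, \rank M = k -> v != 0 ->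
     \rank (map_mx (eval_coord M v x) E) = rho (mxim M, <[v]>%VS, x)) ->
  zariski_closed k [set y | exoticX k y.1 /\ (rho y <= t)%N].
Proof.
move=> h; split; first by move=> y [].
exists [set f | exists P : 'M[F]_(t.+1, m), exists Q : 'M[F]_(n, t.+1),
   f = \det (map_mx (@mpoly.mpolyC _ F) P *m E *m map_mx (@mpoly.mpolyC _ F) Q)].
move=> M v x hM hv.
have key P Q : eval_coord M v x (\det (map_mx (@mpoly.mpolyC _ F) P *m E *m map_mx
  (@mpoly.mpolyC _ F) Q)) =
    \det (P *m map_mx (eval_coord M v x) E *m Q).
  by rewrite -det_map_mx !map_mxM !eval_const.
split=> [[_]|H].
  rewrite -h // => /rank_le_det hr f [P [Q ->]]; rewrite [LHS]key; exact: hr.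
split; first by rewrite /exoticX /= dim_mxim hM dim_vline hv.
rewrite -h //; apply/rank_le_det => P Q; rewrite -key; apply: H.
by exists P, Q.
Qed.

Lemma closed_union (F : fieldType) p q k (Z1 Z2 : set (ptY F p q)) :
  zariski_closed k Z1 -> zariski_closed k Z2 -> zariski_closed k (Z1 `|` Z2).
Proof.
move=> [s1 [A1 h1]] [s2 [A2 h2]]; split; first by move=> y [/s1|/s2].
exists [set f | exists f1, exists2 f2, A1 f1 /\ A2 f2 & f = f1 * f2].
move=> M v x hM hv; split.
  have mM f1 f2 := mpoly.mevalM (fun i => coordY M v x 0 i) f1 f2.
  case=> [/(h1 M v x hM hv)|/(h2 M v x hM hv)] H f [f1 [f2 [a1 a2] ->]].
    by rewrite mM (H f1 a1) mul0r.
  by rewrite mM (H f2 a2) mulr0.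
move=> H; apply: contrapT => /not_orP[n1 n2].
have [f1 a1 e1] : exists2 f, A1 f & mpoly.meval (fun i => coordY M v x 0 i) f <> 0.
  apply: contrapT => nE; apply: n1; apply/(h1 M v x hM hv) => f af; apply: contrapT => ne.
  by apply: nE; exists f.
have [f2 a2 e2] : exists2 f, A2 f & mpoly.meval (fun i => coordY M v x 0 i) f <> 0.
  apply: contrapT => nE; apply: n2; apply/(h2 M v x hM hv) => f af; apply: contrapT => ne.
  by apply: nE; exists f.
have := H (f1 * f2); rewrite mpoly.mevalM => /(_ _)/eqP.
rewrite mulf_eq0 => /(_ _)/orP[]; first by exists f1, f2.
  by move/eqP.
by move/eqP.
Qed.

Lemma horner_meval (F : fieldType) N (f : mpoly.mpoly N F) (h : 'I_N -> {poly F}) l :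
  (mpoly.mmap (@polyC F) h f).[l] = mpoly.meval (fun i => (h i).[l]) f.
Proof.
rewrite /mpoly.meval /mpoly.mmap horner_sum; apply: eq_bigr => m _.
rewrite hornerM hornerC /mpoly.mmap1 horner_prod; congr (_ * _).
by apply: eq_bigr => i _; rewrite horner_exp.
Qed.

Lemma poly_vanish (F : numFieldType) (P g : {poly F}) :
  g != 0 -> (forall l, g.[l] != 0 -> P.[l] = 0) -> P = 0.
Proof.
move=> g0 h; apply/eqP; apply: contraT => P0.
have gP : g * P != 0 by rewrite mulf_neq0.
have := @max_poly_roots _ (g * P) [seq i%:R | i <- iota 0 (size (g * P))] gP.
rewrite size_map size_iota ltnn => H; suff: false by []; apply: H.
  apply/allP => _ /mapP[i _ ->]; rewrite rootE hornerM.
  by have [->|/h ->] := eqVneq g.[i%:R] 0; rewrite ?mul0r ?mulr0.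
rewrite map_inj_uniq ?iota_uniq // => i j /eqP; rewrite eqr_nat => /eqP //.
Qed.

(** A polynomial in one variable that vanishes outside finitely many points is zero. *)
Lemma closed_line (F : numFieldType) p q k (Z : set (ptY F p q)) W L x d (g : {poly F}) :
  zariski_closed k Z -> exoticX k (W, L) -> g != 0 ->
  (forall l, g.[l] != 0 -> Z (W, L, x + l *: d)) -> Z (W, L, x).
Proof.
move=> [_ [A hA]] [/= dW dL] g0 h.
have [M mM rM] := mxim_ex dW; have [v v0 hv] := line_generator dL; subst W L.
apply/(hA M v x rM v0) => f af.
pose c := coordY M v x; pose c1 := coordY (0 : 'M_(p + q, k)) 0 d.
have cE l i : coordY M v (x + l *: d) 0 i = ((c 0 i)%:P + (c1 0 i)%:P * 'X).[l].
  rewrite !hornerE mulrC.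
  have -> : coordY M v (x + l *: d) = c + l *: c1.
    rewrite /c /c1 /coordY !scale_row_mx !add_row_mx -!linearZ /= -!linearD /=.
    by rewrite !scaler0 !addr0.
  by rewrite !mxE.
pose P := mpoly.mmap (@polyC F) (fun i => (c 0 i)%:P + (c1 0 i)%:P * 'X) f.
have PE l : P.[l] = mpoly.meval (fun i => coordY M v (x + l *: d) 0 i) f.
  by rewrite horner_meval; apply: mpoly.meval_eq => i; rewrite cE.
have : P = 0.
  apply: (poly_vanish g0) => l hl; rewrite PE.
  by have /(hA M v _ rM v0) := h l hl; apply.
move/(congr1 (fun P => P.[0])); rewrite PE scale0r addr0 horner0; exact.
Qed.

(** A minor of E0 + l (E1 - E0) is a polynomial in l that does not vanish at l = 1 if the
    minor of E1 does not vanish. *)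
Lemma rank_line (F : fieldType) m n (E0 E1 : 'M[F]_(m, n)) :
  exists2 g : {poly F}, g.[1] != 0 &
    forall l, g.[l] != 0 -> (\rank E1 <= \rank (E0 + l *: (E1 - E0))%R)%N.
Proof.
case hr: (\rank E1) => [|t]; first by exists 1 => [|//]; rewrite hornerE oner_eq0.
have [P [Q hPQ]] : exists P : 'M_(t.+1, m), exists Q : 'M_(n, t.+1), \det (P *m E1 *m Q) <> 0.
  have hn : ~ (\rank E1 <= t)%N by rewrite hr ltnn.
  apply: contrapT => nE; apply: hn; apply/rank_le_det => P Q.
  by apply: contrapT => ne; apply: nE; exists P, Q.
pose G := map_mx (@polyC F) (P *m E0 *m Q) + 'X *: map_mx (@polyC F) (P *m (E1 - E0) *m Q).
have GE l : (\det G).[l] = \det (P *m (E0 + l *: (E1 - E0)) *m Q).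
  rewrite -[LHS]/(horner_eval l _) -det_map_mx; congr (\det _).
  rewrite mulmxDr mulmxDl -scalemxAr -scalemxAl; apply/matrixP => i j.
  by rewrite !mxE [LHS]horner_evalE !hornerE.
exists (\det G) => [|l]; rewrite GE.
  by rewrite scale1r addrC subrK; apply/eqP.
move=> hl; rewrite ltnNge; apply: contraNN hl => /rank_le_det ->; exact: eqxx.
Qed.

(** E is a matrix of polynomials whose value at (M, v, x) has the required rank. *)
Ltac closed_by_rank E := apply: (closed_rank (E := E)) => M v x rM v0;
  rewrite ?(map_row_mx, map_col_mx, map_mxM, map_ursubmx, map_dlsubmx, map_ulsubmx)
    ?(eval_const, eval_XM, eval_Xv, eval_Xx) //=.

Lemma closed_rank_a (F : fieldType) p q k t :
  zariski_closed k [set y : ptY F p q | exoticX k y.1 /\ (\rank (ursubmx y.2) <= t)%N].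
Proof. by closed_by_rank (ursubmx (Xx F p q k)). Qed.

Lemma closed_rank_b (F : fieldType) p q k t :
  zariski_closed k [set y : ptY F p q | exoticX k y.1 /\ (\rank (dlsubmx y.2) <= t)%N].
Proof. by closed_by_rank (dlsubmx (Xx F p q k)). Qed.

Lemma closed_rank_x1 (F : fieldType) p q k t :
  zariski_closed k [set y : ptY F p q | exoticX k y.1 /\ (\rank (ulsubmx y.2) <= t)%N].
Proof. by closed_by_rank (ulsubmx (Xx F p q k)). Qed.

Lemma closed_rank_x1b (F : fieldType) p q k t :
  zariski_closed k [set y : ptY F p q | exoticX k y.1 /\
    (\rank (col_mx (ulsubmx y.2) (dlsubmx y.2)) <= t)%N].
Proof. by closed_by_rank (col_mx (ulsubmx (Xx F p q k)) (dlsubmx (Xx F p q k))). Qed.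

Lemma closed_dim_proj1 (F : fieldType) p q k t :
  zariski_closed k [set y : ptY F p q | exoticX k y.1 /\ (\dim (proj1 y.1.1) <= t)%N].
Proof.
closed_by_rank (map_mx (@mpolyC _ F) (pr1 F p q) *m XM F p q k).
by rewrite -dim_mxim -mxlin_im.
Qed.

Lemma closed_dim_proj2 (F : fieldType) p q k t :
  zariski_closed k [set y : ptY F p q | exoticX k y.1 /\ (\dim (proj2 y.1.1) <= t)%N].
Proof.
closed_by_rank (map_mx (@mpolyC _ F) (pr2 F p q) *m XM F p q k).
by rewrite -dim_mxim -mxlin_im.
Qed.

Lemma closed_dim_WL (F : fieldType) p q k t :
  zariski_closed k [set y : ptY F p q | exoticX k y.1 /\ (\dim (y.1.1 + inV1 q y.1.2) <= t)%N].
Proof.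
closed_by_rank (row_mx (XM F p q k) (map_mx (@mpolyC _ F) (in1 F p q) *m Xv F p q k)).
by rewrite -dim_mxim mxim_row -mxlin_im mxim_cV.
Qed.

Lemma closed_dim_proj1L (F : fieldType) p q k t :
  zariski_closed k [set y : ptY F p q | exoticX k y.1 /\ (\dim (proj1 y.1.1 + y.1.2) <= t)%N].
Proof.
closed_by_rank (row_mx (map_mx (@mpolyC _ F) (pr1 F p q) *m XM F p q k) (Xv F p q k)).
by rewrite -dim_mxim mxim_row -mxlin_im mxim_cV.
Qed.

Lemma closed_dim_imaL (F : fieldType) p q k t :
  zariski_closed k [set y : ptY F p q | exoticX k y.1 /\
    (\dim (mxim (ursubmx y.2) + y.1.2) <= t)%N].
Proof.
closed_by_rank (row_mx (ursubmx (Xx F p q k)) (Xv F p q k)).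
by rewrite -dim_mxim mxim_row mxim_cV.
Qed.

Lemma closed_dim_bL (F : fieldType) p q k t :
  zariski_closed k [set y : ptY F p q | exoticX k y.1 /\
    (\dim (mxlin (dlsubmx y.2) @: y.1.2) <= t)%N].
Proof.
closed_by_rank (dlsubmx (Xx F p q k) *m Xv F p q k).
by rewrite -dim_mxim -mxlin_im mxim_cV.
Qed.

Lemma closed_dim_aproj2 (F : fieldType) p q k t :
  zariski_closed k [set y : ptY F p q | exoticX k y.1 /\
    (\dim (mxlin (ursubmx y.2) @: proj2 y.1.1) <= t)%N].
Proof.
closed_by_rank (ursubmx (Xx F p q k) *m (map_mx (@mpolyC _ F) (pr2 F p q) *m XM F p q k)).
by rewrite -dim_mxim -mxlin_im -mxlin_im.
Qed.

(** * The generic conormal vector *)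

(** The generic ranks of a and b and the generic position of L; q + w1 - k and p + w2 - k
    are the codimensions of proj2 W and proj1 W. *)
Definition phi_r (q k w1 w2 j : nat) :=
  minn w1 (q + w1 - k + ((j == 0) && (w1 + w2 < k)))%N.
Definition phi_s (p k w2 j : nat) := minn (w2 + (j == 1))%N (p + w2 - k).
Definition phi_t (q k w1 w2 j : nat) : nat :=
  (if j == 0 then nat_of_bool (~~ ((w1 + w2 < k) || (k <= q)))
  else if j == 1 then 1 else (w2 != 0).+1)%N.

Lemma pos_le2 (F : fieldType) (vT : vectType F) (U1 U2 L : {vspace vT}) : (pos U1 U2 L <= 2)%N.
Proof. by rewrite /pos; case: ifP => // _; case: ifP. Qed.

Lemma dim_le_cV (F : fieldType) n (U : {vspace 'cV[F]_n}) : (\dim U <= n)%N.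
Proof. by rewrite -[n in leqRHS](@dim_cV F) dimvS ?subvf. Qed.

Lemma pos0 (F : fieldType) (vT : vectType F) (U1 U2 L : {vspace vT}) :
  (pos U1 U2 L == 0%N) = (L <= U1)%VS.
Proof. by rewrite /pos; case: ifP => // _; case: ifP. Qed.
Lemma pos1 (F : fieldType) (vT : vectType F) (U1 U2 L : {vspace vT}) :
  (pos U1 U2 L == 1%N) = ~~ (L <= U1)%VS && (L <= U2)%VS.
Proof. by rewrite /pos; case: ifP => // _; case: ifP. Qed.
Lemma pos2 (F : fieldType) (vT : vectType F) (U1 U2 L : {vspace vT}) : (U1 <= U2)%VS ->
  (pos U1 U2 L == 2%N) = ~~ (L <= U2)%VS.
Proof.
rewrite /pos => h; case: ifP => [/subv_trans/(_ h) ->|_] //; by case: ifP.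
Qed.

Section Generic.
Variables (F : fieldType) (p q k : nat) (W : {vspace 'cV[F]_(p + q)}) (L : {vspace 'cV[F]_p}).
Variables (x1 : 'M[F]_p) (a : 'M[F]_(p, q)) (b : 'M[F]_(q, p)).
Hypotheses (dW : \dim W = k) (dL : \dim L = 1%N) (hfib : fibre W L x1 a b).
Let w1 := \dim (meet1 W).
Let w2 := \dim (meet2 W).
Let j := pos (meet1 W) (proj1 W) L.

Lemma fibre_phi_le : (\rank a <= phi_r q k w1 w2 j)%N /\ (\rank b <= phi_s p k w2 j)%N.
Proof.
have [n1 n2 n3 n4 [n5 n6 n7]] := fibre_num dL hfib.
have := dim_meet1_proj2 W; have := dim_meet2_proj1 W; rewrite dW.
have := dim_le_cV (proj1 W); have := dim_le_cV (proj2 W); have m1 := dimvS (meet1_proj1 W).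
rewrite /phi_r /phi_s !leq_min -/w1 -/w2.
have := pos_le2 (meet1 W) (proj1 W) L.
rewrite -/j in n5 n6 n7 *; rewrite -/w1 -/w2 in n1 n2 n3 n4 n5 n6 n7 m1 *.
case: j n5 n6 n7 => [|[|[|//]]] n5 n6 n7 _ /=.
- move=> e1 e2 e3 e4; have := n5 erefl => ?.
  have [lt|ge] /= := ltnP (w1 + w2) k; first by dim_lia.
  have /n4 n4' : \dim (proj1 W) = w1 by dim_lia.
  by dim_lia.
- by have [] := n6 erefl; dim_lia.
- by have [] := n7 erefl; dim_lia.
Qed.

(** Sufficient open conditions for the invariants of (L, a, b) to be the generic ones. The
    position of L is automatic in most cases; the three extra conditions exclude the others. *)
Lemma fibre_generic :
  (phi_r q k w1 w2 j <= \rank a)%N -> (phi_s p k w2 j <= \rank b)%N ->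
  (j = 0%N -> phi_t q k w1 w2 j = 1%N -> (phi_r q k w1 w2 j < \dim (mxim a + L))%N) ->
  (phi_t q k w1 w2 j = 2%N -> (0 < \dim (mxlin b @: L))%N) ->
  (j = 0%N -> (w1 + w2 < k)%N -> (0 < \dim (mxlin a @: proj2 W))%N) ->
  [/\ \rank a = phi_r q k w1 w2 j, \rank b = phi_s p k w2 j
    & pos (mxim a) (mxker b) L = phi_t q k w1 w2 j].
Proof.
have [la lb] := fibre_phi_le; move=> ga gb c1 c2 c3.
have ra : \rank a = phi_r q k w1 w2 j by apply/eqP; rewrite eqn_leq la ga.
have rb : \rank b = phi_s p k w2 j by apply/eqP; rewrite eqn_leq lb gb.
have [ab ba] := fibre_ab hfib; have iak : (mxim a <= mxker b)%VS by rewrite im_ker ba.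
split=> //; apply/eqP; move: (erefl j) c1 c2 c3 ra rb; rewrite {2}/j.
have hmp := meet1_proj1 W; have imm := fibre_ima hfib; have pker := fibre_kerb hfib.
have [hL|nL] := boolP (L <= meet1 W)%VS.
  have -> : pos (meet1 W) (proj1 W) L = 0%N by apply/eqP; rewrite pos0.
  move=> -> c1 _ c3; rewrite /phi_t /=.
  have [lt|ge] /= := ltnP (w1 + w2) k.
    move=> _ _; rewrite pos0.
    have := c3 erefl lt; rewrite lt0n dimv_eq0 => /negP ne.
    have : ~~ (mxlin a @: proj2 W <= 0)%VS by rewrite subv0; apply/negP.
    case/subvPn => v hv; rewrite memv0 => v0.
    apply: (line_sub dL _ v0); first exact: (subvP (fibre_aproj hfib)).
    by apply: (subvP (limgS _ (subvf _))) hv.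
  have [kq|qk] /= := leqP k q => ra rb.
    rewrite pos0; apply: subv_trans hL _.
    have /eqP -> : mxim a == meet1 W by rewrite eqEdim imm dim_mxim ra /phi_r /= -/w1; dim_lia.
    exact: subvv.
  rewrite pos1 (subv_trans hL (subv_trans hmp pker)) andbT.
  apply/negP => hLa; have := c1 erefl; rewrite /phi_t /= ltnNge ge leqNgt qk => /(_ erefl).
  by rewrite (addv_idPl hLa) dim_mxim ra ltnn.
have nLa : ~~ (L <= mxim a)%VS by apply: contra nL => h; apply: subv_trans h imm.
have [hP|nP] := boolP (L <= proj1 W)%VS.
  have -> : pos (meet1 W) (proj1 W) L = 1%N by apply/eqP; rewrite pos1 nL hP.
  by move=> -> _ _ _ _ _; rewrite /phi_t /= pos1 nLa (subv_trans hP pker).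
have -> : pos (meet1 W) (proj1 W) L = 2%N by apply/eqP; rewrite pos2.
move=> -> _ c2 _ _; rewrite /phi_t /phi_s /= => rb.
have [w0|w0] := eqVneq w2 0%N; last first.
  rewrite pos2 //=; apply/negP => hb; have := c2; rewrite /phi_t /= w0 => /(_ erefl).
  by move: hb; rewrite lkerE => /eqP ->; rewrite dimv0.
rewrite pos1 nLa /= (_ : mxker b = fullv) ?subvf //.
apply/eqP; rewrite eqEdim subvf /= dim_cV; have := dim_mxker b; rewrite rb w0; dim_lia.
Qed.

End Generic.

Lemma mx_on_basis3 (F : fieldType) m n (f1 f2 f3 : seq 'cV[F]_n) (z1 z2 z3 : seq 'cV[F]_m) :
  is_basis (f1 ++ f2 ++ f3) -> size z1 = size f1 -> size z2 = size f2 -> size z3 = size f3 ->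
  exists A : 'M[F]_(m, n),
    [/\ map (mulmx A) f1 = z1, map (mulmx A) f2 = z2 & map (mulmx A) f3 = z3].
Proof.
move=> hf s1 s2 s3; have [] := @mx_on_basis _ m _ _ (z1 ++ z2 ++ z3) hf.
  by rewrite !size_cat s1 s2 s3 -!size_cat; case: hf.
move=> A; rewrite !map_cat => /eqP; rewrite eqseq_cat ?size_map // => /andP[/eqP e1].
by rewrite eqseq_cat ?size_map // => /andP[/eqP e2 /eqP e3]; exists A.
Qed.

Lemma map_nth0 (F : fieldType) m n (A : 'M[F]_(m, n)) (f : seq 'cV_n) (z : seq 'cV_m) i : map
  (mulmx A) f = z ->
  A *m f`_i = z`_i.
Proof.
move=> <-; have [hi|hi] := ltnP i (size f); first by rewrite (nth_map 0).
by rewrite !nth_default ?size_map // mulmx0.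
Qed.

Lemma nth_nseq0 (F : fieldType) n l i : (nseq l (0 : 'cV[F]_n))`_i = 0.
Proof. by rewrite nth_nseq if_same. Qed.

Lemma basis_ind (F : fieldType) n (e : seq 'cV[F]_n) (U : {vspace 'cV[F]_n}) :
  is_basis e -> (forall i, e`_i \in U) -> U = fullv.
Proof.
move=> [_ he] h; apply/eqP; rewrite eqEsubv subvf -he; apply/span_subvP => v.
by case/(nthP 0) => i _ <-.
Qed.

Lemma nth_cat3 (F : fieldType) n (e1 e2 e3 : seq 'cV[F]_n) (P : 'cV[F]_n -> Prop) :
  (forall i, P e1`_i) -> (forall i, P e2`_i) -> (forall i, P e3`_i) ->
  forall i, P (e1 ++ e2 ++ e3)`_i.
Proof. by move=> h1 h2 h3 i; rewrite !nth_cat; case: ifP => // _; case: ifP. Qed.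

(** The conditions that define the fibre are linear, so they can be tested on adapted
    bases. *)
Lemma fibre_adapted (F : fieldType) p q (W : {vspace 'cV[F]_(p + q)}) (L : {vspace 'cV[F]_p})
    e1 e2 e3 f1 f2 f3 (x1 : 'M[F]_p) (a : 'M[F]_(p, q)) (b : 'M[F]_(q, p)) :
  adapted W e1 e2 e3 f1 f2 f3 ->
  (L <= mxker x1)%VS ->
  (forall i, x1 *m e1`_i = 0 /\ b *m e1`_i = 0) ->
  (forall i, [/\ x1 *m e2`_i \in L, x1 *m e2`_i \in meet1 W, b *m e2`_i = 0
     & x1 *m e2`_i + a *m f1`_i = 0]) ->
  (forall i, x1 *m e3`_i \in L /\ col_mx (x1 *m e3`_i) (b *m e3`_i) \in W) ->
  (forall i, a *m f2`_i = 0) -> (forall i, a *m f3`_i \in meet1 W) ->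
  fibre W L x1 a b.
Proof.
move=> hA hLk h1 h2 h3 h4 h5; have [[m1 m2 m3 m4] _] := adapted_spaces hA.
case: hA => he hf hs hW.
have full_e (U : {vspace 'cV[F]_p}) v : (forall i, e1`_i \in U) -> (forall i, e2`_i \in U) ->
    (forall i, e3`_i \in U) -> v \in U.
  by move=> u1 u2 u3; rewrite (@basis_ind _ _ _ U he) ?memvf //; apply: (nth_cat3 (P :=
    fun x => x \in U)).
have full_f (U : {vspace 'cV[F]_q}) v : (forall i, f1`_i \in U) -> (forall i, f2`_i \in U) ->
    (forall i, f3`_i \in U) -> v \in U.
  by move=> u1 u2 u3; rewrite (@basis_ind _ _ _ U hf) ?memvf //; apply: (nth_cat3 (P :=
    fun x => x \in U)).
have pre m n (A : 'M[F]_(m, n)) U (v : 'cV[F]_n) : (v \in (mxlin A @^-1: U)%VS) = (A *m v \in U).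
  by rewrite -mxlinE; apply/esym; exact: memv_preim.
split=> //.
- apply/subvP => _ /memv_imgP[v _ ->]; rewrite mxlinE -pre; apply: full_e => i; rewrite pre.
  + by have [-> _] := h1 i; exact: mem0v.
  + by have [] := h2 i.
  + by have [] := h3 i.
- move=> v; rewrite -mul_col_mx -pre; apply: full_e => i; rewrite pre mul_col_mx.
  + by have [-> ->] := h1 i; rewrite col_mx0; exact: mem0v.
  + by have [_ hm -> _] := h2 i; rewrite -mem_meet1.
  + by have [] := h3 i.
- move=> v; rewrite -mem_meet1 -pre; apply: full_f => i; rewrite pre.
  + have [_ hm _ h0] := h2 i.
    by rewrite -(addKr (x1 *m e2`_i) (a *m f1`_i)) h0 addr0 memvN.
  + by rewrite h4; exact: mem0v.
  + exact: h5.
move=> w w' hw; have : block_mx x1 a b 0 *m col_mx w w' = 0.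
  apply/eqP; rewrite -memv_mxker; move: hw; rewrite hW; apply/subvP.
  apply: glue_sub => [x|i _ _|y].
  - case/(nthP 0) => i _ <-; have [u1 u2] := h1 i.
    by rewrite memv_mxker block4_col u1 u2 !mulmx0 !addr0 col_mx0; exact: eqxx.
  - have [_ _ u2 u3] := h2 i.
    by rewrite memv_mxker block4_col u2 u3 !mul0mx !addr0 col_mx0; exact: eqxx.
  - case/(nthP 0) => i _ <-.
    by rewrite memv_mxker block4_col h4 !mulmx0 !mul0mx !addr0 col_mx0; exact: eqxx.
rewrite block4_col mul0mx addr0 => /eqP; rewrite col_mx_eq0 => /andP[/eqP ? /eqP ?].
by [].
Qed.

Lemma free_le (F : fieldType) n (s : seq 'cV[F]_n) (U : {vspace 'cV[F]_n}) :
  free s -> (forall i, (i < size s)%N -> s`_i \in U) -> (size s <= \dim U)%N.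
Proof.
move=> hs h; rewrite -(free_dim hs); apply: dimvS; apply/span_subvP => x /(nthP 0)[i hi <-].
exact: h.
Qed.

Lemma free_take (F : fieldType) n l (s : seq 'cV[F]_n) : free s -> free (take l s).
Proof. by rewrite -{1}(cat_take_drop l s) => /catl_free. Qed.

Lemma free_nth0 (F : fieldType) n (s : seq 'cV[F]_n) i : free s -> (i < size s)%N -> s`_i != 0.
Proof. by move=> hs hi; apply: (free_not0 hs); rewrite mem_nth. Qed.

Definition resize0 (F : fieldType) n l (s : seq 'cV[F]_n) := mkseq (nth 0 s) l.

Lemma nth_resize0 (F : fieldType) n l (s : seq 'cV[F]_n) i :
  (resize0 l s)`_i = if (i < l)%N then s`_i else 0.
Proof.
rewrite /resize0; have [hi|hi] := ltnP i l; first by rewrite nth_mkseq.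
by rewrite nth_default // size_mkseq.
Qed.

Lemma size_resize0 (F : fieldType) n l (s : seq 'cV[F]_n) : size (resize0 l s) = l.
Proof. by rewrite size_mkseq. Qed.

Lemma resize0_mem (F : fieldType) n l (s : seq 'cV[F]_n) (U : {vspace 'cV[F]_n}) i :
  (<<s>> <= U)%VS -> (resize0 l s)`_i \in U.
Proof.
move=> h; rewrite nth_resize0; case: ifP => _; last exact: mem0v.
have [hi|hi] := ltnP i (size s); last by rewrite nth_default ?mem0v.
by apply: (subvP h); apply: memv_span; exact: mem_nth.
Qed.

Lemma rank_ge_resize0 (F : fieldType) m n (A : 'M[F]_(m, n)) (f : seq 'cV_n) l
  (s : seq 'cV[F]_m) :
  free s -> map (mulmx A) f = resize0 l s -> (minn l (size s) <= \rank A)%N.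
Proof.
move=> hs hA; rewrite -size_take_min -dim_mxim; apply: free_le; first exact: free_take.
move=> i; rewrite size_take_min leq_min => /andP[i1 i2]; rewrite nth_take //.
have := map_nth0 i hA; rewrite nth_resize0 i1 => <-; exact: memv_mxim.
Qed.

Section Witness.
Variables (F : fieldType) (p q k : nat) (W : {vspace 'cV[F]_(p + q)}) (L : {vspace 'cV[F]_p}).
Hypotheses (dW : \dim W = k) (dL : \dim L = 1%N).
Let w1 := \dim (meet1 W).
Let w2 := \dim (meet2 W).
Let j := pos (meet1 W) (proj1 W) L.

(** Besides the conditions of [fibre_generic], two facts about x1 that separate the fibre
    over (W, L) from the preimages of other orbits. *)
Definition witness_spec (x1 : 'M[F]_p) (a : 'M[F]_(p, q)) (b : 'M[F]_(q, p)) :=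
  [/\ fibre W L x1 a b,
      (phi_r q k w1 w2 j <= \rank a)%N /\ (phi_s p k w2 j <= \rank b)%N,
      [/\ j = 0%N -> phi_t q k w1 w2 j = 1%N -> (phi_r q k w1 w2 j < \dim (mxim a + L))%N,
          phi_t q k w1 w2 j = 2%N -> (0 < \dim (mxlin b @: L))%N
        & j = 0%N -> (w1 + w2 < k)%N -> (0 < \dim (mxlin a @: proj2 W))%N],
      (j < 2)%N -> (\dim (proj1 W) < p)%N -> (0 < \rank x1)%N
    & j = 0%N -> (w1 + w2 = k)%N -> (minn w2.+1 (p + w2 - k) <= \rank (col_mx x1 b))%N].

Lemma dim_gt0 n (U : {vspace 'cV[F]_n}) (v : 'cV[F]_n) : v != 0 -> v \in U -> (0 < \dim U)%N.
Proof.
move=> v0 vU; have /dimvS : (<[v]> <= U)%VS by rewrite -memvE.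
by rewrite dim_vline v0.
Qed.

Lemma witness_ex : exists x1 a b, witness_spec x1 a b.
Proof.
have [e1 [e2 [e3 [f1 [f2 [f3 [hA hL]]]]]]] := adapted_ex W dL.
have [[m1 m2 m3 m4] [s1 s2 s3]] := adapted_spaces hA.
have [he hf hs hW] := hA; rewrite -/j in hL.
have sE : (size e1 + size e2 + size e3)%N = p.
  by have := he.1; rewrite !size_cat addnA.
have sF : (size f1 + size f2 + size f3)%N = q.
  by have := hf.1; rewrite !size_cat addnA.
have fe := is_basis_free he; have ff := is_basis_free hf.
have fe1 := catl_free fe; have fe23 := catr_free fe.
have fe2 := catl_free fe23; have fe3 := catr_free fe23.
have ff1 := catl_free ff; have ff23 := catr_free ff; have ff2 := catl_free ff23.
rewrite dW in s3; rewrite -/w1 in s1; rewrite -/w2 in s2.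
have eu : (q + w1 - k)%N = size f3 by dim_lia.
have ev : (p + w2 - k)%N = size e3 by dim_lia.
have dP1 : \dim (proj1 W) = (size e1 + size e2)%N.
  by have := dim_meet2_proj1 W; rewrite -/w2; dim_lia.
have h0 : head 0%R (nth [::] [:: e1; e2; e3] j) != 0.
  by apply/negP => /eqP h; move: dL; rewrite hL h dim_vline eqxx.
have memL : head 0%R (nth [::] [:: e1; e2; e3] j) \in L by rewrite hL memv_line.
have jle : (j <= 2)%N := pos_le2 _ _ _.
have hj : j = pos (meet1 W) (proj1 W) L by [].
rewrite /witness_spec /phi_r /phi_s eu ev.
clearbody j; case: j hL h0 memL jle hj => [|[|[|//]]] /= hL h0 memL _ hj.
- (* L <= W: x1 may be nonzero on proj1 W, and then a compensates it along f1; this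
     raises the rank of a by one *)
  case: e1 => [|h e1'] /= in hA m1 m2 s1 s3 he hW sE fe fe1 dP1 hL h0 memL *.
    by rewrite eqxx in h0.
  have he' : is_basis ((h :: e1') ++ e2 ++ e3) := he.
  set t := size e2; set u := size f3; set v := size e3.
  have hm : h \in meet1 W by rewrite m1 memv_span ?mem_head.
  have [x1 [X1 X2 X3]] := @mx_on_basis3 _ p _ _ _ _ (nseq (size (h :: e1')) 0)
    (resize0 t [:: - h]) (nseq v h) he' (size_nseq _ _) (size_resize0 _ _) (size_nseq _ _).
  have [b [B1 B2 B3]] := @mx_on_basis3 _ q _ _ _ _ (nseq (size (h :: e1')) 0)
    (nseq t 0) (resize0 v f2) he' (size_nseq _ _) (size_nseq _ _) (size_resize0 _ _).
  (* h is put last in the list of images of f3, so that for u < w1 it is not one of them *)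
  have [a [A1 A2 A3]] := @mx_on_basis3 _ p _ _ _ _ (resize0 t [:: h])
    (nseq (size f2) 0) (resize0 u (rcons e1' h)) hf (etrans (size_resize0 _ _) hs)
      (size_nseq _ _) (size_resize0 _ _).
  have pr : perm_eq (rcons e1' h) (h :: e1') by rewrite perm_rcons.
  have frc : free (rcons e1' h) by rewrite (perm_free pr).
  have hfib : fibre W L x1 a b.
    apply: (fibre_adapted hA).
    + have -> : L = <[h]>%VS by [].
      by rewrite -memvE memv_mxker (map_nth0 0%N X1); exact: eqxx.
    + by move=> i; rewrite (map_nth0 i X1) (map_nth0 i B1) !nth_nseq0.
    + move=> i; rewrite (map_nth0 i X2) (map_nth0 i B2) (map_nth0 i A1) nth_nseq0.
      split=> //; try by apply: resize0_mem; rewrite span_seq1 -memvE memvN.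
      by rewrite !nth_resize0; case: i => [|i] /=; case: ifP => _;
        rewrite ?nth_nil ?addr0 // addNr.
    + move=> i; rewrite (map_nth0 i X3) (map_nth0 i B3).
      have hx : (nseq v h)`_i \in L by rewrite nth_nseq; case: ifP => // _; exact: mem0v.
      split=> //.
      have -> : col_mx (nseq v h)`_i (resize0 v f2)`_i = col_mx (nseq v h)`_i 0 + col_mx 0
        (resize0 v f2)`_i.
        by rewrite add_col_mx addr0 add0r.
      apply: memvD; first by rewrite -mem_meet1 nth_nseq; case: ifP => // _; exact: mem0v.
      by rewrite -mem_meet2; apply: resize0_mem; rewrite m3; exact: subvv.
    + by move=> i; rewrite (map_nth0 i A2) nth_nseq0.
    + move=> i; rewrite (map_nth0 i A3); apply: resize0_mem.
      by rewrite (eq_span (perm_mem pr)) m1; exact: subvv.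
  have rb : (minn v w2 <= \rank b)%N by have := rank_ge_resize0 ff2 B3; dim_lia.
  have keyD (U : {vspace 'cV[F]_p}) : h \in U -> (mxim a <= U)%VS -> (minn u.+1 w1 <= \dim U)%N.
    move=> hU aU; have hsz : size (take u.+1 (h :: e1')) = minn u.+1 w1.
      by rewrite size_take_min s1.
    rewrite -hsz; apply: free_le; first exact: free_take.
    move=> [|i]; rewrite size_take_min leq_min => /andP[i1 i2]; first by [].
    rewrite nth_take //= -[_`_i](_ : (rcons e1' h)`_i = _); last first.
      by rewrite nth_rcons; case: ltnP => // hi; move: i2; rewrite /= ltnS ltnNge hi.
    have := map_nth0 i A3; rewrite nth_resize0; rewrite ltnS in i1; rewrite i1 => <-.
    by apply: (subvP aU); exact: memv_mxim.
  have af1 : (0 < t)%N -> a *m f1`_0 = h.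
    by move=> t0; rewrite (map_nth0 0%N A1) nth_resize0 t0.
  exists x1, a, b; split=> //.
  + split; last by rewrite addn0 minnC; exact: rb.
    have [lt|ge] := ltnP (w1 + w2) k; last first.
      rewrite addn0; have := rank_ge_resize0 frc A3; rewrite (perm_size pr) /=.
      by rewrite -/u; dim_lia.
    rewrite addn1 minnC -dim_mxim; apply: keyD; last exact: subvv.
    by rewrite -af1; [exact: memv_mxim|rewrite /t; dim_lia].
  + split=> //.
    - move=> _; rewrite /phi_t /=; have [//|ge] := ltnP (w1 + w2) k.
      have [//|qk] /= := leqP k q => _.
      rewrite addn0; have hD : (minn u.+1 w1 <= \dim (mxim a + L))%N.
        by apply: keyD; [apply: (subvP (addvSr _ _))|exact: addvSl].
      by apply: leq_trans hD; dim_lia.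
    - by rewrite /phi_t /=; case: (~~ _).
    - move=> _ lt; have t0 : (0 < t)%N by rewrite /t; dim_lia.
      apply: (dim_gt0 h0); rewrite -af1 // -mxlinE; apply: memv_img.
      by rewrite m4 memv_span // mem_cat mem_nth // -hs.
  + move=> _ lt; have v0 : (0 < v)%N by rewrite /v; dim_lia.
    rewrite -dim_mxim; apply: (dim_gt0 h0).
    have := map_nth0 0%N X3; rewrite nth_nseq v0 => <-; exact: memv_mxim.
  + move=> _ ek; have := fibre_rankb x1 b; rewrite -/v.
    have [vw|wv] := leqP v w2; first by move: rb; dim_lia.
    move=> _; rewrite -dim_mxim -(dim_meet1_proj2 (mxim _)).
    have : (0 < \dim (meet1 (mxim (col_mx x1 b))))%N.
      apply: (dim_gt0 h0); rewrite mem_meet1.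
      have := map_nth0 w2 X3; rewrite nth_nseq wv => <-.
      have := map_nth0 w2 B3; rewrite nth_resize0 wv [f2`_w2]nth_default ?s2 // => <-.
      by rewrite -mul_col_mx; exact: memv_mxim.
    have -> : proj2 (mxim (col_mx x1 b)) = mxim b.
      by rewrite /proj2 mxlin_im /pr2 mul_row_col mul0mx mul1mx add0r.
    by rewrite dim_mxim; move: rb; dim_lia.
- (* b may also use c, the second component of a vector of W over the generator h of L,
     provided that x1 produces h at the same time *)
  case: e2 => [|h e2'] /= in hA m2 s3 he hW hs sE fe fe2 fe23 dP1 hL h0 memL *.
    by rewrite eqxx in h0.
  case: f1 => [|c f1'] //= in hA m4 he hf hW hs sF ff ff1 *.
  have he' : is_basis (e1 ++ (h :: e2') ++ e3) := he.
  have hf' : is_basis ((c :: f1') ++ f2 ++ f3) := hf.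
  set u := size f3; set v := size e3; set t := size (h :: e2').
  have [x1 [X1 X2 X3]] := @mx_on_basis3 _ p _ _ _ _ (nseq (size e1) 0)
    (nseq t 0) (resize0 v [:: h]) he' (size_nseq _ _) (size_nseq _ _) (size_resize0 _ _).
  have [b [B1 B2 B3]] := @mx_on_basis3 _ q _ _ _ _ (nseq (size e1) 0)
    (nseq t 0) (resize0 v (c :: f2)) he' (size_nseq _ _) (size_nseq _ _) (size_resize0 _ _).
  have [a [A1 A2 A3]] := @mx_on_basis3 _ p _ _ _ _ (nseq (size (c :: f1')) 0)
    (nseq (size f2) 0) (resize0 u e1) hf' (size_nseq _ _) (size_nseq _ _) (size_resize0 _ _).
  have hcW : col_mx h c \in W.
    by rewrite hW memv_span // !mem_cat /= mem_head orbT.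
  have fcf : free (c :: f2).
    have pe : perm_eq (c :: f1' ++ f2 ++ f3) ((c :: f2) ++ (f1' ++ f3)).
      by rewrite /= perm_cons perm_catCA perm_refl.
    by move: ff; rewrite (perm_free pe) => /catl_free.
  have hfib : fibre W L x1 a b.
    apply: (fibre_adapted hA).
    + have -> : L = <[h]>%VS by [].
      by rewrite -memvE memv_mxker (map_nth0 0%N X2) nth_nseq0; exact: eqxx.
    + by move=> i; rewrite (map_nth0 i X1) (map_nth0 i B1) !nth_nseq0.
    + move=> i; rewrite (map_nth0 i X2) (map_nth0 i B2) (map_nth0 i A1) !nth_nseq0 addr0.
      by split=> //; exact: mem0v.
    + move=> i; rewrite (map_nth0 i X3) (map_nth0 i B3).
      split; first by apply: resize0_mem; rewrite span_seq1 -memvE.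
      rewrite !nth_resize0; case: ifP => _; last by rewrite col_mx0; exact: mem0v.
      case: i => [|i] //=; rewrite nth_nil -mem_meet2 m3.
      have [hi|hi] := ltnP i (size f2); last by rewrite nth_default ?mem0v.
      by apply: memv_span; exact: mem_nth.
    + by move=> i; rewrite (map_nth0 i A2) nth_nseq0.
    + by move=> i; rewrite (map_nth0 i A3); apply: resize0_mem; rewrite m1; exact: subvv.
  exists x1, a, b; split=> //.
  + split; first by rewrite addn0; have := rank_ge_resize0 fe1 A3; rewrite -/u; dim_lia.
    by have := rank_ge_resize0 fcf B3; rewrite /= -/v; dim_lia.
  + move=> _ lt; have v0 : (0 < v)%N by rewrite /v; dim_lia.
    rewrite -dim_mxim; apply: (dim_gt0 h0).
    have := map_nth0 0%N X3; rewrite nth_resize0 v0 /= => <-; exact: memv_mxim.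
- (* x1 vanishes; the generator of L is the head of e3, which b sends to the head of f2 *)
  set u := size f3; set v := size e3.
  have [b [B1 B2 B3]] := @mx_on_basis3 _ q _ _ _ _ (nseq (size e1) 0)
    (nseq (size e2) 0) (resize0 v f2) he (size_nseq _ _) (size_nseq _ _) (size_resize0 _ _).
  have [a [A1 A2 A3]] := @mx_on_basis3 _ p _ _ _ _ (nseq (size f1) 0)
    (nseq (size f2) 0) (resize0 u e1) hf (size_nseq _ _) (size_nseq _ _) (size_resize0 _ _).
  have hfib : fibre W L 0 a b.
    apply: (fibre_adapted hA).
    + by apply/subvP => x _; rewrite memv_mxker mul0mx; exact: eqxx.
    + by move=> i; rewrite (map_nth0 i B1) mul0mx !nth_nseq0.
    + move=> i; rewrite (map_nth0 i B2) (map_nth0 i A1) !nth_nseq0 mul0mx addr0.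
      by split=> //; exact: mem0v.
    + move=> i; rewrite mul0mx (map_nth0 i B3); split; first exact: mem0v.
      by rewrite -mem_meet2; apply: resize0_mem; rewrite m3; exact: subvv.
    + by move=> i; rewrite (map_nth0 i A2) nth_nseq0.
    + by move=> i; rewrite (map_nth0 i A3); apply: resize0_mem; rewrite m1; exact: subvv.
  exists 0, a, b; split=> //.
  + split; first by rewrite addn0; have := rank_ge_resize0 fe1 A3; rewrite -/u; dim_lia.
    by rewrite addn0; have := rank_ge_resize0 ff2 B3; rewrite /= -/v; dim_lia.
  + split=> //; rewrite /phi_t /=; have [//|w0 _] := eqVneq w2 0%N.
    have v0 : (0 < v)%N.
      by rewrite lt0n; apply: contra h0 => /nilP ->.
    have f20 : f2`_0 != 0 by apply: free_nth0 => //; rewrite -s2 lt0n.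
    apply: (dim_gt0 f20).
    have := map_nth0 0%N B3; rewrite nth_resize0 v0 => <-; rewrite nth0 -mxlinE.
    exact: memv_img.
Qed.

End Witness.

(** * Closures of conormal bundles *)

Lemma fibre_line (F : fieldType) p q (W : {vspace 'cV[F]_(p + q)}) (L : {vspace 'cV[F]_p})
    x1 a b x1' a' b' l :
  fibre W L x1 a b -> fibre W L x1' a' b' ->
  fibre W L (x1 + l *: (x1' - x1)) (a + l *: (a' - a)) (b + l *: (b' - b)).
Proof.
have aff m n (A A' : 'M[F]_(m, n)) (v : 'cV_n) :
    (A + l *: (A' - A)) *m v = (1 - l) *: (A *m v) + l *: (A' *m v).
  by rewrite mulmxDl -scalemxAl mulmxBl scalerBr scalerBl scale1r addrAC addrA.
move=> [f1 f2 f3 f4 f5] [g1 g2 g3 g4 g5]; split.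
- apply/subvP => _ /memv_imgP[v _ ->]; rewrite mxlinE aff.
  apply: memvD; apply: memvZ; first by apply: (subvP f1); exact: memv_mxim.
  by apply: (subvP g1); exact: memv_mxim.
- apply/subvP => v hv; rewrite memv_mxker aff.
  have := subvP f2 _ hv; have := subvP g2 _ hv; rewrite !memv_mxker => /eqP -> /eqP ->.
  by rewrite !scaler0 addr0; exact: eqxx.
- move=> v; rewrite !aff.
  have -> : col_mx ((1 - l) *: (x1 *m v) + l *: (x1' *m v)) ((1 - l) *: (b *m v) + l *: (b' *m v))
    = (1 - l) *: col_mx (x1 *m v) (b *m v) + l *: col_mx (x1' *m v) (b' *m v).
    by rewrite !scale_col_mx add_col_mx.
  by apply: memvD; apply: memvZ.
- move=> v; rewrite aff.
  have -> : col_mx ((1 - l) *: (a *m v) + l *: (a' *m v)) (0 : 'cV_q)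
    = (1 - l) *: col_mx (a *m v) 0 + l *: col_mx (a' *m v) 0.
    by rewrite !scale_col_mx !scaler0 add_col_mx addr0.
  by apply: memvD; apply: memvZ.
move=> w w' hw; have [u1 u2] := f5 _ _ hw; have [t1 t2] := g5 _ _ hw.
rewrite !aff u2 t2 !scaler0 addr0; split=> //.
by rewrite addrACA -!scalerDr u1 t1 !scaler0 addr0.
Qed.

Lemma conormal_block (F : fieldType) p q k (W : {vspace 'cV[F]_(p + q)})
  (L : {vspace 'cV[F]_p}) x1 a b :
  \dim W = k -> \dim L = 1%N -> fibre W L x1 a b -> conormalY k (W, L, block_mx x1 a b 0).
Proof.
by move=> dW dL h; apply/conormalP; rewrite block_mxKul block_mxKur block_mxKdl block_mxKdr.
Qed.

Definition pi_preimage (F : fieldType) p q k (N : set (ptE F p q)) : set (ptY F p q) :=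
  conormalY k `&` @piYE F p q @^-1` N.

Lemma pi_preimage_block (F : fieldType) p q k (W : {vspace 'cV[F]_(p + q)})
  (L : {vspace 'cV[F]_p})
    x1 a b r s t :
  \dim W = k -> \dim L = 1%N -> fibre W L x1 a b ->
  \rank a = r -> \rank b = s -> pos (mxim a) (mxker b) L = t ->
  pi_preimage k (stratumE k r s t) (W, L, block_mx x1 a b 0).
Proof.
move=> dW dL hf ra rb hp; split; first exact: conormal_block.
rewrite /piYE /= /mtheta block_mxKur block_mxKdl; split; first exact: fibre_exotic hf k dW.
by rewrite /= block_mxKur block_mxKdl.
Qed.

Definition stratumPhi (F : fieldType) (p q k w1 w2 j : nat) : set (ptE F p q) :=
  stratumE k (phi_r q k w1 w2 j) (phi_s p k w2 j) (phi_t q k w1 w2 j).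

(** The line through x and the witness meets the preimage of the generic orbit outside
    finitely many points, because the ranks that matter do not drop outside finitely many
    points. *)
Lemma generic_in_closure (F : numFieldType) p q k w1 w2 j (Z : set (ptY F p q)) :
  zariski_closed k Z -> pi_preimage k (stratumPhi k w1 w2 j) `<=` Z ->
  conormal_bundle k (stratumX k w1 w2 j) `<=` Z.
Proof.
move=> cZ hZ [[W L] x] [/conormalP[dW dL d0 hf] [hX [/= e1 e2 e3]]].
subst w1 w2 j.
have [x1 [a [b [hf' [ra rb] [c1 c2 c3] _ _]]]] := witness_ex dW dL.
set w1 := \dim (meet1 W) in hZ ra rb c1 c2 c3; set w2 := \dim (meet2 W) in hZ ra rb c1 c2 c3.
set j := pos _ _ _ in hZ ra rb c1 c2 c3.
move: hf; set y1 := ulsubmx x; set a0 := ursubmx x; set b0 := dlsubmx x => hf.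
have ex : x = block_mx y1 a0 b0 0 by rewrite -d0 submxK.
have [v v0 hv] := line_generator dL.
have [B0 mB rB] := mxim_ex (erefl (\dim (proj2 W))).
have [g1 u1 G1] := rank_line a0 a.
have [g2 u2 G2] := rank_line b0 b.
have [g3 u3 G3] := rank_line (row_mx a0 v) (row_mx a v).
have [g4 u4 G4] := rank_line (b0 *m v) (b *m v).
have [g5 u5 G5] := rank_line (a0 *m B0) (a *m B0).
pose g := g1 * g2 * g3 * g4 * g5.
have g0 : g != 0.
  apply/eqP => e; have := congr1 (horner^~ 1) e; rewrite horner0 /g !hornerM => /eqP.
  by rewrite !mulf_eq0 (negbTE u1) (negbTE u2) (negbTE u3) (negbTE u4) (negbTE u5).
apply: (@closed_line F p q k Z W L x (block_mx x1 a b 0 - x) g cZ hX g0) => l.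
rewrite /g !hornerM !mulf_eq0 !negb_or => /andP[/andP[/andP[/andP[l1 l2] l3] l4] l5].
apply: hZ; rewrite ex opp_block_mx add_block_mx scale_block_mx add_block_mx subrr scaler0 addr0.
have hfl := fibre_line l hf hf'.
have [] := fibre_generic dW dL hfl; rewrite -/w1 -/w2 -/j.
- exact: leq_trans ra (G1 l l1).
- exact: leq_trans rb (G2 l l2).
- move=> j0 t1; apply: leq_trans (c1 j0 t1) _.
  rewrite hv -!mxim_cV -!mxim_row !dim_mxim.
  have := G3 l l3; rewrite opp_row_mx add_row_mx scale_row_mx add_row_mx.
  by rewrite subrr scaler0 addr0.
- move=> t2; apply: leq_trans (c2 t2) _.
  rewrite hv -!mxim_cV !mxlin_im !dim_mxim.
  by have := G4 l l4; rewrite -mulmxBl scalemxAl -mulmxDl.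
- move=> j0 lt; apply: leq_trans (c3 j0 lt) _.
  rewrite -mB !mxlin_im !dim_mxim.
  by have := G5 l l5; rewrite -mulmxBl scalemxAl -mulmxDl.
by move=> e1 e2 e3; apply: pi_preimage_block hfl e1 e2 e3.
Qed.

Lemma stratumE_ranks (F : fieldType) p q k r s t (z : ptE F p q) : stratumE k r s t z ->
  [/\ (r + s <= p)%N, (r + s <= q)%N & (r + s <= minn k (p + q - k))%N].
Proof.
case: z => L x [/exoticE_ab[_ _ ab ba hr] [/= <- <- _]].
have d1 := dim_mxker (ursubmx x); have d2 := dim_mxker (dlsubmx x).
have : (mxim (dlsubmx x) <= mxker (ursubmx x))%VS by rewrite im_ker ab.
have : (mxim (ursubmx x) <= mxker (dlsubmx x))%VS by rewrite im_ker ba.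
by move=> /rank_sub h1 /rank_sub h2; split=> //; dim_lia.
Qed.

Lemma pi_preimageP (F : fieldType) p q k r s t (W : {vspace 'cV[F]_(p + q)})
  (L : {vspace 'cV[F]_p}) x :
  pi_preimage k (stratumE k r s t) (W, L, x) ->
  [/\ \dim W = k, \dim L = 1%N, fibre W L (ulsubmx x) (ursubmx x) (dlsubmx x)
   & [/\ \rank (ursubmx x) = r, \rank (dlsubmx x) = s
     & pos (mxim (ursubmx x)) (mxker (dlsubmx x)) L = t]].
Proof.
case=> /conormalP[dW dL _ hf] [_]; rewrite /piYE /= /mtheta block_mxKur block_mxKdl.
by case=> ? ? ?.
Qed.

Section Unique.
Variables (F : fieldType) (p q k : nat) (W : {vspace 'cV[F]_(p + q)}) (L : {vspace 'cV[F]_p}).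
Hypotheses (dW : \dim W = k) (dL : \dim L = 1%N).
Let w1 := \dim (meet1 W).
Let w2 := \dim (meet2 W).
Let j := pos (meet1 W) (proj1 W) L.
Variables (r s t : nat).
Hypothesis (ne : exists z, @stratumE F p q k r s t z).
Hypothesis adh : forall Z : set (ptY F p q), zariski_closed k Z ->
  @pi_preimage F p q k (stratumE k r s t) `<=` Z -> forall x1 a b, fibre W L x1 a b ->
    Z (W, L, block_mx x1 a b 0).

Lemma adh_le (rho : ptY F p q -> nat) m :
  zariski_closed k [set y | exoticX k y.1 /\ (rho y <= m)%N] ->
  (forall W' L' x, @pi_preimage F p q k (stratumE k r s t) (W', L', x) ->
    (rho (W', L', x) <= m)%N) ->
  forall x1 a b, fibre W L x1 a b -> (rho (W, L, block_mx x1 a b 0) <= m)%N.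
Proof.
move=> cZ h x1 a b hf; have [] // := adh cZ _ hf.
case=> [[W' L'] x] hy; split; last exact: h.
by have [? ? _ _] := pi_preimageP hy.
Qed.

(** If the fibre over (W, L) is in the closure of the preimage of N, then N is the generic
    orbit. The bounds phi_r <= r and phi_s <= s hold since rk a <= r and rk b <= s are closed
    conditions. In the other direction, the bounds of [fibre_num] at the points of the preimage
    are inequalities on dim (proj1 W') and dim (proj2 W'), which are semicontinuous. *)
Lemma unique_param :
  [/\ r = phi_r q k w1 w2 j, s = phi_s p k w2 j & t = phi_t q k w1 w2 j].
Proof.
have [x1 [a [b [hf [ra rb] [c1 c2 c3] c4 c5]]]] := witness_ex dW dL.
rewrite -/w1 -/w2 -/j in ra rb c1 c2 c3 c4 c5.
have [ea eb et] := fibre_generic dW dL hf ra rb c1 c2 c3; rewrite -/w1 -/w2 -/j in ea eb et.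
have [rsp rsq] : (r + s <= p)%N /\ (r + s <= q)%N by have [z /stratumE_ranks[]] := ne.
have rsk : (r + s <= minn k (p + q - k))%N by have [z /stratumE_ranks[]] := ne.
have ler : (phi_r q k w1 w2 j <= r)%N.
  rewrite -ea; have := adh_le (@closed_rank_a F p q k r) _ hf; rewrite /= block_mxKur; apply.
  by move=> W' L' x /pi_preimageP[_ _ _ [-> _ _]].
have les : (phi_s p k w2 j <= s)%N.
  rewrite -eb; have := adh_le (@closed_rank_b F p q k s) _ hf; rewrite /= block_mxKdl; apply.
  by move=> W' L' x /pi_preimageP[_ _ _ [_ -> _]].
have leP1 m : (forall W' L' x, @pi_preimage F p q k (stratumE k r s t) (W', L', x) ->
  (\dim (proj1 W') <= m)%N) ->
    (\dim (proj1 W) <= m)%N.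
  by move=> h; exact: (adh_le (@closed_dim_proj1 F p q k m) h hf).
have leP2 m : (forall W' L' x, @pi_preimage F p q k (stratumE k r s t) (W', L', x) ->
  (\dim (proj2 W') <= m)%N) ->
    (\dim (proj2 W) <= m)%N.
  by move=> h; exact: (adh_le (@closed_dim_proj2 F p q k m) h hf).
have D1 := dim_meet1_proj2 W; have D2 := dim_meet2_proj1 W; rewrite dW in D1 D2.
have lq : (\dim (proj2 W) <= q)%N := dim_le_cV _.
have lp : (\dim (proj1 W) <= p)%N := dim_le_cV _.
have lm := dimvS (meet1_proj1 W).
rewrite -/w1 -/w2 in D1 D2 lm.
have jle : (j <= 2)%N := pos_le2 _ _ _.
have gP2 : (\dim (proj2 W) <= k - r)%N.
  apply: leP2 => W' L' x /pi_preimageP[dW' dL' hf' [<- _ _]].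
  by have [n1 _ _ _ _] := fibre_num dL' hf'; have := dim_meet1_proj2 W'; dim_lia.
have gP1 : (\dim (proj1 W) <= p - s)%N.
  apply: leP1 => W' L' x /pi_preimageP[dW' dL' hf' [_ <- _]].
  by have [_ n2 _ _ _] := fibre_num dL' hf'; dim_lia.
have tle : (t <= 2)%N by have [z [_ [_ _ <-]]] := ne; exact: pos_le2.
have sp0 : (t = 2 -> 0 < s)%N.
  have [[L' x] [_ [_ /= <- <-]]] := ne; move/eqP.
  rewrite /pos; case: ifP => // _; case: ifP => // /negP h _.
  rewrite lt0n; apply/negP; rewrite mxrank_eq0 => /eqP h0; apply: h.
  by apply/subvP => v _; rewrite memv_mxker h0 mul0mx; exact: eqxx.
have noP2 : (L <= meet1 W)%VS ->
    (forall W' L' x, @pi_preimage F p q k (stratumE k r s t) (W', L', x) ->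
       (\dim (proj2 W') < \dim (proj2 W))%N) -> False.
  move=> hL H.
  have : (\dim (proj2 W) <= \dim (proj2 W) - 1)%N by apply: leP2 => W' L' x /H; dim_lia.
  have [y hy] : exists y, pi_preimage k (@stratumE F p q k r s t) y.
    apply: contrapT => nE.
    have : (\dim (proj1 W) <= 0)%N by apply: leP1 => W' L' x hy; case: nE; exists (W', L', x).
    have : (0 < w1)%N by apply: leq_trans (dimvS hL); rewrite dL.
    by move: lm; dim_lia.
  by case: y hy => [[W' L'] x] /H; dim_lia.
case: t tle adh ne adh_le leP1 leP2 sp0 noP2 =>
  [|[|[|//]]] _ adh' ne' adh_le' leP1' leP2' sp0' noP2.
- (* L' <= Im a' forces L' <= W', hence L <= W *)
  have F0 W' L' x : @pi_preimage F p q k (stratumE k r s 0) (W', L', x) ->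
      [/\ (L' <= meet1 W')%VS, (s <= \dim (meet2 W'))%N,
          (\dim (proj1 W') = \dim (meet1 W') -> r + \dim (proj2 W') <= q)%N
        & (r + \dim (proj2 W') <= q + 1)%N].
    move=> /pi_preimageP[dW' dL' hf' [<- <- /eqP]]; rewrite pos0 => h.
    have p0 := fibre_type0 hf' h.
    have [_ _ n3 n4 [n5 _ _]] := fibre_num dL' hf'.
    by split=> //; [rewrite -(pos0 _ (proj1 W')) p0|apply: n5].
  have hL : (L <= meet1 W)%VS.
    have h : (\dim (W + inV1 q L) <= k)%N.
      have := adh_le' (fun y => \dim (y.1.1 + inV1 q y.1.2)) k
        (@closed_dim_WL F p q k k) _ _ _ _ hf.
      apply=> W' L' x hy; have [h _ _ _] := F0 _ _ _ hy; have [dW' _ _ _] := pi_preimageP hy.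
      rewrite /= (addv_idPl _) ?dW' // inV1E.
      apply/subvP => _ /memv_imgP[v hv ->]; rewrite mxlinE in1E -mem_meet1.
      exact: (subvP h).
    have : (inV1 q L <= W)%VS.
      have /eqP e : W == (W + inV1 q L)%VS by rewrite eqEdim addvSl dW.
      by rewrite e addvSr.
    move/subvP => hW; apply/subvP => v hv; rewrite mem_meet1; apply: hW.
    by rewrite mem_inV1 hv eqxx.
  have j0 : j = 0%N by apply/eqP; rewrite pos0.
  have gw2 : (\dim (proj1 W) <= k - s)%N.
    apply: leP1' => W' L' x hy; have [_ h _ _] := F0 _ _ _ hy.
    by have [dW' _ _ _] := pi_preimageP hy; have := dim_meet2_proj1 W'; dim_lia.
  have gu : (\dim (proj2 W) <= q + 1 - r)%N.
    by apply: leP2' => W' L' x hy; have [_ _ _ h] := F0 _ _ _ hy; dim_lia.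
  have es : s = phi_s p k w2 j.
    by move: les; rewrite /phi_s j0 /=; dim_lia.
  have [lt|ge] := ltnP (w1 + w2) k.
    split=> //; last by rewrite /phi_t j0 lt.
    by move: ler; rewrite /phi_r j0 /= lt; dim_lia.
  have [kq|qk] := leqP k q.
    split=> //; last by rewrite /phi_t j0 kq orbT.
    by move: ler; rewrite /phi_r j0 /=; dim_lia.
  (* remaining case: W = meet1 W + meet2 W and q < k, where generically L is not in Im a *)
  exfalso.
  have pr : phi_r q k w1 w2 j = (q - \dim (proj2 W))%N.
    by rewrite /phi_r j0 /= (ltnNge (w1 + w2) k) ge /=; dim_lia.
  have [er|nr] := eqVneq r (q - \dim (proj2 W))%N.
    have pt : phi_t q k w1 w2 j = 1%N by rewrite /phi_t j0 /= (leqNgt k q) qk (ltnNge _ k) ge.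
    have := c1 j0 pt; rewrite ltnNge => /negP; apply.
    have := adh_le' (fun y => \dim (mxim (ursubmx y.2) + y.1.2)) r
      (@closed_dim_imaL F p q k r) _ _ _ _ hf.
    rewrite /= block_mxKur pr -er; apply.
    move=> W' L' x /pi_preimageP[_ _ _ [<- _ /eqP]]; rewrite pos0 => /addv_idPl ->.
    by rewrite dim_mxim.
  apply: (noP2 hL) => W' L' x.
  move=> hy; have [_ h1 h2 h3] := F0 _ _ _ hy.
  have [dW' dL' hf' [e1 e2 _]] := pi_preimageP hy.
  have [n1 n2 _ _ _] := fibre_num dL' hf'; rewrite e1 e2 in n1 n2.
  have := dim_meet1_proj2 W'; have := dim_meet2_proj1 W'; have := dimvS (meet1_proj1 W').
  by rewrite dW'; move: es les; rewrite /phi_s j0 /=; dim_lia.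
- (* a' kills proj2 W' and b' kills L' *)
  have F1 W' L' x : @pi_preimage F p q k (stratumE k r s 1) (W', L', x) ->
      [/\ (mxlin (ursubmx x) @: proj2 W' == 0)%VS, (L' <= mxker (dlsubmx x))%VS,
          (r + \dim (proj2 W') <= q)%N,
          [/\ pos (meet1 W') (proj1 W') L' = 0%N -> (r < \dim (meet1 W'))%N,
              pos (meet1 W') (proj1 W') L' = 1%N ->
                (\dim (meet1 W') < \dim (proj1 W'))%N /\ (s <= \dim (meet2 W') + 1)%N
            & pos (meet1 W') (proj1 W') L' = 2%N ->
                (s <= \dim (meet2 W'))%N /\ (s + \dim (proj1 W') < p)%N]
        & ~~ (L' <= meet1 W')%VS -> (\rank (col_mx (ulsubmx x) (dlsubmx x)) <= s)%N].
    move=> /pi_preimageP[dW' dL' hf' [<- <- /eqP]]; rewrite pos1 => /andP[h1 h2].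
    have [g1 g2 g3] := fibre_type1 dL' hf' h1 h2.
    have [n1 n2 n3 n4 [n5 n6 n7]] := fibre_num dL' hf'.
    split=> //.
    - by rewrite -lkerE.
    - exact: rank_ker g1.
    - by split=> // h; [have [] := n6 h|split; [have [] := n7 h|exact: g3]].
    by move=> h; have [_ _ ->] := fibre_notmeet dL' hf' h.
  have a0 : (\dim (mxlin a @: proj2 W) <= 0)%N.
    have := adh_le' (fun y => \dim (mxlin (ursubmx y.2) @: proj2 y.1.1)) 0%N
      (@closed_dim_aproj2 F p q k 0) _ _ _ _ hf.
    rewrite /= block_mxKur; apply=> W' L' x /F1[/eqP h _ _ _ _] /=.
    by rewrite h dimv0.
  have b0 : (\dim (mxlin b @: L) <= 0)%N.
    have := adh_le' (fun y => \dim (mxlin (dlsubmx y.2) @: y.1.2)) 0%N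
      (@closed_dim_bL F p q k 0) _ _ _ _ hf.
    rewrite /= block_mxKdl; apply=> W' L' x /F1[_ h _ _ _] /=.
    by move: h; rewrite lkerE => /eqP ->; rewrite dimv0.
  have gu : (\dim (proj2 W) <= q - r)%N.
    by apply: leP2' => W' L' x /F1[_ _ h _ _]; dim_lia.
  have hj : j = pos (meet1 W) (proj1 W) L by [].
  have j3 : [\/ j = 0%N, j = 1%N | j = 2%N].
    by case: (j) jle => [|[|[|//]]] _; [constructor 1|constructor 2|constructor 3].
  case: j3 => j0; rewrite j0 in ler les *.
  + have hL : (L <= meet1 W)%VS by rewrite -(pos0 _ (proj1 W)) -hj j0.
    have [lt|ge] := ltnP (w1 + w2) k; first by have := c3 j0 lt; rewrite ltnNge a0.
    have kE : (w1 + w2)%N = k by dim_lia.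
    have er : r = phi_r q k w1 w2 0.
      by move: ler; rewrite /phi_r /= (ltnNge (w1 + w2)) ge /=; dim_lia.
    have [kq|qk] := leqP k q; last first.
      split=> //; last by rewrite /phi_t /= (leqNgt k q) qk (ltnNge _ k) ge.
      by move: les er; rewrite /phi_s /phi_r /= (ltnNge (w1 + w2)) ge /=; dim_lia.
    (* here k <= q and W = meet1 W + meet2 W; unless L' <= W', which lowers dim proj2 W',
       the rank of (x1', b') is that of b', whereas it can be min (w2 + 1, v) over (W, L) *)
    exfalso.
    have {}er : r = w1.
      by rewrite er /phi_r /= (ltnNge (w1 + w2)) ge /=; dim_lia.
    have col : (\rank (col_mx x1 b) <= s)%N.
      (* dim proj2 W' <= (dim proj2 W).-1 means dim proj2 W' < dim proj2 W only if the
         latter is nonzero *)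
      have [P0|P0] := posnP (\dim (proj2 W)).
        have := adh_le' (fun y => \rank (col_mx (ulsubmx y.2) (dlsubmx y.2))) s
          (@closed_rank_x1b F p q k s) _ _ _ _ hf.
        rewrite /= block_mxKul block_mxKdl; apply=> W' L' x hy.
        have [_ _ _ [h1 _ _] h] := F1 _ _ _ hy; apply: h; rewrite -(pos0 _ (proj1 W')).
        apply/negP => /eqP/h1 h2; have [dW' _ _ _] := pi_preimageP hy.
        by have := dim_meet1_proj2 W'; dim_lia.
      have := adh' _ (closed_union (@closed_dim_proj2 F p q k (\dim (proj2 W)).-1)
        (@closed_rank_x1b F p q k s)).
      move=> /(_ _ _ _ _ hf) [].
      * case=> [[W' L'] x] hy; have [dW' dL' _ _] := pi_preimageP hy.
        have [_ _ _ [h1 _ _] h] := F1 _ _ _ hy.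
        have [hL'|nL'] := boolP (L' <= meet1 W')%VS; last by right; split=> //; exact: h.
        left; split=> //=; have : pos (meet1 W') (proj1 W') L' == 0%N by rewrite pos0.
        by move/eqP/h1; have := dim_meet1_proj2 W'; dim_lia.
      * by case=> _ /=; dim_lia.
      * by case=> _ /=; rewrite block_mxKul block_mxKdl.
    have c5' := c5 j0 kE.
    apply: (noP2 hL) => W' L' x hy; have [dW' dL' hf' [e1 e2 _]] := pi_preimageP hy.
    have [_ _ h3 [h4 h5 h6] _] := F1 _ _ _ hy.
    have [n1 n2 _ _ _] := fibre_num dL' hf'; rewrite e1 e2 in n1 n2.
    have := dim_meet1_proj2 W'; have := dim_meet2_proj1 W'; have := dimvS (meet1_proj1 W').
    have := pos_le2 (meet1 W') (proj1 W') L'.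
    rewrite dW'; case: (pos _ _ _) h4 h5 h6 => [|[|[|//]]] h4 h5 h6 _.
    * by have := h4 erefl; dim_lia.
    * by have [] := h5 erefl; dim_lia.
    * by have [] := h6 erefl; dim_lia.
  + have gs : (\dim (proj1 W) <= k + 1 - s)%N.
      apply: leP1' => W' L' x hy; have [dW' dL' hf' _] := pi_preimageP hy.
      have [_ _ h3 [h4 h5 h6] _] := F1 _ _ _ hy.
      have [_ _ _ _ [n5 _ _]] := fibre_num dL' hf'.
      have [_ _ _ [_ e2 _]] := pi_preimageP hy; rewrite e2 in n5.
      have := dim_meet2_proj1 W'; have := pos_le2 (meet1 W') (proj1 W') L'.
      rewrite dW'; case: (pos _ _ _) n5 h4 h5 h6 => [|[|[|//]]] n5 h4 h5 h6 _.
      * by have := n5 erefl; dim_lia.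
      * by have [] := h5 erefl; dim_lia.
      * by have [] := h6 erefl; dim_lia.
    by move: ler les; rewrite /phi_r /phi_s /phi_t /=; split=> //; dim_lia.
  + have nP : ~~ (L <= proj1 W)%VS by rewrite -(pos2 _ (meet1_proj1 W)) -hj j0.
    have [w0|w0] := eqVneq w2 0%N; last first.
      by have := c2; rewrite j0 /phi_t /= w0 => /(_ erefl); rewrite ltnNge b0.
    have gs : (\dim (proj1 W) <= k + 1 - s)%N.
      apply: leP1' => W' L' x hy; have [dW' dL' hf' _] := pi_preimageP hy.
      have [_ _ h3 [h4 h5 h6] _] := F1 _ _ _ hy.
      have [_ _ _ _ [n5 _ _]] := fibre_num dL' hf'.
      have [_ _ _ [_ e2 _]] := pi_preimageP hy; rewrite e2 in n5.
      have := dim_meet2_proj1 W'; have := pos_le2 (meet1 W') (proj1 W') L'.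
      rewrite dW'; case: (pos _ _ _) n5 h4 h5 h6 => [|[|[|//]]] n5 h4 h5 h6 _.
      * by have := n5 erefl; dim_lia.
      * by have [] := h5 erefl; dim_lia.
      * by have [] := h6 erefl; dim_lia.
    have s0 : s = 0%N.
      apply/eqP; rewrite -leqn0 leqNgt; apply/negP => s0.
      have : (\dim (proj1 W + L) <= k)%N.
        have := adh_le' (fun y => \dim (proj1 y.1.1 + y.1.2)) k
          (@closed_dim_proj1L F p q k k) _ _ _ _ hf.
        apply=> W' L' x hy /=; have [dW' dL' hf' _] := pi_preimageP hy.
        have := dim_meet2_proj1 W'; rewrite dW'.
        have [hL'|nL'] := boolP (L' <= proj1 W')%VS.
          by rewrite (addv_idPl hL'); dim_lia.
        have [_ _ _ [_ _ h6] _] := F1 _ _ _ hy.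
        have /eqP/h6[h7 _] : pos (meet1 W') (proj1 W') L' == 2%N by rewrite pos2 ?meet1_proj1.
        have := (dimv_add_leqif (proj1 W') L').1; rewrite dL'; dim_lia.
      rewrite dimv_disjoint_sum ?dL; first by dim_lia.
      apply/eqP; rewrite -subv0; apply/subvP => w /memv_capP[wP wL].
      by rewrite memv0 (line_cap dL nP wL wP).
    by move: ler les; rewrite /phi_r /phi_s /phi_t w0 s0 /=; split=> //; dim_lia.
have F2 W' L' x : @pi_preimage F p q k (stratumE k r s 2) (W', L', x) ->
    [/\ (\rank (ulsubmx x) <= 0)%N, (r + \dim (proj2 W') <= q)%N & (s <= \dim (meet2 W'))%N].
  move=> /pi_preimageP[dW' dL' hf' [<- <- h]].
  have imk : (mxim (ursubmx x) <= mxker (dlsubmx x))%VS by rewrite im_ker (fibre_ab hf').2.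
  move/eqP: h; rewrite pos2 // => h.
  have [_ _ _ _ [_ _ n7]] := fibre_num dL' hf'.
  by have [h1 h2 _ ->] := n7 (fibre_type2 hf' h); rewrite mxrank0.
have x10 : (\rank x1 <= 0)%N.
  have := adh_le' (fun y => \rank (ulsubmx y.2)) 0%N (@closed_rank_x1 F p q k 0) _ _ _ _ hf.
  by rewrite /= block_mxKul; apply=> W' L' x /F2[].
have gu : (\dim (proj2 W) <= q - r)%N.
  by apply: leP2' => W' L' x /F2[_ h _]; dim_lia.
have gs : (\dim (proj1 W) <= k - s)%N.
  apply: leP1' => W' L' x hy; have [dW' _ _ _] := pi_preimageP hy; have [_ _ h] := F2 _ _ _ hy.
  by have := dim_meet2_proj1 W'; dim_lia.
have s0 := sp0' erefl.
have j2 : j = 2%N.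
  apply/eqP; rewrite eqn_leq jle leqNgt; apply/negP => j2.
  have : (\dim (proj1 W) < p)%N by dim_lia.
  by move/(c4 j2); rewrite ltnNge x10.
have w20 : (w2 != 0)%N by apply/eqP => w20; dim_lia.
by move: ler les; rewrite /phi_r /phi_s /phi_t j2 /= w20; split=> //; dim_lia.
Qed.

End Unique.

(** * The map Phi on parameters *)

(** A closure is defined as an intersection, so inclusions of closures are tested on closed
    sets. *)
Lemma closure_subP (F : fieldType) p q k (S T : set (ptY F p q)) :
  (forall Z, zariski_closed k Z -> T `<=` Z -> S `<=` Z) <->
  zariski_closure k S `<=` zariski_closure k T.
Proof.
split=> [h y Sy Z [cZ TZ]|h Z cZ TZ y Sy].
  by apply: Sy; split=> //; apply: h.
have : zariski_closure k T y by apply: h => Z' [_]; apply.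
by apply; split.
Qed.

(** The parameters of nonempty strata, by [stratumX_valid] and [stratumX_inhabited]. *)
Definition validX (p q k w1 w2 j : nat) : Prop :=
  [/\ (w1 + w2 <= k)%N, (k <= p + w2)%N, (k <= q + w1)%N &
   [/\ (j <= 2)%N, j = 0%N -> (0 < w1)%N, j = 1%N -> (w1 + w2 < k)%N & j = 2%N ->
     (k < p + w2)%N]].

(** The parameters of nonempty strata: necessity is [stratumE_valid], and [phi_surj] gives the
    converse when k <= n. *)
Definition validE (p q k r s t : nat) : Prop :=
  [/\ (r + s <= p)%N, (r + s <= q)%N, (r + s <= minn k (p + q - k))%N &
   [/\ (t <= 2)%N, t = 0%N -> (0 < r)%N, t = 1%N -> (r + s < p)%N & t = 2%N -> (0 < s)%N]].

Lemma stratumX_valid (F : fieldType) p q k w1 w2 j (z : ptX F p q) :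
  stratumX k w1 w2 j z -> validX p q k w1 w2 j.
Proof.
case: z => W L [[/= dW dL] [/= <- <- <-]].
have D1 := dim_meet1_proj2 W; have D2 := dim_meet2_proj1 W; rewrite dW in D1 D2.
have lq : (\dim (proj2 W) <= q)%N := dim_le_cV _.
have lp : (\dim (proj1 W) <= p)%N := dim_le_cV _.
have lm := dimvS (meet1_proj1 W).
split; [by dim_lia|by dim_lia|by dim_lia|split].
- exact: pos_le2.
- by move/eqP; rewrite pos0 => /dimvS; rewrite dL.
- move/eqP; rewrite pos1 => /andP[h1 h2].
  suff : \dim (meet1 W) != \dim (proj1 W) by move=> /eqP; dim_lia.
  apply: contra h1 => /eqP h; suff -> : meet1 W = proj1 W by [].
  by apply/eqP; rewrite eqEdim meet1_proj1 h leqnn.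
move/eqP; rewrite pos2 ?meet1_proj1 // => h.
suff : \dim (proj1 W) != p by move=> /eqP; dim_lia.
apply: contra h => /eqP h; suff -> : proj1 W = fullv by exact: subvf.
by apply/eqP; rewrite eqEdim subvf /= dim_cV h.
Qed.

Lemma free_head (F : fieldType) n (X Y : seq 'cV[F]_n) : free (X ++ Y) -> (0 < size Y)%N ->
  head 0 Y \notin <<X>>%VS.
Proof.
case: Y => [//|v Y] /=.
have pe : perm_eq (X ++ v :: Y) (v :: (X ++ Y)) by rewrite -cat1s perm_catCA.
rewrite (perm_free pe) free_cons => /andP[h _] _; apply: contra h; apply: subvP.
by rewrite span_cat addvSl.
Qed.

(** Any bases of V1 and V2, cut into pieces of the required sizes, are adapted to
    the subspace that they glue to. *)
Lemma stratumX_inhabited (F : fieldType) p q k w1 w2 j : validX p q k w1 w2 j ->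
  exists z, @stratumX F p q k w1 w2 j z.
Proof.
move=> [o1 o2 o3 [o4 o5 o6 o7]].
pose e : seq 'cV[F]_p := vbasis fullv; pose f : seq 'cV[F]_q := vbasis fullv.
have he : is_basis e by split; rewrite ?size_tuple ?dim_cV // (span_basis (vbasisP _)).
have hf : is_basis f by split; rewrite ?size_tuple ?dim_cV // (span_basis (vbasisP _)).
have se : size e = p by case: he.
have sf : size f = q by case: hf.
pose t := (k - w1 - w2)%N.
pose e1 := take w1 e; pose e2 := take t (drop w1 e); pose e3 := drop t (drop w1 e).
pose f1 := take t f; pose f2 := take w2 (drop t f); pose f3 := drop w2 (drop t f).
have ee : e1 ++ e2 ++ e3 = e by rewrite /e2 /e3 cat_take_drop cat_take_drop.
have ff : f1 ++ f2 ++ f3 = f by rewrite /f2 /f3 cat_take_drop cat_take_drop.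
have s1 : size e1 = w1 by rewrite size_take_min se; lia.
have s2 : size e2 = t by rewrite size_take_min size_drop se; lia.
have s3 : size e3 = (p - w1 - t)%N by rewrite !size_drop se.
have s4 : size f1 = t by rewrite size_take_min sf; lia.
have s5 : size f2 = w2 by rewrite size_take_min size_drop sf; lia.
pose W := <<glue e1 e2 f1 f2>>%VS.
have hA : adapted W e1 e2 e3 f1 f2 f3 by split; rewrite ?ee ?ff ?s2 ?s4.
have [[m1 m2 m3 m4] [d1 d2 d3]] := adapted_spaces hA.
pose v := head 0 (nth [::] [:: e1; e2; e3] j).
have fe : free (e1 ++ e2 ++ e3) by rewrite ee; exact: is_basis_free.
have hv : (0 < size (nth [::] [:: e1; e2; e3] j))%N.
  case: (j) o4 o5 o6 o7 => [|[|[|//]]] _ o5 o6 o7 /=.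
  - by rewrite s1; exact: o5.
  - by have := o6 erefl; rewrite s2 /t; lia.
  - by have := o7 erefl; rewrite s3 /t; lia.
have v0 : v != 0.
  have : free (nth [::] [:: e1; e2; e3] j).
    have fe1 := catl_free fe; have fe23 := catr_free fe.
    have fe2 := catl_free fe23; have fe3 := catr_free fe23.
    by case: (j) o4 => [|[|[|//]]].
  by move/(free_head (X := [::])) => /(_ hv); rewrite span_nil memv0.
exists (W, <[v]>%VS); split; split=> /=.
- by rewrite d3 s1 s2 s5 /t; lia.
- by rewrite dim_vline v0.
- by rewrite d1 s1.
- by rewrite d2 s5.
apply/eqP; rewrite /v; case: (j) o4 hv => [|[|[|//]]] _ /= hv.
- by rewrite pos0 m1 -memvE memv_span // -nth0 mem_nth.
- rewrite pos1 m1 m2 -!memvE (free_head _ hv); last first.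
    by move: fe; rewrite catA => /catl_free.
  by rewrite memv_span // mem_cat -nth0 mem_nth ?orbT.
rewrite pos2 ?meet1_proj1 // m2 -memvE (free_head _ hv) //.
by rewrite -catA.
Qed.

Lemma stratumE_valid (F : fieldType) p q k r s t (z : ptE F p q) : stratumE k r s t z ->
  validE p q k r s t.
Proof.
move=> hz; have [h1 h2 h3] := stratumE_ranks hz; split=> //.
case: z hz => L x [/exoticE_ab[dL _ ab ba _] [/= hr hs ht]].
have imk : (mxim (ursubmx x) <= mxker (dlsubmx x))%VS by rewrite im_ker ba.
split; first by rewrite -ht; exact: pos_le2.
- move=> t0; move: ht; rewrite t0 => /eqP; rewrite pos0 => /dimvS.
  by rewrite dL dim_mxim hr.
- move=> t0; move: ht; rewrite t0 => /eqP; rewrite pos1 => /andP[n1 n2].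
  have hs' : (mxim (ursubmx x) + L <= mxker (dlsubmx x))%VS by rewrite subv_add imk.
  have := rank_ker hs'; rewrite dimv_disjoint_sum ?dL ?dim_mxim ?hr ?hs; first by dim_lia.
  apply/eqP; rewrite -subv0; apply/subvP => w /memv_capP[wP wL].
  by rewrite memv0 (line_cap dL n1 wL wP).
move=> t0; move: ht; rewrite t0 => /eqP; rewrite pos2 // => n2.
rewrite -hs lt0n mxrank_eq0; apply: contra n2 => /eqP ->.
by apply/subvP => w _; rewrite memv_mxker mul0mx; exact: eqxx.
Qed.

Lemma orbitsXP (F : fieldType) p q k (O : set (ptX F p q)) :
  orbitsX k O <-> exists w1 w2 j, validX p q k w1 w2 j /\ O = stratumX k w1 w2 j.
Proof.
split=> [[z hz <-]|[w1 [w2 [j [ok ->]]]]].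
  have hz' := orbit_X_refl hz.
  by do 3 eexists; split; [exact: stratumX_valid hz'|exact: orbit_X hz'].
by have [z hz] := stratumX_inhabited F ok; exists z; [case: hz|exact: orbit_X hz].
Qed.

Lemma stratumX_inj (F : fieldType) p q k w1 w2 j w1' w2' j' : validX p q k w1 w2 j ->
  @stratumX F p q k w1 w2 j = stratumX k w1' w2' j' -> [/\ w1 = w1', w2 = w2' & j = j'].
Proof.
by move=> /(stratumX_inhabited F)[z hz] e; move: (hz); rewrite e => -[_ [<- <- <-]];
  case: hz => _ [-> -> ->].
Qed.

Lemma stratumE_inj (F : fieldType) p q k r s t r' s' t' (z : ptE F p q) : stratumE k r s t z ->
  @stratumE F p q k r s t = stratumE k r' s' t' -> [/\ r = r', s = s' & t = t'].
Proof. by move=> hz e; move: (hz); rewrite e => -[_ [<- <- <-]]; case: hz => _ [-> -> ->]. Qed.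

Lemma stratumPhi_inhabited (F : fieldType) p q k w1 w2 j : validX p q k w1 w2 j ->
  exists z, @stratumPhi F p q k w1 w2 j z.
Proof.
move=> /(stratumX_inhabited F)[[W L] [[/= dW dL] [/= <- <- <-]]].
have [x1 [a [b [hf [ra rb] [c1 c2 c3] _ _]]]] := witness_ex dW dL.
have [e1 e2 e3] := fibre_generic dW dL hf ra rb c1 c2 c3.
by have [_] := pi_preimage_block dW dL hf e1 e2 e3; eexists; eassumption.
Qed.

Lemma stratumE_orbit (F : fieldType) p q k r s t (z : ptE F p q) : stratumE k r s t z ->
  orbitsE k (@stratumE F p q k r s t).
Proof. by move=> hz; exists z; [case: hz|exact: orbit_E hz]. Qed.

(** Existence is [generic_in_closure], uniqueness is [unique_param]. *)
Lemma Phi_stratumX (F : numFieldType) p q k w1 w2 j : validX p q k w1 w2 j ->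
  Phi k (@stratumX F p q k w1 w2 j) = stratumPhi k w1 w2 j.
Proof.
move=> ok; set O := stratumX _ _ _ _.
suff hu : unique (Phi_spec k O) (stratumPhi k w1 w2 j).
  have [_] : unique (Phi_spec k O) (Phi k O).
    by apply: (@xgetPex _ set0 [set N | unique (Phi_spec k O) N]); exists (stratumPhi k w1 w2 j).
  by apply; case: hu.
split.
  split; first by have [z hz] := stratumPhi_inhabited F ok; exact: stratumE_orbit hz.
  by apply/closure_subP => Z cZ hZ; apply: generic_in_closure.
move=> N [[z hz <-] /closure_subP h].
have hz' : stratumE k (\rank (ursubmx z.2)) (\rank (dlsubmx z.2))
  (pos (mxim (ursubmx z.2)) (mxker (dlsubmx z.2)) z.1) z by [].
rewrite (orbit_E hz') in h *.
have [[W L] hX] := stratumX_inhabited F ok; have [[/= dW dL] [/= e1 e2 e3]] := hX.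
have [|u1 u2 u3] := @unique_param F p q k W L dW dL _ _ _ (ex_intro _ z hz').
  move=> Z cZ hZ x1 a b hf; apply: (h Z cZ hZ); split=> //.
  exact: conormal_block.
by rewrite u1 u2 u3 e1 e2 e3.
Qed.

(** * The fibres of the parameter map *)

(** The type (II)* relations: in the range k <= n, q < min (k, n - k) is q < k < p, and
    then q + 2 <= p. *)
Definition star_param (p q k r s : nat) := ((r + s == q) && (q < k) && (k < p))%N.

(** min (w1, q + w1 - k) = w1 - (k - q) with truncated subtraction, and similarly below;
    closed forms without minima are easier to compare. *)
Lemma phi_rE p q k w1 w2 j : validX p q k w1 w2 j ->
  phi_r q k w1 w2 j = (w1 - (k - q - ((j == 0) && (w1 + w2 < k))))%N.
Proof. by case=> _ _ h _; rewrite /phi_r; case: (_ && _) => /=; lia. Qed.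

Lemma phi_sE p q k w1 w2 j : validX p q k w1 w2 j ->
  phi_s p k w2 j = (w2 + (j == 1) - (k + (j == 1) - p))%N.
Proof. by case=> _ h _ _; rewrite /phi_s; case: (j == 1)%N => /=; lia. Qed.

Lemma validX_cases p q k w1 w2 j : validX p q k w1 w2 j ->
  (w1 + w2 <= k)%N /\ (k <= p + w2)%N /\ (k <= q + w1)%N /\
  (j = 0%N /\ (0 < w1)%N \/ j = 1%N /\ (w1 + w2 < k)%N \/ j = 2%N /\ (k < p + w2)%N).
Proof.
case=> ? ? ? [h1 h2 h3 h4]; do 3 (split=> //); case: j h1 h2 h3 h4 => [|[|[|//]]] _ h2 h3 h4.
- by left; split=> //; exact: h2.
- by right; left; split=> //; exact: h3.
by right; right; split=> //; exact: h4.
Qed.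

(** Among the triples of position 1, r + s separates those with j = 0 (for which t = 0) from
    the others, unless r + s = q < k < p. *)
Lemma phi_inj p q k w1 w2 j w1' w2' j' :
  validX p q k w1 w2 j -> validX p q k w1' w2' j' ->
  phi_r q k w1 w2 j = phi_r q k w1' w2' j' -> phi_s p k w2 j = phi_s p k w2' j' ->
  phi_t q k w1 w2 j = phi_t q k w1' w2' j' ->
  ~ (phi_t q k w1 w2 j = 1%N /\ star_param p q k (phi_r q k w1 w2 j) (phi_s p k w2 j)) ->
  [/\ w1 = w1', w2 = w2' & j = j'].
Proof.
move=> o o'; rewrite (phi_rE o) (phi_rE o') (phi_sE o) (phi_sE o').
have {o}[o1 [o2 [o3 o4]]] := validX_cases o; have {o'}[o1' [o2' [o3' o4']]] := validX_cases o'.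
rewrite /star_param /phi_t.
case: o4 => [[-> o4]|[[-> o4]|[-> o4]]]; case: o4' => [[-> o4']|[[-> o4']|[-> o4']]] /=;
  try case: (ltnP (w1 + w2) k) => c1; try case: (ltnP (w1' + w2') k) => c2;
  case: (leqP k q) => kq /=; (have [w20|w20] := posnP w2); (have [w20'|w20'] :=
    posnP w2') ; rewrite ?w20 ?w20' /=; try by move=> _ _; lia.
all: move=> e1 e2 e3 e4; split; lia.
Qed.

Lemma phi_surj p q k r s t : (k <= p + q)%N -> validE p q k r s t ->
  exists w1 w2 j, [/\ validX p q k w1 w2 j, phi_r q k w1 w2 j = r, phi_s p k w2 j = s
    & phi_t q k w1 w2 j = t].
Proof.
move=> kn [o1 o2 o3 [o4 o5 o6 o7]].
have fin w1 w2 j : validX p q k w1 w2 j /\ [/\ phi_r q k w1 w2 j = r, phi_s p k w2 j = s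
    & phi_t q k w1 w2 j = t] -> exists w1 w2 j, [/\ validX p q k w1 w2 j,
      phi_r q k w1 w2 j = r, phi_s p k w2 j = s
    & phi_t q k w1 w2 j = t].
  by case=> ? [? ? ?]; exists w1, w2, j.
rewrite /validX /phi_r /phi_s /phi_t in fin.
case: t o4 o5 o6 o7 fin => [|[|[|//]]] _ o5 o6 o7 fin.
- have r0 := o5 erefl; clear o5 o6 o7.
  apply: (fin (if (k <= q)%N then r else r.-1 + (k - q))%N (s + (k - p))%N 0%N) => /=.
  by have [kq|qk] := leqP k q; split; split; try split; try lia.
- have r0 := o6 erefl; clear o5 o6 o7.
  have [kq|qk] := leqP k q.
    have [pk|kp] := leqP p k.
      by apply: (fin r (s + (k - p))%N 1%N) => /=; split; split; try split; try lia.
    have [s0|s0] := posnP s.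
      by apply: (fin r 0%N 2%N) => /=; split; split; try split; try lia.
    by apply: (fin r s.-1 1%N) => /=; split; split; try split; try lia.
  have [pk|kp] := leqP p k.
    have [e|ne] := leqP (p + q - k)%N (r + s)%N.
      by apply: (fin (k - (s + (k - p)))%N (s + (k - p))%N 0%N) => /=; split; split; try split;
        try lia.
    by apply: (fin (r + (k - q))%N (s + (k - p))%N 1%N) => /=; split; split; try split; try lia.
  have [s0|s0] := posnP s.
    by apply: (fin (r + (k - q))%N 0%N 2%N) => /=; split; split; try split; try lia.
  by apply: (fin (r + (k - q))%N s.-1 1%N) => /=; split; split; try split; try lia.
have r0 := o7 erefl; clear o5 o6 o7.
apply: (fin (r + (k - q))%N (s + (k - p))%N 2%N) => /=.
have -> : (s + (k - p) != 0)%N by lia.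
by split; split; try split; try lia.
Qed.

(** The two orbits over (r, s) are W = (W /\ V1) + (W /\ V2) with w2 = s and L <= W, and the
    one with s = w2 + 1, t = 1, j = 1, or, if s = 0, the one with the same W but with L not
    in W. *)
Lemma phi_star p q k r s : (k <= p + q)%N -> validE p q k r s 1 -> star_param p q k r s ->
  exists w1 w2 j w1' w2' j', [/\ validX p q k w1 w2 j, validX p q k w1' w2' j', j <> j' &
    forall u1 u2 i, validX p q k u1 u2 i ->
     [/\ phi_r q k u1 u2 i = r, phi_s p k u2 i = s & phi_t q k u1 u2 i = 1%N] <->
     (u1 = w1 /\ u2 = w2 /\ i = j) \/ (u1 = w1' /\ u2 = w2' /\ i = j')].
Proof.
move=> kn [o1 o2 o3 [_ _ o6 _]] /andP[/andP[/eqP hq qk] kp]; have o4 := o6 erefl; clear o6.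
exists (k - s)%N, s, 0%N, (k - s)%N, s.-1, (if s == 0%N then 2 else 1)%N.
split.
- by split; try split; lia.
- by case: eqVneq => ?; split; try split; lia.
- by case: eqVneq.
move=> u1 u2 i [q1 q2 q3 [q4 q5 q6 q7]].
rewrite /phi_r /phi_s /phi_t; case: i q4 q5 q6 q7 => [|[|[|//]]] _ q5 q6 q7 /=;
  try (have := q5 erefl); try (have := q6 erefl); try (have := q7 erefl); clear q5 q6 q7 => h;
  case: (ltnP (u1 + u2) k) => ?; case: (leqP k q) => ? /=; case: (eqVneq s 0%N) => ?;
  try case: (eqVneq u2 0%N) => ? /=; split=> [[? ? ?]|?]; try split; lia.
Qed.

(** * The parameter set of the cone *)

Section Param.
Variables (F : fieldType) (p q k r s : nat) (mu : seq int).
Hypothesis hmu : Pi2k p q k r s mu.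

Lemma types_excl :
  [/\ ~ (typeI p r s mu /\ typeII p r s mu), ~ (typeI p r s mu /\ typeIII p r s mu)
    & ~ (typeII p r s mu /\ typeIII p r s mu)].
Proof.
case: hmu => [[[hrs _] _ _ _ _] _]; split.
- case=> h1 [ne _ h2]; have lt : (r + s < p)%N by lia.
  have := h1 (r + s)%N; rewrite h2 ?leqnn //= => /(_ _).
  by rewrite leq_addr lt => /(_ isT).
- case=> h1 [s0 h3]; have lt : (r < r + s)%N by lia.
  have := h1 r; rewrite h3 ?leqnn //= => /(_ _).
  by rewrite (_ : (r < p)%N); [move=> /(_ isT)|lia].
case=> [[_ h2 _] [s0 h3]]; have lt : (r < r + s)%N by lia.
by have := h2 r; rewrite h3 ?leqnn // lt => /(_ isT).
Qed.

(** The three types are mutually exclusive, so the defining implications reduce to the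
    one of the actual type. *)
Lemma paramOrbit_stratumE t :
  (typeI p r s mu -> t = 0%N) -> (typeII p r s mu -> t = 1%N) -> (typeIII p r s mu -> t = 2%N) ->
  [\/ typeI p r s mu, typeII p r s mu | typeIII p r s mu] ->
  @paramOrbitE F p q r s mu = stratumE k r s t.
Proof.
move=> h1 h2 h3 h; have [x12 x13 x23] := types_excl; case: hmu => _ hrk.
have posE (a : 'M[F]_(p, q)) (b : 'M[F]_(q, p)) (L : {vspace 'cV[F]_p}) : b *m a = 0 ->
    [/\ typeI p r s mu -> (L <= mxim a)%VS,
               typeII p r s mu -> (L <= mxker b)%VS /\ ~ (L <= mxim a)%VS
             & typeIII p r s mu -> ~ (L <= mxker b)%VS] <-> pos (mxim a) (mxker b) L = t.
  move=> ba; have imk : (mxim a <= mxker b)%VS by rewrite im_ker ba.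
  case: h => hT.
  - rewrite (h1 hT); split=> [[g _ _]|/eqP]; first by apply/eqP; rewrite pos0 g.
    by rewrite pos0 => g; split=> // hT'; [case: x12|case: x13].
  - rewrite (h2 hT); split=> [[_ g _]|/eqP].
      by have [g1 /negP g2] := g hT; apply/eqP; rewrite pos1 g1 g2.
    by rewrite pos1 => /andP[/negP g1 g2]; split=> // hT'; [case: x12|case: x23].
  rewrite (h3 hT); split=> [[_ _ g]|/eqP].
    by apply/eqP; rewrite pos2 //; apply/negP; exact: g.
  by rewrite pos2 // => /negP g; split=> // hT'; [case: x13|case: x23].
apply/predeqP => -[L x]; split.
  move=> [/= dL [a [b [-> [ab ba] [ra rb] ht]]]]; split.
    by apply/exoticE_ab; rewrite block_mxKur block_mxKdl ra rb.
  by rewrite /= block_mxKur block_mxKdl; split=> //; apply/(posE _ _ _ ba).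
move=> [/exoticE_ab[dL ex ab ba _] [/= ra rb ht]]; split=> //=.
exists (ursubmx x), (dlsubmx x); split=> //; exact/(posE _ _ _ ba).
Qed.

(** In type (I), some mu_i is positive, which is only possible for i <= r. *)
Lemma param_valid t : 
  (typeI p r s mu /\ t = 0%N) \/ (typeII p r s mu /\ t = 1%N) \/ (typeIII p r s mu /\ t = 2%N) ->
  validE p q k r s t.
Proof.
case: hmu => [[[hrs sz] h1 h2 h3 [h4 [m hm m1] h5]] hk] h.
split; [lia|lia|exact: hk|]; case: h => [[hT ->]|[[hT ->]|[hT ->]]]; split=> // _.
- rewrite lt0n; apply/negP => /eqP r0; move: hm => /(nthP 0)[i hi hm].
  have [ip|pi] := ltnP i p.
    have := hT i; rewrite r0 ip => /(_ isT); rewrite hm => m0.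
    by have := le_trans m1 m0.
  by move: m1; rewrite -hm h4 // pi /= -sz.
- by case: hT => ne _ _; lia.
by case: hT => ne _; lia.
Qed.

End Param.

Lemma star_relP p q k r s : (k <= p + q)%N -> star_rel p q k r s <-> star_param p q k r s.
Proof.
move=> hk; rewrite /star_rel /star_param; split=> [[? ? ?]|]; first by lia.
by move=> /andP[/andP[/eqP ? ?] ?]; split; lia.
Qed.

(** * Fibres of Phi *)

Lemma Phi_fiberP (F : numFieldType) p q k r s t (O : set (ptX F p q)) : 
  Phi_fiber k (stratumE k r s t) O <-> exists w1 w2 j, [/\ validX p q k w1 w2 j,
    O = stratumX k w1 w2 j
    & [/\ phi_r q k w1 w2 j = r, phi_s p k w2 j = s & phi_t q k w1 w2 j = t]].
Proof.
split=> [[/orbitsXP[w1 [w2 [j [ok ->]]]] /=]|[w1 [w2 [j [ok -> [<- <- <-]]]]]].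
  rewrite Phi_stratumX // => e; exists w1, w2, j; split=> //.
  by have [z hz] := stratumPhi_inhabited F ok; apply: stratumE_inj hz e.
by split; [apply/orbitsXP; exists w1, w2, j|rewrite /= Phi_stratumX].
Qed.

Lemma Phi_fiber_single (F : numFieldType) p q k r s t : (k <= p + q)%N ->
  validE p q k r s t -> ~ (t = 1%N /\ star_param p q k r s) ->
  exists O : set (ptX F p q), Phi_fiber k (@stratumE F p q k r s t) = [set O].
Proof.
move=> kn oe ns; have [w1 [w2 [j [ok h1 h2 h3]]]] := phi_surj kn oe.
exists (stratumX k w1 w2 j); apply/predeqP => O; split; last first.
  by move=> ->; apply/Phi_fiberP; exists w1, w2, j.
move=> /Phi_fiberP[u1 [u2 [i [ok' -> [g1 g2 g3]]]]].
have [||||n1 n2 n3] := phi_inj ok' ok; rewrite ?h1 ?h2 ?h3 ?g1 ?g2 ?g3 //.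
by rewrite n1 n2 n3.
Qed.

Lemma Phi_fiber_pair (F : numFieldType) p q k r s : (k <= p + q)%N ->
  validE p q k r s 1 -> star_param p q k r s ->
  exists O1 O2 : set (ptX F p q), O1 <> O2 /\
    Phi_fiber k (@stratumE F p q k r s 1) = [set O1; O2].
Proof.
move=> kn oe hs; have [w1 [w2 [j [w1' [w2' [j' [ok ok' nj h]]]]]]] := phi_star kn oe hs.
exists (stratumX k w1 w2 j), (stratumX k w1' w2' j'); split.
  by move=> e; have [_ _ ?] := stratumX_inj ok e.
apply/predeqP => O; split=> [/Phi_fiberP[u1 [u2 [i [oku -> g]]]]|].
  by have [[-> [-> ->]]|[-> [-> ->]]] := (h u1 u2 i oku).1 g; [left|right].
by case=> ->; apply/Phi_fiberP; do 3 eexists; (split; [|reflexivity|]); 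
  try eassumption; apply/h => //; [left|right].
Qed.

Lemma orbitsEP (F : fieldType) p q k (N : set (ptE F p q)) : orbitsE k N ->
  exists r s t, validE p q k r s t /\ N = stratumE k r s t.
Proof.
move=> [z hz <-].
have hz' : stratumE k (\rank (ursubmx z.2)) (\rank (dlsubmx z.2))
  (pos (mxim (ursubmx z.2)) (mxker (dlsubmx z.2)) z.1) z by [].
by do 3 eexists; split; [exact: stratumE_valid hz'|exact: orbit_E hz'].
Qed.

Lemma Phi_fun (F : numFieldType) p q k : set_fun (@orbitsX F p q k) (@orbitsE F p q k)
  (@Phi F p q k).
Proof.
move=> O /orbitsXP[w1 [w2 [j [ok ->]]]]; rewrite Phi_stratumX //.
by have [z hz] := stratumPhi_inhabited F ok; exact: stratumE_orbit hz.
Qed.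

Lemma Phi_bij (F : numFieldType) p q k : (k <= p + q)%N ->
  set_bij (@orbitsX F p q k) (@orbitsE F p q k) (@Phi F p q k) <->
  (p <= maxn k (maxn (p + q - k) (q + 1)))%N.
Proof.
move=> kn; split=> [[_ inj _]|hp].
  rewrite leqNgt; apply/negP => lt.
  have hs : star_param p q k q 0 by rewrite /star_param addn0 eqxx; lia.
  have oe : validE p q k q 0 1 by split; try split; lia.
  have [O1 [O2 [ne e]]] := Phi_fiber_pair F kn oe hs; apply: ne.
  have [h1 p1] : Phi_fiber k (@stratumE F p q k q 0 1) O1 by rewrite e; left.
  have [h2 p2] : Phi_fiber k (@stratumE F p q k q 0 1) O2 by rewrite e; right.
  by apply: inj; rewrite ?inE // p1 p2.
have single r s t : validE p q k r s t ->
    exists O : set (ptX F p q), Phi_fiber k (@stratumE F p q k r s t) = [set O].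
  move=> oe; apply: Phi_fiber_single => // -[_ /andP[/andP[/eqP ? ?] ?]]; lia.
split; first exact: Phi_fun.
  move=> O1 O2; rewrite !inE => h1 h2 e.
  have [r [s [t [oe eN]]]] := orbitsEP (Phi_fun h1).
  have [O eO] := single r s t oe.
  have f1 : Phi_fiber k (@stratumE F p q k r s t) O1 by split.
  have f2 : Phi_fiber k (@stratumE F p q k r s t) O2 by split=> //=; rewrite -e.
  by move: f1 f2; rewrite eO => -> ->.
move=> N /orbitsEP[r [s [t [oe ->]]]]; have [O eO] := single r s t oe.
have [h1 h2] : Phi_fiber k (@stratumE F p q k r s t) O by rewrite eO.
by exists O.
Qed.

Theorem corollary2p14 (R : realType) (p q k : nat)
    (n_ge1 : (1 <= p + q)%N) (k_le_n : (k <= p + q)%N) :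
  [/\ set_fun (@orbitsX R[i] p q k) (@orbitsE R[i] p q k) (@Phi R[i] p q k),
      (* (a) *)
      forall (r s : nat) (mu : seq int), Pi2k p q k r s mu ->
        [\/ typeI p r s mu, typeII_zero p q k r s mu | typeIII p r s mu] ->
        exists O : set (ptX R[i] p q),
          Phi_fiber k (@paramOrbitE R[i] p q r s mu) = [set O],
      (* (b) *)
      forall (r s : nat) (mu : seq int), Pi2k p q k r s mu ->
        typeII_star p q k r s mu ->
        exists O1 O2 : set (ptX R[i] p q), O1 <> O2 /\
          Phi_fiber k (@paramOrbitE R[i] p q r s mu) = [set O1; O2]
    & (* (c) *)
      set_bij (@orbitsX R[i] p q k) (@orbitsE R[i] p q k) (@Phi R[i] p q k) <->
      (p <= maxn k (maxn (p + q - k) (q + 1)))%N].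
Proof.
split.
- exact: Phi_fun.
- move=> r s mu hmu [hT|[hT ns]|hT].
  + have ok := param_valid hmu (or_introl (conj hT erefl)).
    have [x12 x13 _] := types_excl hmu.
    rewrite (paramOrbit_stratumE (t :=
      0) R[i] hmu) //; [|by move=> h; case: x12|by move=> h; case: x13|by constructor 1].
    by apply: Phi_fiber_single => // -[].
  + have ok := param_valid hmu (or_intror (or_introl (conj hT erefl))).
    have [x12 _ x23] := types_excl hmu.
    rewrite (paramOrbit_stratumE (t :=
      1) R[i] hmu) //; [|by move=> h; case: x12|by move=> h; case: x23|by constructor 2].
    by apply: Phi_fiber_single => // -[_ /(star_relP r s k_le_n)].
  have ok := param_valid hmu (or_intror (or_intror (conj hT erefl))).
  have [_ x13 x23] := types_excl hmu.
  rewrite (paramOrbit_stratumE (t :=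
    2) R[i] hmu) //; [|by move=> h; case: x13|by move=> h; case: x23|by constructor 3].
  by apply: Phi_fiber_single => // -[].
- move=> r s mu hmu [hT hs].
  have ok := param_valid hmu (or_intror (or_introl (conj hT erefl))).
  have [x12 _ x23] := types_excl hmu.
  rewrite (paramOrbit_stratumE (t :=
    1) R[i] hmu) //; [|by move=> h; case: x12|by move=> h; case: x23|by constructor 2].
  by apply: Phi_fiber_pair => //; apply/(star_relP r s k_le_n).
exact: Phi_bij.
Qed.
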